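(* If $w$ is a symplectic Hecke word then $\mathrm{Des}(w)=\mathrm{Des}(Q_{\mathsf{Sp}}(w))$.
   Context: **Words.** $\mathbb{P}=\{1,2,3,\dots\}$, $[n]=\{1,\dots,n\}$. A word is a finite sequence of positive integers. $\mathfrak{S}_\infty$ is the group of finitely supported permutations of $\mathbb{P}$, $s_i=(i,i+1)$, $\Theta(i)=i-(-1)^i$, $\mathfrak{F}_\infty=\{\pi^{-1}\Theta\pi:\pi\in\mathfrak{S}_\infty\}$. Let $\mathcal{N}_\infty$ be the free $\mathbb{Z}$-module with basis $\{N_z:z\in\mathfrak{F}_\infty\}$ and let $U_i$ ($i\in\mathbb{P}$) act on it on the right, linearly, by $N_zU_i=N_{s_izs_i}$ if $z(i)<z(i+1)$; $N_z$ if $i+1\neq z(i)>z(i+1)\neq i$; $0$ if $i+1=z(i)>z(i+1)=i$. A symplectic Hecke word is a word $i_1\cdots i_l$ with $N_\Theta U_{i_1}\cdots U_{i_l}=N_z$ for some $z\in\mathfrak{F}_\infty$. **Tableaux.** A tableau is a map $T$ from a finite subset of $\mathbb{P}\times\mathbb{P}$ (its shape) to $\mathbb{P}$; $(i,j)\in T$ means $(i,j)$ is in the shape, and $T_{ij}=T(i,j)$. Position $(i,j)$ is in row $i$, column $j$. $T$ has $m$ rows (resp. $n$ columns) if its shape is contained in $[m]\times\mathbb{P}$ but not $[m-1]\times\mathbb{P}$ (resp. $\mathbb{P}\times[n]$ but not $\mathbb{P}\times[n-1]$); the empty tableau $\emptyset$ has $0$ of each. $T$ is increasing if $T_{ab}<T_{xy}$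 whenever $(a,b)\neq(x,y)$ are in $T$ with $a\le x,b\le y$. $T$ is shifted if its shape is $\{(i,i+j-1):1\le j\le\lambda_i\}$ for a strict partition $\lambda$. A set-valued tableau is a map from a finite subset of $\mathbb{P}\times\mathbb{P}$ (its shape) to nonempty finite subsets of $\{1'<1<2'<2<\cdots\}$; it is shifted if its shape is $\{(i,i+j-1):1\le j\le\lambda_i\}$ for a strict partition $\lambda$, and $|T|$ is the sum of the sizes of its entries. A shifted set-valued tableau $T$ is standard if $\max T_{ab}<\min T_{xy}$ whenever $(a,b)\neq(x,y)$ are in $T$ with $a\le x,b\le y$, no primed number is in a box $(i,i)$, and exactly one of $i,i'$ appears in some box for each $i\in\{1,\dots,|T|\}$. **Shifted insertion states.** A shifted insertion state is a tableau that is either (a) increasing, shifted and nonempty (then called terminal), or (b) formed from an increasing shifted tableau with $m-2$ rows and $n-2$ columns by adding one extra box, the outer box, at a position in $[m-1]\times\{n\}$ or $\{m\}\times[n-1]$. **Forward transitions.** Each non-terminal state $U$ (with $m-2$ rows and $n-2$ columns when its outer box is removed) has a unique labelled forward transition $U\to V$: *Outer box $(i,n)$.* If $U_{in}$ is maximal in its row, let $j\ge i$ be minimal with $(i,j)\notin U$. (R1) If moving the outer box to $(i,j)$ gives an increasing shifted tableau, $V$ is that tableau; (R2) otherwise $V$ is $U$ with the outer box removed. The label is $(i,j)$. If $U_{in}$ is not maximal in its row, let $x$ be minimal with $(i,x)\in U$, $U_{in}<U_{ix}$, and let $U'$ be formed from $U$ by replacing the value in $(i,x)$ by $U_{in}$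 and removing the outer box. The label is $(i,x)$. If $i<x$: (R3) if $U'$ is not increasing, and $i+1<x$ or row $i+1$ of $U$ is nonempty, $V$ is formed from $U$ by moving the outer box to $(i+1,n)$ and changing its value to $U_{ix}$; (R4) if $U'$ is increasing, $V$ is $U'$ with an outer box of value $U_{ix}$ added at $(i+1,n)$; (D1) if $U_{ii}\le U_{in}<U_{i,i+1}$ (so $x=i+1$), row $i+1$ of $U$ is empty, and $U'$ is not increasing, $V$ is formed from $U$ by moving the outer box to $(m,i+1)$ and changing its value to $U_{i,i+1}$. If $x=i$: (D2) if $U_{in}\equiv U_{ii}\pmod 2$ and $U'$ is not increasing, $V$ is formed from $U$ by moving the outer box to $(m,i+1)$ and changing its value to $U_{ii}$; (D3) if $U_{in}\equiv U_{ii}\pmod 2$ and $U'$ is increasing, $V$ is $U'$ with an outer box of value $U_{ii}$ added at $(m,i+1)$; (D4) if $U_{in}\not\equiv U_{ii}\pmod 2$, $V$ is formed from $U$ by moving the outer box to $(m,i+1)$ and changing its value to $U_{ii}+1$. *Outer box $(m,j)$.* If $U_{mj}$ is maximal in its column, let $i$ be minimal with $(i,j)\notin U$. (C1) If moving the outer box to $(i,j)$ gives an increasing shifted tableau, $V$ is that tableau; (C2) otherwise $V$ is $U$ with the outer box removed. The label is $(i,j)$. If $U_{mj}$ is not maximal in its column, let $x$ be minimal with $(x,j)\in U$, $U_{mj}<U_{xj}$, and let $U'$ be formed from $U$ by replacing the value in $(x,j)$ by $U_{mj}$ and removing the outer box. The label is $(x,j)$. (C3) If $U'$ is not increasing, $V$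 is formed from $U$ by moving the outer box to $(m,j+1)$ and changing its value to $U_{xj}$; (C4) if $U'$ is increasing, $V$ is $U'$ with an outer box of value $U_{xj}$ added at $(m,j+1)$. **Insertion.** For an increasing shifted tableau $T$ and $a\in\mathbb{P}$, $T\oplus a$ is the state formed by adding $a$ to the second unoccupied box of the first row of $T$. Following forward transitions from $T\oplus a$ leads to a unique terminal state, denoted $T\xleftarrow{\mathsf{Sp}}a$; the sequence of transitions is the insertion path. For $w=w_1\cdots w_n$, $P_{\mathsf{Sp}}(w)=(\cdots((\emptyset\xleftarrow{\mathsf{Sp}}w_1)\xleftarrow{\mathsf{Sp}}w_2)\cdots)\xleftarrow{\mathsf{Sp}}w_n$. For a symplectic Hecke word $w=w_1\cdots w_n$, the standard shifted set-valued tableau $Q_{\mathsf{Sp}}(w)$ is defined inductively: $Q_{\mathsf{Sp}}(\emptyset)=\emptyset$; if $n>0$ and the last transition in the insertion path of $P_{\mathsf{Sp}}(w_1\cdots w_{n-1})\xleftarrow{\mathsf{Sp}}w_n$ has label $(i,j)$, form $Q_{\mathsf{Sp}}(w)$ from $Q_{\mathsf{Sp}}(w_1\cdots w_{n-1})$ by adding: $n$ to box $(i,j)$ if its type is (R1); $n'$ to box $(i,j)$ if (C1); $n$ to the last (highest row index) box in column $j-1$ if (R2); $n'$ to the last (highest column index) box in row $i-1$ if (C2). **Descents.** For a word $w=w_1\cdots w_n$, $\mathrm{Des}(w)=\{i\in[n-1]:w_i>w_{i+1}\}$. For a standard shifted set-valued tableau $T$ with $|T|=n$, $\mathrm{Des}(T)$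 is the set of $i\in[n-1]$ such that one of the following holds: $i$ appears in $T$ and $(i+1)'$ appears in $T$; $i$ appears in $T$ and $i+1$ appears in $T$ in a row above $i$ (larger row index); $i'$ appears in $T$ and $(i+1)'$ appears in $T$ in a column to the right of $i'$ (larger column index). *)

(* Defs.v *)
From HB Require Import structures.
From mathcomp Require Import all_boot ssralg ssrint.
From mathcomp Require Import finmap.
From mathcomp Require Import boolp.
From mathcomp Require freeg.

Set Implicit Arguments.
Unset Strict Implicit.
Unset Printing Implicit Defensive.

(* The set P of positive integers is encoded in nat: 0 is never
   a letter, and rows and columns of boxes are numbered from 1. *)

Section SymplecticHecke.
Import GRing.Theory freeg.

(* i - (-1)^i for i > 0, and Theta 0 = 0. *)
Definition Theta (i : nat) : nat := if odd i then i.+1 else i.-1.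

Definition finitely_supported (f : nat -> nat) : Prop :=
  exists N, forall i, N < i -> f i = i.

(* pi' is the inverse of pi. *)
Definition Sinf (pi pi' : nat -> nat) : Prop :=
  [/\ cancel pi pi', cancel pi' pi, pi 0 = 0 & finitely_supported pi].

Definition Finf_pred (z : nat -> nat) : Prop :=
  exists pi pi', Sinf pi pi' /\ z = pi' \o Theta \o pi.

Record Finf := MkFinf { Finf_fun :> nat -> nat; Finf_prop : Finf_pred Finf_fun }.

HB.instance Definition _ := gen_eqMixin Finf.
HB.instance Definition _ := gen_choiceMixin Finf.

(* The transposition (i, i+1); 0 is not in P, so s_ 0 is set to the identity. *)
Definition s_ (i : nat) (k : nat) : nat :=
  if i == 0 then k else if k == i then i.+1 else if k == i.+1 then i else k.

Lemma s_K i : involutive (s_ i).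
Proof.
move=> k; rewrite /s_; case: (i =P 0) => // _.
case: (k =P i) => [->|ki]; first by rewrite eqxx gtn_eqF.
case: (k =P i.+1) => [->|kSi]; first by rewrite eqxx.
by move/eqP/negbTE: ki => ->; move/eqP/negbTE: kSi => ->.
Qed.

Lemma s_Sinf i : Sinf (s_ i) (s_ i).
Proof.
split; [exact: s_K | exact: s_K | by case: i |].
exists i.+1 => k ik; rewrite /s_; case: ifP => // _.
by rewrite !gtn_eqF // ltnW.
Qed.

Lemma Sinf_comp p p' q q' : Sinf p p' -> Sinf q q' -> Sinf (p \o q) (q' \o p').
Proof.
move=> [pK p'K p0 [N pN]] [qK q'K q0 [M qM]]; split.
- exact: can_comp.
- exact: can_comp.
- by rewrite /= q0.
- exists (maxn N M) => i; rewrite gtn_max => /andP[Ni Mi].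
  by rewrite /= qM // pN.
Qed.

Lemma Theta_in_Finf : Finf_pred Theta.
Proof. by exists id, id; split=> //; split=> //; exists 0. Qed.

Definition ThetaF : Finf := MkFinf Theta_in_Finf.

Lemma conj_in_Finf i (z : Finf) : Finf_pred (s_ i \o z \o s_ i).
Proof.
have [p [p' [hp zE]]] := Finf_prop z; exists (p \o s_ i), (s_ i \o p').
by split; [exact: Sinf_comp hp (s_Sinf i) | rewrite zE].
Qed.

Definition conjF (i : nat) (z : Finf) : Finf := MkFinf (conj_in_Finf i z).

Definition Ninf := {freeg Finf / int}.

Definition N_ (z : Finf) : Ninf := << z >>%R.

Definition U_basis (i : nat) (z : Finf) : Ninf :=
  if z i < z i.+1 then N_ (conjF i z)
  else if (z i != i.+1) && (z i.+1 != i) then N_ z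
  else 0%R.

Definition U_ (i : nat) : Ninf -> Ninf := fglift (U_basis i).

Lemma U_N i z : U_ i (N_ z) = U_basis i z.
Proof. by rewrite /U_ /N_ liftU scale1r. Qed.

Definition symplectic_Hecke_word (w : seq nat) : Prop :=
  all (leq 1) w /\ exists z : Finf, foldl (fun x i => U_ i x) (N_ ThetaF) w = N_ z.

End SymplecticHecke.

Local Open Scope fset_scope.
Local Open Scope fmap_scope.

Definition pos := (nat * nat)%type.

Definition tableau := {fmap pos -> nat}.

Definition entry (T : tableau) (p : pos) : nat := odflt 0 T.[? p].

Definition nrows (T : tableau) : nat := \max_(p <- domf T) p.1.
Definition ncols (T : tableau) : nat := \max_(p <- domf T) p.2.

Definition increasing (T : tableau) : bool :=
  all (fun p => all (fun q =>
    [&& p != q, p.1 <= q.1 & p.2 <= q.2] ==> (entry T p < entry T q))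
  (domf T)) (domf T).

Definition strict_partition (lam : seq nat) : bool :=
  sorted gtn lam && (0 \notin lam).

Definition shifted_shape (lam : seq nat) : {fset pos} :=
  [fset p in [seq (i, (i + j).-1) | i <- iota 1 (size lam),
                                     j <- iota 1 (nth 0 lam i.-1)]].

Definition shifted (T : tableau) : bool :=
  `[< exists2 lam, strict_partition lam & domf T = shifted_shape lam >].

(* [outer] is the position of the outer box, which belongs to the tableau [tab];
   [outer] is [None] for a terminal state.  This position is determined by [tab]. *)
Record state := State { tab : tableau; outer : option pos }.

Inductive transition_type :=
  R1 | R2 | R3 | R4 | D1 | D2 | D3 | D4 | C1 | C2 | C3 | C4.

Record transition := Transition {
  tr_type : transition_type;
  tr_label : pos;
  tr_target : state
}.

(* 0 if no k in [lo, hi] satisfies P; the bounds used below always admit one. *)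
Definition least (P : pred nat) (lo hi : nat) : nat :=
  head 0 [seq k <- index_iota lo hi.+1 | P k].

Definition terminal_state (T : tableau) : state := State T None.

Definition add_outer (T : tableau) (p : pos) (a : nat) : state :=
  State T.[p <- a] (Some p).

(* The outer box of U is (i, n); m-2 and n-2 are the numbers of rows and columns
   of U without its outer box. *)
Definition row_transition (U : tableau) (m n i : nat) : transition :=
  let T := U.[~ (i, n)] in
  let a := entry U (i, n) in
  if all (fun p => (p.1 == i) ==> (entry U p <= a)) (domf U) then
    let j := least (fun j => (i, j) \notin domf U) i n in
    let V := T.[(i, j) <- a] in
    if increasing V && shifted V then Transition R1 (i, j) (terminal_state V)
    else Transition R2 (i, j) (terminal_state T)
  else
    let x := least (fun x => ((i, x) \in domf U) && (a < entry U (i, x))) 1 n in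
    let b := entry U (i, x) in
    let U' := T.[(i, x) <- a] in
    if i < x then
      if increasing U' then Transition R4 (i, x) (add_outer U' (i.+1, n) b)
      else if (i.+1 < x) || has (fun p => p.1 == i.+1) (domf U) then
        Transition R3 (i, x) (add_outer T (i.+1, n) b)
      else (* x = i+1, and U_{ii} <= a < U_{i,i+1} by minimality of x *)
        Transition D1 (i, x) (add_outer T (m, i.+1) b)
    else (* x = i *)
      if odd a == odd b then
        if increasing U' then Transition D3 (i, x) (add_outer U' (m, i.+1) b)
        else Transition D2 (i, x) (add_outer T (m, i.+1) b)
      else Transition D4 (i, x) (add_outer T (m, i.+1) b.+1).

(* The outer box of U is (m, j). *)
Definition col_transition (U : tableau) (m j : nat) : transition :=
  let T := U.[~ (m, j)] in
  let a := entry U (m, j) in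
  if all (fun p => (p.2 == j) ==> (entry U p <= a)) (domf U) then
    let i := least (fun i => (i, j) \notin domf U) 1 m in
    let V := T.[(i, j) <- a] in
    if increasing V && shifted V then Transition C1 (i, j) (terminal_state V)
    else Transition C2 (i, j) (terminal_state T)
  else
    let x := least (fun x => ((x, j) \in domf U) && (a < entry U (x, j))) 1 m in
    let b := entry U (x, j) in
    let U' := T.[(x, j) <- a] in
    if increasing U' then Transition C4 (x, j) (add_outer U' (m, j.+1) b)
    else Transition C3 (x, j) (add_outer T (m, j.+1) b).

Definition forward (S : state) : option transition :=
  if outer S is Some (r, c) then
    let T := (tab S).[~ (r, c)] in
    let m := (nrows T).+2 in
    let n := (ncols T).+2 in
    Some (if c == n then row_transition (tab S) m n r
          else col_transition (tab S) m c)
  else None.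

Fixpoint follow (k : nat) (S : state) : seq transition :=
  if k isn't k'.+1 then [::]
  else if forward S is Some t then t :: follow k' (tr_target t) else [::].

Definition oplus (T : tableau) (a : nat) : state :=
  let c1 := least (fun j => (1, j) \notin domf T) 1 (ncols T).+1 in
  let c2 := least (fun j => (1, j) \notin domf T) c1.+1 (ncols T).+2 in
  add_outer T (1, c2) a.

(* Each transition moves the outer box to the next row, or to row m, or to the
   next column, so m + n bounds the number of transitions; see
   [insertion_path_terminal] below. *)
Definition insertion_path (T : tableau) (a : nat) : seq transition :=
  follow ((nrows T).+2 + (ncols T).+2) (oplus T a).

Definition insertion_end (T : tableau) (a : nat) : state :=
  last (oplus T a) (map tr_target (insertion_path T a)).

Lemma least_eq (P : pred nat) lo hi k :
  lo <= k <= hi -> P k -> (forall j, lo <= j < k -> ~~ P j) -> least P lo hi = k.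
Proof.
move=> /andP[lok khi] Pk kmin; rewrite /least.
rewrite /index_iota -(subnKC lok) in kmin *.
have -> : (hi.+1 - lo = (k - lo) + (hi.+1 - k))%N.
  by rewrite addnC addnBA // subnK // ltnW.
rewrite iotaD filter_cat subnKC //.
rewrite (_ : [seq j <- _ | _] = [::]) /=; last first.
  apply/eqP; rewrite -(negbK (_ == _)) -has_filter; apply/hasPn => j.
  by rewrite mem_iota => /kmin.
by rewrite subSn //= Pk.
Qed.

Lemma least_mem (P : pred nat) lo hi k :
  lo <= k <= hi -> P k -> P (least P lo hi).
Proof.
move=> khi Pk; rewrite /least.
have: k \in [seq k <- index_iota lo hi.+1 | P k].
  by rewrite mem_filter Pk mem_index_iota ltnS.
by case E: [seq _ <- _ | _] => [//|h s] _ /=; have := mem_head h s;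
  rewrite -E mem_filter => /andP[].
Qed.

Lemma nrows_ge (T : tableau) p : p \in domf T -> p.1 <= nrows T.
Proof. by move=> pT; rewrite /nrows (big_rem p) //= leq_maxl. Qed.

Lemma ncols_ge (T : tableau) p : p \in domf T -> p.2 <= ncols T.
Proof. by move=> pT; rewrite /ncols (big_rem p) //= leq_maxl. Qed.

Lemma mem_shifted_shape lam i j : ((i, j) \in shifted_shape lam) =
  [&& 0 < i, i <= size lam, i <= j & j < i + nth 0 lam i.-1].
Proof.
rewrite /shifted_shape in_fset /=; apply/idP/idP.
  case/allpairsPdep => i' [j' [hi hj [-> ->]]].
  move: hi hj; rewrite !mem_iota !add1n !ltnS => /andP[i0 ->] /andP[j0 jl].
  rewrite i0 /= -{1}(prednK j0) addnS /= leq_addr /=.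
  by rewrite -(prednK j0) addnS /= -addnS prednK // leq_add2l.
case/and4P => i0 il ij jl; apply/allpairsPdep.
exists i, (j - i)%N.+1; rewrite !mem_iota !add1n !ltnS i0 il /=; split=> //.
  by rewrite -(ltn_add2l i) subnKC.
by rewrite addnS subnKC.
Qed.

Lemma strict_partition_nth lam i : strict_partition lam ->
  i < size lam -> i + nth 0 lam i <= nth 0 lam 0.
Proof.
case/andP => slam _; elim: i => [|i IH] il; first by rewrite add0n.
apply: leq_trans (IH (ltnW il)); rewrite addSnnS leq_add2l.
have := sorted_ltn_nth (fun y x z (h1 : y < x) h2 => ltn_trans h2 h1 : z < x) 0 slam.
by apply; rewrite ?inE // ltnW.
Qed.

Definition upper (T : tableau) : Prop :=
  forall q, q \in domf T -> 0 < q.1 <= q.2.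

Lemma upper_nrows T : upper T -> nrows T <= ncols T.
Proof.
move=> uT; rewrite /nrows; apply/bigmax_leqP_seq => p pT _.
by have /andP[_ h] := uT _ pT; exact: leq_trans h (ncols_ge pT).
Qed.

Lemma shifted_upper T : shifted T -> upper T.
Proof.
case/asboolP => lam _ dT [i j].
by rewrite dT mem_shifted_shape => /and4P[/= -> _ ->].
Qed.

Lemma shifted_row1 T j : shifted T -> ((1, j) \in domf T) = (0 < j <= ncols T).
Proof.
case/asboolP => lam hlam dT.
have -> : ncols T = nth 0 lam 0.
  apply/eqP; rewrite eqn_leq; apply/andP; split.
    rewrite /ncols; apply/bigmax_leqP_seq => -[i k] + _.
    rewrite dT mem_shifted_shape /= => /and4P[i0 il _].
    rewrite -{1}(prednK i0) addSn ltnS => kl.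
    by apply: leq_trans kl (strict_partition_nth hlam _); rewrite prednK.
  case E: (nth 0 lam 0) => [//|l].
  apply: (@ncols_ge T (1, l.+1)).
  by rewrite dT mem_shifted_shape /= E add1n ltnSn andbT; case: (lam) E.
rewrite dT mem_shifted_shape /= add1n ltnS.
by case: (lam) => [|h s] //=; case: j.
Qed.

Lemma rm_outer (T : tableau) p a : p \notin domf T -> T.[p <- a].[~ p] = T.
Proof.
move=> pT; apply/fmapP => q; rewrite fnd_rem1 fnd_set.
by case: eqP => //= ->; rewrite not_fnd.
Qed.

Lemma domf_upd (T : tableau) p a : p \in domf T -> domf T.[p <- a] = domf T.
Proof.
by move=> pT; apply/fsetP => q; rewrite dom_setf !inE; case: eqP => // ->.
Qed.

Lemma forward_progress (T : tableau) p a :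
  let m := (nrows T).+2 in let n := (ncols T).+2 in
  upper T -> (p.1 < m /\ p.2 = n) \/ (p.1 = m /\ p.2 < n) ->
  exists t, forward (add_outer T p a) = Some t /\
    (outer (tr_target t) = None \/
     exists T' q b, [/\ tr_target t = add_outer T' q b, domf T' = domf T &
       (p.2 = n /\ p.1 < q.1 /\ q.1 < m /\ q.2 = n) \/
       (q.1 = m /\ q.2 < n /\ (p.2 = n \/ p.2 < q.2))]).
Proof.
move=> m n uT hp; have mn := upper_nrows uT.
have pT : p \notin domf T.
  apply/negP => pT; have := (nrows_ge pT, ncols_ge pT).
  by case: hp => -[h1 h2] []; rewrite ?h1 ?h2 => l1 l2;
    [move: l2 | move: l1]; rewrite ltnNge leqnSn.
have ent : entry T.[p <- a] p = a by rewrite /entry fnd_set eqxx.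
have domU q : (q \in domf T.[p <- a]) = (q == p) || (q \in domf T).
  by rewrite dom_setf !inE.
have greater q : q \in domf T.[p <- a] -> a < entry T.[p <- a] q -> q \in domf T.
  by rewrite domU; case: eqP => //= ->; rewrite ent ltnn.
rewrite /forward /add_outer /=; case: p hp pT ent domU greater => r c /= hp pT ent domU gr.
rewrite rm_outer // -/m -/n; eexists; split; first by [].
case: hp => -[hr hc].
  rewrite hc in pT ent domU gr *.
  rewrite eqxx /row_transition rm_outer // ent.
  case: ifP => [_|/negbT/allPn[q qU]]; first by case: ifP => _; left.
  rewrite negb_imply -ltnNge => /andP[/eqP qr aq].
  have qT := gr _ qU aq.
  have rm : r.+1 < m by rewrite -qr !ltnS nrows_ge.
  have rn : r.+1 < n by apply: leq_trans rm _; rewrite !ltnS.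
  right; set x := least _ 1 n.
  have xT : (r, x) \in domf T.
    have : ((r, x) \in domf T.[(r, n) <- a]) && (a < entry T.[(r, n) <- a] (r, x)).
      apply: (@least_mem (fun y => ((r, y) \in domf T.[(r, n) <- a]) &&
                         (a < entry T.[(r, n) <- a] (r, y))) 1 n q.2).
        have /andP[q1 q12] := uT _ qT; rewrite (leq_trans q1 q12) /=.
        by rewrite (leq_trans (ncols_ge qT)) // /n ltnW.
      by rewrite (_ : (r, q.2) = q) ?qU //; case: (q) qr => ? ? /= ->.
    by case/andP; exact: gr.
  have dx := domf_upd a xT.
  by do ![case: ifP => _]; do 3!eexists; split; try reflexivity; rewrite ?dx //=;
    [left | left | right | right | right | right]; do !split; try left.
rewrite hr in pT ent domU gr *.
rewrite ltn_eqF // /col_transition rm_outer // ent.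
case: ifP => [_|/negbT/allPn[q qU]]; first by case: ifP => _; left.
rewrite negb_imply -ltnNge => /andP[/eqP qc aq].
have qT := gr _ qU aq.
have cn : c.+1 < n by rewrite -qc !ltnS ncols_ge.
right; set x := least _ 1 m.
have xT : (x, c) \in domf T.
  have : ((x, c) \in domf T.[(m, c) <- a]) && (a < entry T.[(m, c) <- a] (x, c)).
    apply: (@least_mem (fun y => ((y, c) \in domf T.[(m, c) <- a]) &&
                       (a < entry T.[(m, c) <- a] (y, c))) 1 m q.1).
      have /andP[q1 _] := uT _ qT; rewrite q1 /=.
      by rewrite (leq_trans (nrows_ge qT)) // /m ltnW.
    by rewrite (_ : (q.1, c) = q) ?qU //; case: (q) qc => ? ? /= ->.
  by case/andP; exact: gr.
have dx := domf_upd a xT.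
by case: ifP => _; do 3!eexists; split; try reflexivity; rewrite ?dx //=;
  right; do !split => //; right.
Qed.

Lemma follow_terminal k (T : tableau) p a :
  let m := (nrows T).+2 in let n := (ncols T).+2 in
  upper T -> (p.1 < m /\ p.2 = n) \/ (p.1 = m /\ p.2 < n) ->
  (if p.2 == n then (m - p.1) + n else n - p.2)%N <= k ->
  outer (last (add_outer T p a)
              (map tr_target (follow k (add_outer T p a)))) = None.
Proof.
elim: k T p a => [|k IH] T p a m n uT hp.
  case: ifP => [_|pn]; first by rewrite /n addnS.
  by case: hp => -[_]; [move/eqP; rewrite pn | rewrite -subn_gt0 lt0n leqn0 => /negbTE->].
move=> hk; have [t [ft ht]] := forward_progress a uT hp.
rewrite [follow _ _]/= ft [map _ _]/= [last _ _]/=.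
case: ht => [tN|[T' [q [b [-> dT' hq]]]]].
  by case: k {IH hk} => //= k; rewrite /forward tN.
have mE : nrows T' = nrows T by rewrite /nrows dT'.
have nE : ncols T' = ncols T by rewrite /ncols dT'.
apply: IH; rewrite ?mE ?nE -/m -/n.
- by move=> z; rewrite dT'; exact: uT.
- by case: hq => [[_ [_ [? ?]]]|[? [? _]]]; [left | right].
rewrite -ltnS; apply: leq_trans hk.
case: hq => [[pn [pq [qm qn]]]|[qm [qn pq]]].
  by rewrite pn qn eqxx ltn_add2r ltn_sub2l // (ltn_trans pq).
rewrite (ltn_eqF qn); case: pq => [pn|pq].
  case: hp => -[pm pn']; last by rewrite pn ltnn in pn'.
  rewrite pn eqxx (leq_ltn_trans (leq_subr _ _)) // -{1}(add0n n) ltn_add2r.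
  by rewrite subn_gt0.
by rewrite (ltn_eqF (ltn_trans pq qn)) ltn_sub2l // (ltn_trans pq).
Qed.

(* The bound in [insertion_path] suffices to reach a terminal state. *)
Lemma insertion_path_terminal (T : tableau) (a : nat) :
  shifted T -> outer (insertion_end T a) = None.
Proof.
move=> sT; rewrite /insertion_end /insertion_path /oplus.
have -> : least (fun j => (1, j) \notin domf T) 1 (ncols T).+1 = (ncols T).+1.
  apply: least_eq; rewrite ?leqnn //; first by rewrite shifted_row1 // ltnn.
  by move=> j; rewrite shifted_row1 // negbK ltnS.
have -> : least (fun j => (1, j) \notin domf T) (ncols T).+2 (ncols T).+2
          = (ncols T).+2.
  apply: least_eq; rewrite ?leqnn //.
    by rewrite shifted_row1 // negb_and orbC -ltnNge ltnW.
  by move=> j /andP[h1 h2]; move: (leq_ltn_trans h1 h2); rewrite ltnn.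
apply: follow_terminal; first exact: shifted_upper.
  by left.
by rewrite eqxx leq_add2r leq_subr.
Qed.

Definition insertSp (T : tableau) (a : nat) : tableau := tab (insertion_end T a).

Definition PSp (w : seq nat) : tableau := foldl insertSp [fmap] w.

(* (k, false) stands for k and (k, true) for k'. *)
Definition letter := (nat * bool)%type.

Definition sv_tableau := {fmap pos -> {fset letter}}.

Definition sv_entry (Q : sv_tableau) (p : pos) : {fset letter} :=
  odflt fset0 Q.[? p].

Definition add_letter (Q : sv_tableau) (p : pos) (x : letter) : sv_tableau :=
  Q.[p <- x |` sv_entry Q p].

Definition last_in_col (Q : sv_tableau) (c : nat) : pos :=
  (\max_(p <- domf Q | p.2 == c) p.1, c).

Definition last_in_row (Q : sv_tableau) (r : nat) : pos :=
  (r, \max_(p <- domf Q | p.1 == r) p.2).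

(* A path that reaches a terminal state ends with R1, R2, C1 or C2. *)
Definition record_step (Q : sv_tableau) (k : nat) (path : seq transition) :
    sv_tableau :=
  if rev path is t :: _ then
    let: (i, j) := tr_label t in
    match tr_type t with
    | R1 => add_letter Q (i, j) (k, false)
    | C1 => add_letter Q (i, j) (k, true)
    | R2 => add_letter Q (last_in_col Q j.-1) (k, false)
    | C2 => add_letter Q (last_in_row Q i.-1) (k, true)
    | _ => Q
    end
  else Q.

Definition QSp (w : seq nat) : sv_tableau :=
  foldl (fun Q k =>
           record_step Q k (insertion_path (PSp (take k.-1 w)) (nth 0 w k.-1)))
        [fmap] (iota 1 (size w)).

Definition word_Des (w : seq nat) : {fset nat} :=
  [fset i in iota 1 (size w).-1 | nth 0 w i < nth 0 w i.-1].

Definition sv_size (Q : sv_tableau) : nat := \sum_(p <- domf Q) #|` sv_entry Q p|.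

Definition appear (Q : sv_tableau) (x y : letter) (R : rel pos) : bool :=
  has (fun p => (x \in sv_entry Q p) &&
                has (fun q => (y \in sv_entry Q q) && R p q) (domf Q)) (domf Q).

Definition tab_Des (Q : sv_tableau) : {fset nat} :=
  [fset i in iota 1 (sv_size Q).-1 |
    [|| appear Q (i, false) (i.+1, true) (fun _ _ => true),
        appear Q (i, false) (i.+1, false) (fun p q => p.1 < q.1)
      | appear Q (i, true) (i.+1, true) (fun p q => p.2 < q.2)]].

(* Main.v *)
Require Import Defs.
From mathcomp Require Import ssreflect seq.
From HB Require Import structures.
From mathcomp Require Import all_boot ssralg ssrint.
From mathcomp Require Import finmap boolp zify.
From mathcomp Require freeg.

Set Implicit Arguments.
Unset Strict Implicit.
Unset Printing Implicit Defensive.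

(** Why insertion turns descents into descents.

    Insert a and then b into T, giving T1 and T2.  Each insertion is a path: a
    value travels up through the rows, may turn at the diagonal, and then travels
    to the right through the columns, until it is added to T or lost.  The two
    paths never cross.  If b < a, then b stays smaller than the first value in
    every line that both meet, so it is bumped at the same box or before it; the
    second path outlives the first one and ends in a column, if the first one
    does, strictly further to the right, and otherwise in a strictly higher row or
    in a column.  If a <= b, the second path is bumped at the same box or after it
    and ends no later ([rowins_lt], [rowins_le], and [colins_lt], [colins_le] for
    the part in the columns).  Translated into boxes of the recording tableau by
    [later_descends] and [earlier_descends], this is the theorem, letter by letter
    ([consecutive_descends]).

    The comparison fails for arbitrary words, at the turns.  It needs three facts:
    the diagonal entries of T are even; D1 occurs only if the entry that it bumps
    exceeds the diagonal entry by at least 2; D4 occurs only if the inserted value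
    is one less than the diagonal entry.  All of them follow from one invariant:
    N_Theta times the reading word of the current state is equal to N_Theta times
    the letters read so far, hence is not zero.  For an odd number could otherwise
    be commuted to the front of the reading word, and N_Theta U_a = 0 for a odd
    ([diag_even], [D1_gap], [D4_gap]).

    The invariant holds because every transition replaces the reading word by one
    that acts in the same way.  The operators U_i satisfy the relations of a
    0-Hecke algebra ([step_idem], [step_comm], [step_braid]), which accounts for
    all transitions but D4; the latter uses
    N_Theta U_a U_(a-1) = N_Theta U_a U_(a+1) for a even ([act_even]).  As long as
    the path is in the rows, states are read row by row, from the last row to the
    first one, and afterwards column by column; the two readings of an increasing
    shifted tableau agree up to commutations ([row_word_col_word]). *)

(** * The action of a letter on a basis element *)

(** The right action of U_i on the set consisting of the N_z and of 0, which is
    represented by None. *)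
Definition step (o : option Finf) (i : nat) : option Finf :=
  if o is Some z then
    if z i < z i.+1 then Some (conjF i z)
    else if (z i != i.+1) && (z i.+1 != i) then Some z else None
  else None.

Notation act := (foldl step).

Local Notation Theta_state := (Some ThetaF).

Section Freeg.
Import GRing.Theory freeg.

Definition emb (o : option Finf) : Ninf := if o is Some z then N_ z else 0%R.

Lemma U_emb i o : U_ i (emb o) = emb (step o i).
Proof.
case: o => [z|] /=; last by rewrite /U_ -[X in fglift _ X](subr0 0%R) lift_is_additive subrr.
by rewrite U_N /U_basis; case: ifP => // _; case: ifP.
Qed.

(** Each U_i sends a basis element to a basis element or to 0, so N_Theta times a
    word is some N_z exactly if it does not vanish. *)
Lemma symplectic_act w : symplectic_Hecke_word w ->
  all (leq 1) w /\ act Theta_state w <> None.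
Proof.
case=> w1 [z wz]; split => // wN.
have E o : foldl (fun x i => U_ i x) (emb o) w = emb (act o w).
  by elim: w {w1 wz wN} o => //= i w IH o; rewrite U_emb IH.
have := E Theta_state; rewrite /= wz wN /= => /eqP.
by rewrite freegU_eq0 oner_eq0.
Qed.

End Freeg.

Lemma act_cat o u v : act o (u ++ v) = act (act o u) v.
Proof. exact: foldl_cat. Qed.

Lemma Finf_ext (z y : Finf) : (forall k, z k = y k) -> z = y.
Proof.
case: z y => [f Pf] [g Pg] /= fg.
have E : f = g by apply: funext.
by case: g / E Pg fg => Pg _; congr MkFinf; exact: Prop_irrelevance.
Qed.

Lemma Theta_inv i : Theta (Theta i) = i.
Proof.
rewrite /Theta; case: (boolP (odd i)) => [h|]; first by rewrite /= h.
by case: i => //= i; rewrite negbK => ->.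
Qed.

(** The elements of F_infinity are the conjugates of Theta, hence involutions
    without fixed points in P. *)
Lemma Finf_facts (z : Finf) :
  [/\ forall k, z (z k) = k, z 0 = 0 & forall k, 0 < k -> z k != k].
Proof.
have [p [p' [[pK p'K p0 _] ->]]] := Finf_prop z; split => /=.
- by move=> k; rewrite p'K Theta_inv pK.
- by rewrite p0 -[RHS]pK p0.
- move=> k k0; apply/eqP => /(congr1 p); rewrite p'K.
  have pk0 : p k != 0 by apply/eqP => pk; have := pK k; rewrite pk -p0 pK => k00; rewrite -k00 in k0.
  rewrite /Theta; case: ifP; lia.
Qed.

Lemma s_l i : 0 < i -> s_ i i = i.+1.
Proof. by rewrite /s_ eqxx; case: i. Qed.
Lemma s_r i : 0 < i -> s_ i i.+1 = i.
Proof. by rewrite /s_; do ![case: eqP => //]; lia. Qed.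
Lemma s_o i k : k != i -> k != i.+1 -> s_ i k = k.
Proof. by rewrite /s_ => /negbTE -> /negbTE ->; case: eqP. Qed.

(** With the tactics below this replaces a nest of transpositions by its value,
    one case at a time. *)
Lemma sP i k : 0 < i -> (k = i /\ s_ i k = i.+1) \/
  ((k = i.+1 /\ s_ i k = i) \/ ((k <> i /\ k <> i.+1) /\ s_ i k = k)).
Proof.
move=> i0; case: (k =P i) => [->|?]; first by left; rewrite s_l.
case: (k =P i.+1) => [->|?]; first by right; left; rewrite s_r.
by right; right; split=> //; apply: s_o; apply/eqP.
Qed.

Ltac ssub i k := let i0 := fresh in let E := fresh in
  (have i0 : 0 < i by lia);
  case: (sP k i0) => [[? E]|[[? E]|[? E]]]; rewrite ?E; clear i0 E; try lia.

Ltac ss := repeat match goal with |- context [s_ ?i ?k] =>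
  lazymatch k with context [s_ _ _] => fail | _ => ssub i k end end.

Lemma conjE i z k : conjF i z k = s_ i (z (s_ i k)).
Proof. by []. Qed.

Lemma stepE z i : step (Some z) i = if z i < z i.+1 then Some (conjF i z)
  else if (z i != i.+1) && (z i.+1 != i) then Some z else None.
Proof. by []. Qed.

Lemma stepT (z : Finf) i : z i < z i.+1 -> step (Some z) i = Some (conjF i z).
Proof. by rewrite stepE => ->. Qed.
Lemma stepF (z : Finf) i : z i.+1 <= z i -> step (Some z) i =
  if (z i != i.+1) && (z i.+1 != i) then Some z else None.
Proof. by rewrite stepE ltnNge => ->. Qed.
Lemma stepS (z : Finf) i : z i.+1 <= z i -> z i != i.+1 -> z i.+1 != i ->
  step (Some z) i = Some z.
Proof. by move=> h h1 h2; rewrite stepF // h1 h2. Qed.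
Lemma stepN (z : Finf) i : z i = i.+1 -> z i.+1 = i -> step (Some z) i = None.
Proof. by move=> h1 h2; rewrite stepF h1 h2 ?eqxx. Qed.

Lemma step_idem o i : 0 < i -> step (step o i) i = step o i.
Proof.
move=> i0; case: o => [z|] //; have [zK z0 zN] := Finf_facts z.
have n1 := zN i i0; have n2 := zN i.+1 isT.
have K1 := zK i; have K2 := zK i.+1.
rewrite stepE; case: ifP => h.
  have h1 : z i != i.+1 by apply/eqP => E; move: K1; rewrite E; lia.
  have h2 : z i.+1 != i by apply/eqP => E; move: K2; rewrite E; lia.
  by rewrite stepE !conjE s_l // s_r // !s_o // ltnNge ltnW //= n1 n2.
by case: ifP => h' //; rewrite stepE h h'.
Qed.

Lemma step_comm o i j : 0 < i -> i.+1 < j ->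
  step (step o i) j = step (step o j) i.
Proof.
move=> i0 ij; have j0 : 0 < j by lia.
case: o => [z|] //; have [zK z0 zN] := Finf_facts z.
have vj : (conjF i z j = s_ i (z j)) * (conjF i z j.+1 = s_ i (z j.+1)).
  by rewrite !conjE (@s_o i j) ?(@s_o i j.+1) //; lia.
have vi : (conjF j z i = s_ j (z i)) * (conjF j z i.+1 = s_ j (z i.+1)).
  by rewrite !conjE (@s_o j i) ?(@s_o j i.+1) //; lia.
have cc : conjF j (conjF i z) = conjF i (conjF j z).
  apply: Finf_ext => k; rewrite !conjE.
  have S x : s_ i (s_ j x) = s_ j (s_ i x) by ss.
  by rewrite S -S.
have J x y : z x = y -> z y = x by move=> <-.
case: (boolP ((z j == i) && (z j.+1 == i.+1))) => [/andP[/eqP e1 /eqP e2]|e].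
  have d1 := J _ _ e1; have d2 := J _ _ e2.
  have EE : conjF j z = conjF i z.
    apply: Finf_ext => k; rewrite !conjE.
    case: (sP k i0) => [[-> ->]|[[-> ->]|[[a1 a2] ->]]].
    + by rewrite (@s_o j i) ?d1 ?d2 ?s_l ?s_o //; lia.
    + by rewrite (@s_o j i.+1) ?d1 ?d2 ?s_r ?s_o //; lia.
    + case: (sP k j0) => [[-> ->]|[[-> ->]|[[b1 b2] ->]]].
      * by rewrite ?e1 ?e2 ?s_l ?s_o //; lia.
      * by rewrite ?e1 ?e2 ?s_r ?s_o //; lia.
      * by rewrite !s_o //; apply/eqP => /J h; move: a1 a2 b1 b2;
          rewrite -h ?e1 ?e2 ?d1 ?d2; lia.
  have hi : z i < z i.+1 by rewrite d1 d2.
  have hj : z j < z j.+1 by rewrite e1 e2.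
  rewrite [in RHS](stepT hj) EE -(stepT hi) step_idem //.
  by rewrite (stepT hi) stepS ?vj ?e1 ?e2 ?s_l ?s_r //; lia.
have e' : ~~ ((z i == j) && (z i.+1 == j.+1)).
  by apply: contra e => /andP[/eqP /J -> /eqP /J ->]; rewrite !eqxx.
have g : z i < z i.+1 -> ~~ ((z j == i.+1) && (z j.+1 == i)).
  by move=> hi; apply/negP => /andP[/eqP /J h1 /eqP /J h2]; move: hi; rewrite h1 h2; lia.
have g' : z j < z j.+1 -> ~~ ((z i == j.+1) && (z i.+1 == j)).
  by move=> hi; apply/negP => /andP[/eqP /J h1 /eqP /J h2]; move: hi; rewrite h1 h2; lia.
have ni : z i != z i.+1 by apply/eqP => /(congr1 z); rewrite !zK; lia.
have nj : z j != z j.+1 by apply/eqP => /(congr1 z); rewrite !zK; lia.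
move: (z i) (z i.+1) (z j) (z j.+1) e e' g g' ni nj vi vj cc (@stepT z i) (@stepF z i)
  (@stepT z j) (@stepF z j) => A B C D e e' g g' ni nj vi vj cc TA FA TC FC.
clear J zK z0 zN.
case: (ltnP A B) => hi; case: (ltnP C D) => hj.
- have h1 : s_ i C < s_ i D by move: {g g'} (g hi) (g' hj) => g g'; ss.
  have h2 : s_ j A < s_ j B by move: {g g'} (g hi) (g' hj) => g g'; ss.
  by rewrite (TA hi) (TC hj) !stepT ?vi ?vj ?cc.
- have h1 : s_ i D <= s_ i C by move: {g g'} (g hi) => g; ss.
  have h2 : (s_ i C != j.+1) && (s_ i D != j) = (C != j.+1) && (D != j) by clear g g'; ss.
  rewrite (TA hi) (FC hj) stepF ?vj // h2.
  by case: ifP => // _; rewrite (TA hi).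
- have h1 : s_ j B <= s_ j A by move: {g g'} (g' hj) => g'; ss.
  have h2 : (s_ j A != i.+1) && (s_ j B != i) = (A != i.+1) && (B != i) by clear g g'; ss.
  rewrite (TC hj) (FA hi) [in RHS]stepF ?vi // h2.
  by case: ifP => // _; rewrite (TC hj).
- rewrite (FA hi) (FC hj); case: ifP => ci; case: ifP => cj //.
  + by rewrite (FA hi) (FC hj) ci cj.
  + by rewrite (FC hj) cj.
  + by rewrite (FA hi) ci.
Qed.

(** The pairs of z inside {i, i+1, i+2} decide: if there is one, both sides
    vanish; otherwise both sides sort z(i), z(i+1), z(i+2) decreasingly, along
    the two reduced words of the longest permutation of three letters. *)
Lemma step_braid o i : 0 < i ->
  step (step (step o i) i.+1) i = step (step (step o i.+1) i) i.+1.
Proof.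
move=> i0; case: o => [z|] //; have [zK z0 zN] := Finf_facts z.
have N1 := zN i i0; have N2 := zN i.+1 isT; have N3 := zN i.+2 isT.
have J x y : z x = y -> z y = x by move=> <-.
have n12 : z i != z i.+1 by apply/eqP => /(congr1 z); rewrite !zK; lia.
have n23 : z i.+1 != z i.+2 by apply/eqP => /(congr1 z); rewrite !zK; lia.
have n13 : z i != z i.+2 by apply/eqP => /(congr1 z); rewrite !zK; lia.
have CC : conjF i (conjF i.+1 (conjF i z)) = conjF i.+1 (conjF i (conjF i.+1 z)).
  have SS x : s_ i (s_ i.+1 (s_ i x)) = s_ i.+1 (s_ i (s_ i.+1 x)) by ss.
  by apply: Finf_ext => k; rewrite !conjE !SS.
have oi x : x != i -> x != i.+1 -> s_ i x = x by exact: s_o.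
have oj x : x != i.+1 -> x != i.+2 -> s_ i.+1 x = x by exact: s_o.
have v (y : Finf) : [/\ conjF i y i = s_ i (y i.+1), conjF i y i.+1 = s_ i (y i),
  conjF i y i.+2 = s_ i (y i.+2) & [/\ conjF i.+1 y i = s_ i.+1 (y i),
  conjF i.+1 y i.+1 = s_ i.+1 (y i.+2) & conjF i.+1 y i.+2 = s_ i.+1 (y i.+1)]].
  by rewrite !conjE ?s_l ?s_r ?(@s_o i i.+2) ?(@s_o i.+1 i) //; lia.
have [v1 v2 v3 [w1 w2 w3]] := v z.
have [v21 v22 v23 _] := v (conjF i.+1 z).
have [_ _ _ [w21 w22 w23]] := v (conjF i z).
have [v31 v32 v33 _] := v (conjF i.+1 (conjF i z)).
have [_ _ _ [w31 w32 w33]] := v (conjF i (conjF i.+1 z)).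
have G : [\/ [/\ z i = i.+1, z i.+1 = i, z i.+2 != i & z i.+2 != i.+1],
   [/\ z i = i.+2, z i.+2 = i, z i.+1 != i & z i.+1 != i.+2],
   [/\ z i.+1 = i.+2, z i.+2 = i.+1, z i != i.+1 & z i != i.+2] |
   [/\ z i != i.+1, z i != i.+2, z i.+1 != i, z i.+1 != i.+2 & (z i.+2 != i) && (z i.+2 != i.+1)]].
  case: (z i =P i.+1) => [h1|h1]; first by have h2 := J _ _ h1; constructor 1; split; lia.
  case: (z i =P i.+2) => [h2|h2]; first by have h3 := J _ _ h2; constructor 2; split; lia.
  case: (z i.+1 =P i.+2) => [h3|h3]; first by have h4 := J _ _ h3; constructor 3; split; lia.
  constructor 4; split; try lia; first [apply/andP; split | idtac]; apply/eqP => /J; lia.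
have V := (v1,v2,v3,(w1,w2,w3),(v21,v22,v23),(w21,w22,w23),(v31,v32,v33),(w31,w32,w33)).
clear v J zK z0 zN v1 v2 v3 w1 w2 w3 v21 v22 v23 w21 w22 w23 v31 v32 v33 w31 w32 w33.
case: G => [[a1 b1 c1 c2]|[a1 c1 b1 b2]|[b1 c1 a1 a2]|[a1 a2 b1 b2 /andP[c1 c2]]].
- rewrite [in LHS](@stepN z i) //; case: (ltnP i (z i.+2)) => hC.
  + rewrite (@stepT z) ?b1 // stepT; last by rewrite !V; ss.
    by rewrite stepN // !V; ss.
  + rewrite (@stepS z); try lia.
    by rewrite (@stepN z).
- case: (ltnP (z i.+1) i) => hB.
  + rewrite (@stepS z i) ?(@stepT z i.+1) ?c1 //; try lia.
    by rewrite (@stepN (conjF i.+1 z) i) // !V; ss.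
  + rewrite (@stepS z i.+1) ?c1; try lia.
    rewrite (@stepT z i); last by lia.
    by rewrite (@stepN (conjF i z) i.+1) // !V; ss.
- rewrite [in RHS](@stepN z i.+1) //; case: (ltnP (z i) i) => hA.
  + rewrite (@stepT z i); last by lia.
    rewrite stepT; last by rewrite !V; ss.
    by rewrite stepN // !V; ss.
  + rewrite (@stepS z i); try lia.
    by rewrite (@stepN z).
- case: (ltnP (z i) (z i.+1)) => h12; case: (ltnP (z i.+1) (z i.+2)) => h23;
  case: (ltnP (z i) (z i.+2)) => h13; try lia;
  by do ![first [ (rewrite stepT; [ | by rewrite ?V; ss])
    | (rewrite stepS; [| by rewrite ?V; ss | by rewrite ?V; ss| by rewrite ?V; ss])]];
  rewrite ?CC.
Qed.

Lemma act_cons o a w : act o (a :: w) = act (step o a) w. Proof. by []. Qed.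

Lemma act_None w : act None w = None. Proof. by elim: w. Qed.

(** Theta exchanges a and a+1 for a odd. *)
Lemma act_odd a w : odd a -> act Theta_state (a :: w) = None.
Proof.
move=> oa; have h1 : ThetaF a = a.+1 by rewrite /= /Theta oa.
have h2 : ThetaF a.+1 = a by rewrite /= /Theta /= oa.
by rewrite act_cons (stepN h1 h2) act_None.
Qed.

(** For a even, N_Theta U_a = N_z with z exchanging a with a+2 and a-1 with a+1;
    conjugating z by s_(a-1) or by s_(a+1) gives the same involution. *)
Lemma act_even a w : 0 < a -> ~~ odd a ->
  act Theta_state (a :: a.-1 :: w) = act Theta_state (a :: a.+1 :: w).
Proof.
case: a => // a _; rewrite [odd _]/= negbK => oa; rewrite !act_cons [a.+1.-1]/=; congr (act _ w).
have a0 : 0 < a by case: (a) oa.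
have T0 : ThetaF a.+1 = a by rewrite /= /Theta /= oa.
have T1 : ThetaF a.+2 = a.+3 by rewrite /= /Theta /= oa.
have T2 : ThetaF a = a.+1 by rewrite /= /Theta /= oa.
have T3 : ThetaF a.+3 = a.+2 by rewrite /= /Theta /= oa.
rewrite stepT ?T0 ?T1; last by lia.
have v1 : conjF a.+1 ThetaF a = a.+2 by rewrite conjE; ss; rewrite T2; ss.
have v2 : conjF a.+1 ThetaF a.+1 = a.+3 by rewrite conjE s_l // T1; ss.
have v3 : conjF a.+1 ThetaF a.+2 = a by rewrite conjE s_r // T0; ss.
have v4 : conjF a.+1 ThetaF a.+3 = a.+1 by rewrite conjE; ss; rewrite T3; ss.
rewrite !stepT ?v1 ?v2 ?v3 ?v4; try lia.
congr Some; apply: Finf_ext => k.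
rewrite [LHS]conjE [RHS]conjE.
case: (sP k a0) => [[-> ->]|[[-> ->]|[[h1 h2] ->]]]; rewrite ?v1 ?v2.
- by rewrite (@s_o a.+2 a) ?v1; [ss|lia..].
- by rewrite (@s_o a.+2 a.+1) ?v2; [ss|lia..].
- have a2 : 0 < a.+2 by [].
  case: (sP k a2) => [[-> ->]|[[-> ->]|[[h3 h4] ->]]].
  + by rewrite v3 v4; ss.
  + by rewrite v3 v4; ss.
  + have [zK _ _] := Finf_facts (conjF a.+1 ThetaF).
    by rewrite !s_o //; apply/eqP => h; move: (zK k) h1 h2 h3 h4; rewrite h ?v1 ?v2 ?v3 ?v4 => <-.
Qed.

(** * Words with the same action *)

(** The letters whose operators commute because they differ by at least 2. *)
Definition far (a x : nat) : bool :=
  [&& 0 < a, 0 < x & (a.+1 < x) || (x.+1 < a)].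

Lemma act_swap o a x : far a x -> step (step o a) x = step (step o x) a.
Proof.
case/and3P => a0 x0 /orP[h|h]; first exact: step_comm.
by rewrite -step_comm.
Qed.

Lemma act_pass o a s : all (far a) s -> act (step o a) s = step (act o s) a.
Proof.
elim: s o => [|x s IH] o //= /andP[ax as_].
by rewrite (act_swap _ ax) IH.
Qed.

Lemma sub_all_in (P Q : pred nat) s : all P s -> (forall x, P x -> Q x) -> all Q s.
Proof. by move=> h PQ; apply: sub_all h => x; exact: PQ. Qed.

Lemma act1 o a : act o [:: a] = step o a. Proof. by []. Qed.

Definition actE := (act1, act_cat, act_cons).

(** An increasing line P b S in which a bumps b: a passes to the left of S, b to
    the left of P.  The neighbours a and b never have to be exchanged. *)
Lemma act_bump P b S a o : 0 < a < b ->
  all (fun x => 0 < x < a) P -> all (fun x => b < x) S ->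
  act o (P ++ b :: S ++ [:: a]) = act o (b :: P ++ a :: S).
Proof.
move=> ab hP hS.
have fP : all (far b) P by apply: sub_all_in hP _ => x; rewrite /far; lia.
have fS : all (far a) S by apply: sub_all_in hS _ => x; rewrite /far; lia.
by rewrite !actE -(act_pass _ fS) (act_pass _ fP).
Qed.

(** The same for a column, which is read downwards. *)
Lemma act_bump_rev P b S a o : 0 < a < b ->
  all (fun x => 0 < x < a) P -> all (fun x => b < x) S ->
  act o (a :: S ++ b :: P) = act o (S ++ a :: P ++ [:: b]).
Proof.
move=> ab hP hS.
have fP : all (far b) P by apply: sub_all_in hP _ => x; rewrite /far; lia.
have fS : all (far a) S by apply: sub_all_in hS _ => x; rewrite /far; lia.
by rewrite !actE (act_pass _ fS) (act_pass _ fP).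
Qed.

(** If a is in the line already, the line is unchanged and b still moves on: this
    is the braid relation if b = a+1, and aba = bab = ab otherwise. *)
Lemma act_bump_eq P b S a o : 0 < a < b ->
  all (fun x => 0 < x < a) P -> all (fun x => b < x) S ->
  act o (P ++ a :: b :: S ++ [:: a]) = act o (b :: P ++ a :: b :: S).
Proof.
move=> ab hP hS.
have fP : all (far b) P by apply: sub_all_in hP _ => x; rewrite /far; lia.
have fS : all (far a) S by apply: sub_all_in hS _ => x; rewrite /far; lia.
rewrite !actE -(act_pass _ fS) (act_pass _ fP); congr (act _ S).
have a0 : 0 < a by lia.
have [->|ne] := b =P a.+1; first by rewrite step_braid.
have ba : far b a by rewrite /far; lia.
have b0 : 0 < b by lia.
by rewrite (act_swap (step _ a) ba) step_idem // (act_swap _ ba) step_idem.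
Qed.

Lemma act_bump_eq_rev P b S a o : 0 < a < b ->
  all (fun x => 0 < x < a) P -> all (fun x => b < x) S ->
  act o (a :: S ++ b :: a :: P) = act o (S ++ b :: a :: P ++ [:: b]).
Proof.
move=> ab hP hS.
have fP : all (far b) P by apply: sub_all_in hP _ => x; rewrite /far; lia.
have fS : all (far a) S by apply: sub_all_in hS _ => x; rewrite /far; lia.
rewrite !actE (act_pass _ fS) -(act_pass _ fP); congr (act _ P).
have a0 : 0 < a by lia.
have [->|ne] := b =P a.+1; first by rewrite step_braid.
have ba : far b a by rewrite /far; lia.
have b0 : 0 < b by lia.
by rewrite (act_swap (step _ a) ba) step_idem // (act_swap _ ba) step_idem.
Qed.

(** A repeated letter disappears if the letters in between commute with it. *)
Lemma act_absorb a P o : 0 < a -> all (fun x => 0 < x < a.-1) P ->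
  act o (a :: P ++ [:: a]) = act o (P ++ [:: a]).
Proof.
move=> a0 hP.
have fP : all (far a) P by apply: sub_all_in hP _ => x; rewrite /far; lia.
by rewrite !actE (act_pass _ fP) step_idem.
Qed.

Lemma act_absorb_rev a P o : 0 < a -> all (fun x => 0 < x < a.-1) P ->
  act o (a :: P ++ [:: a]) = act o (a :: P).
Proof.
move=> a0 hP.
have fP : all (far a) P by apply: sub_all_in hP _ => x; rewrite /far; lia.
by rewrite !actE (act_pass _ fP) step_idem.
Qed.

(** The letter a bumps b from the line P b S, but the line below, which starts
    with P2 a, keeps a out; a is absorbed there, and b is in both lines. *)
Lemma act_bump_absorb P b S a P2 o : 0 < a < b ->
  all (fun x => 0 < x < a) P -> all (fun x => b < x) S ->
  all (fun x => 0 < x < a.-1) P2 ->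
  act o (P ++ b :: S ++ a :: P2 ++ [:: a]) = act o (b :: P ++ b :: S ++ P2 ++ [:: a]).
Proof.
move=> ab hP hS hP2; have a0 : 0 < a by lia.
have fP : all (far b) P by apply: sub_all_in hP _ => x; rewrite /far; lia.
have h := act_absorb _ a0 hP2; have b0 : 0 < b by lia.
by rewrite act_cat act_cons act_cat h !actE (act_pass _ fP) step_idem.
Qed.

(** Two orders on the same boxes read words with the same action, if the letters
    of any two boxes that the orders compare differently commute. *)
Lemma act_reorder (T : eqType) (f : T -> nat) (r1 r2 : rel T) (l1 l2 : seq T) o :
  perm_eq l1 l2 -> pairwise r1 l1 -> pairwise r2 l2 ->
  {in l1 &, forall x y, r1 x y -> r2 y x -> far (f x) (f y)} ->
  act o (map f l1) = act o (map f l2).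
Proof.
elim: l1 l2 o => [|x l1 IH] l2 o.
  by move/perm_size; case: l2.
move=> pl; have xl : x \in l2 by rewrite -(perm_mem pl) mem_head.
case/splitPr: xl pl => u v pl.
rewrite pairwise_cons => /andP[xl1 p1] p2 hf.
have pl' : perm_eq l1 (u ++ v).
  by rewrite -(perm_cons x) (permPl pl) -cat_rcons -cats1 -catA perm_sym -cat1s perm_catCA.
have uf : all (far (f x)) (map f u).
  rewrite all_map; apply/allP => y yu /=.
  have yl : y \in l1 by rewrite (perm_mem pl') mem_cat yu.
  apply: hf; rewrite ?mem_head ?inE ?yl ?orbT //; first exact: (allP xl1).
  by move: p2; rewrite pairwise_cat /= => /and3P[/allrelP h _ _]; apply: h; rewrite ?mem_head.
rewrite map_cat /= act_cat act_cons -(act_pass _ uf) -act_cat -map_cat.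
apply: IH => //.
- move: p2; rewrite !pairwise_cat /= => /and3P[h -> /andP[_ ->]]; rewrite !andbT.
  by apply/allrelP => a b au bv; move/allrelP: h; apply; rewrite // inE bv orbT.
- by move=> a b al bl; apply: hf; rewrite inE ?al ?bl orbT.
Qed.

(** * Insertion paths in the columns *)

Local Open Scope fmap_scope.

Definition box (T : tableau) (i j : nat) : bool := (i, j) \in domf T.
Definition ent (T : tableau) (i j : nat) : nat := entry T (i, j).

Lemma box_set T i j a k l :
  box T.[(i, j) <- a] k l = ((k == i) && (l == j)) || box T k l.
Proof. by rewrite /box dom_setf !inE xpair_eqE. Qed.

Lemma ent_set T i j a k l :
  ent T.[(i, j) <- a] k l = if (k == i) && (l == j) then a else ent T k l.
Proof. by rewrite /ent /entry fnd_set xpair_eqE; case: ifP. Qed.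

(** The tableaux that are increasing and shifted with positive entries, in a form
    without quantification over strict partitions: the shapes are the finite sets
    of boxes on or above the diagonal that are closed downwards. *)
Record shtab (T : tableau) : Prop := Shtab {
  sh_bd : forall i j, box T i j -> 0 < i <= j;
  sh_dn : forall i j k l, box T i j -> 0 < k -> k <= i -> l <= j -> k <= l -> box T k l;
  sh_in : forall i j k l, box T i j -> box T k l -> i <= k -> j <= l ->
            i + j < k + l -> ent T i j < ent T k l;
  sh_gt0 : forall i j, box T i j -> 0 < ent T i j }.

Definition colmax T j a := forall k, box T k j -> ent T k j <= a.
Definition rowmax T i a := forall k, box T i k -> ent T i k <= a.
Definition leastc T j a x :=
  [/\ box T x j, a < ent T x j & forall k, k < x -> box T k j -> ent T k j <= a].
Definition leastr T i a x :=
  [/\ box T i x, a < ent T i x & forall k, k < x -> box T i k -> ent T i k <= a].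
Definition firstc T i j := [/\ 0 < i, ~~ box T i j & forall k, 0 < k < i -> box T k j].
Definition firstr T i j := [/\ i <= j, ~~ box T i j & forall k, i <= k < j -> box T i k].

(** The state with outer box in column j and value a.  Here p is the row of the
    box of column j-1 that a comes from, and v tells that this box still contains
    a.  The last clause says that the path moves weakly down.  Equality in it is
    possible only next to the diagonal: after D1, and after D4, which raises the
    value by one. *)
Definition col_state (T : tableau) (j a p : nat) (v : bool) : Prop :=
  [/\ shtab T, 1 < j, box T p j.-1,
      (if v then 1 < p /\ ent T p j.-1 = a else ent T p j.-1 < a) &
      box T p j -> a <= ent T p j /\ (p.+1 < j -> a < ent T p j)].

Definition result := (transition_type * pos)%type.

(** [colins T j a p v T1 r]: from this state the transitions lead to T1, and the
    last one has type and label r.  For C2 and C3 the constructors record why a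
    cannot be placed: its neighbour below is equal to a, or its neighbour on the
    left is, which is then the box that a comes from. *)
Inductive colins : tableau -> nat -> nat -> nat -> bool -> tableau -> result -> Prop :=
| ColC1 T j a p v i : col_state T j a p v -> colmax T j a -> firstc T i j -> i <= p ->
    shtab T.[(i, j) <- a] -> colins T j a p v T.[(i, j) <- a] (C1, (i, j))
| ColC2 T j a p v i : col_state T j a p v -> colmax T j a -> firstc T i j -> 1 < i <= j ->
    ent T i.-1 j = a \/ (v /\ i = p) -> colins T j a p v T (C2, (i, j))
| ColC3 T j a p v x T1 r : col_state T j a p v -> leastc T j a x ->
    (1 < x /\ ent T x.-1 j = a) \/ (v /\ x = p) ->
    colins T j.+1 (ent T x j) x true T1 r -> colins T j a p v T1 r
| ColC4 T j a p v x T1 r : col_state T j a p v -> leastc T j a x ->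
    (forall k, k < x -> box T k j -> ent T k j < a) ->
    colins T.[(x, j) <- a] j.+1 (ent T x j) x false T1 r -> colins T j a p v T1 r.

Lemma box_replace T i j a k l : box T i j -> box T.[(i, j) <- a] k l = box T k l.
Proof. by move=> h; rewrite box_set; case: andP => // -[/eqP -> /eqP ->]. Qed.

Lemma ent_other T i j a k l : (k, l) != (i, j) -> ent T.[(i, j) <- a] k l = ent T k l.
Proof. by rewrite ent_set xpair_eqE; case: andP => //. Qed.

Lemma ent_same T i j a : ent T.[(i, j) <- a] i j = a.
Proof. by rewrite ent_set !eqxx. Qed.

(** A column path replaces entries by smaller ones, but all old and new entries
    that it touches are at least the value it starts with. *)
Definition raised_from c (T T1 : tableau) k l : Prop :=
  (box T k l -> box T1 k l /\ (ent T1 k l = ent T k l \/ c <= ent T1 k l < ent T k l))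
  /\ (box T1 k l -> ~~ box T k l -> c <= ent T1 k l).

Lemma raised_from_refl c T k l : raised_from c T T k l.
Proof. by split=> [b|b /negP //]; split=> //; left. Qed.

Lemma raised_from_trans c c' T T' T1 k l :
  c <= c' -> raised_from c T T' k l -> raised_from c' T' T1 k l -> raised_from c T T1 k l.
Proof.
move=> cc [h1 h2] [h3 h4]; split.
  by move=> /h1 [/h3 [b1 e1] e2]; split => //; lia.
move=> b1 b; case: (boolP (box T' k l)) => b'.
  by have := h2 b' b; case: (h3 b') => _; lia.
by have := h4 b1 b'; lia.
Qed.

Lemma raised_from_set T i j a k l : box T i j -> a < ent T i j ->
  raised_from a T T.[(i, j) <- a] k l.
Proof.
move=> b h; split; rewrite box_replace // ?ent_set; last by move=> -> /negP.
by split=> //; case: andP => [[/eqP -> /eqP ->]|]; [right; lia | left].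
Qed.

Lemma raised_from_new T i j a k l : ~~ box T i j ->
  raised_from a T T.[(i, j) <- a] k l.
Proof.
move=> b; split; rewrite box_set ?ent_set.
  by case: andP => [[/eqP -> /eqP ->]|_ ->]; [rewrite (negbTE b) | split=> //; left].
by case: andP => //= _ ->.
Qed.

Lemma colins_raised T j a p v T1 r k l : colins T j a p v T1 r -> raised_from a T T1 k l.
Proof.
elim => {T j a p v T1 r}.
- by move=> T j a p v i _ _ [_ ni _] _ _; exact: raised_from_new.
- by move=> *; exact: raised_from_refl.
- move=> T j a p v x T1 r _ [bx ax _] _ _ IH.
  by apply: raised_from_trans IH; [apply: ltnW ax | exact: raised_from_refl].
- move=> T j a p v x T1 r _ [bx ax _] _ _ IH.
  by apply: raised_from_trans IH; [apply: ltnW ax | exact: raised_from_set].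
Qed.

Lemma colins_frame T j a p v T1 r k l : colins T j a p v T1 r -> l < j ->
  box T1 k l = box T k l /\ ent T1 k l = ent T k l.
Proof.
elim => {T j a p v T1 r}.
- by move=> T j a p v i _ _ _ _ _ lj; rewrite box_set ent_set (ltn_eqF lj) andbF.
- by [].
- by move=> T j a p v x T1 r _ _ _ _ IH lj; apply: IH; apply: ltnW.
- move=> T j a p v x T1 r _ _ _ _ IH lj; have := IH (ltnW lj).
  by rewrite box_set ent_set (ltn_eqF lj) andbF.
Qed.

Lemma colins_state T j a p v T1 r : colins T j a p v T1 r -> col_state T j a p v.
Proof. by case. Qed.

Lemma colins_cases T j a p v T1 ty i c : colins T j a p v T1 (ty, (i, c)) ->
  [/\ j <= c, shtab T1, firstc T i c &
   (ty = C1 /\ i < c /\ forall k l, box T1 k l = ((k == i) && (l == c)) || box T k l) \/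
   (ty = C2 /\ 1 < i <= c /\ forall k l, box T1 k l = box T k l)].
Proof.
move: {-1}(ty, (i, c)) (erefl (ty, (i, c))) => r E h.
elim: h E => {T j a p v T1 r}.
- move=> T j a p v i' [sT j1 bp _ _] mx fi ip sh [-> -> ->]; split => //; left; split => //.
  split; last by move=> k l; rewrite box_set.
  by have := sh_bd sT bp; lia.
- by move=> T j a p v i' [sT _ _ _ _] mx fi ii _ [-> -> ->]; split => //; right.
- move=> T j a p v x T1 r _ _ _ _ IH E; have [h1 h2 h3 h4] := IH E.
  by split => //; apply: ltnW.
- move=> T j a p v x T1 r _ [bx _ _] _ _ IH E; have [h1 h2 [h3 h3' h3''] h4] := IH E.
  split => //; first exact: ltnW.
    split=> //; first by rewrite -(box_replace a _ _ bx).
    by move=> k /h3''; rewrite box_replace.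
  by case: h4 => -[-> [hh h4]]; [left|right]; split=> //; split=> // k l;
    rewrite h4 box_replace.
Qed.

(** A letter is recorded in the last box of this row if the path ends in a column,
    and in the last box of the column [endcol] if it ends in a row. *)
Definition endrow (r : result) : nat := if r.1 is C2 then r.2.1.-1 else r.2.1.
Definition endcol (r : result) : nat := if r.1 is R2 then r.2.2.-1 else r.2.2.
Definition prim (r : result) : bool := if r.1 is (C1 | C2) then true else false.

Lemma colins_prim T j a p v T1 r : colins T j a p v T1 r -> prim r.
Proof. by elim. Qed.

Lemma colins_pass_right S j b q u S2 r R : colins S j b q u S2 r ->
  R <= j -> (box S R j -> b < ent S R j) ->
  forall c, j <= c -> box S R c -> c < r.2.2.
Proof.
move=> h; elim: h R => {S j b q u S2 r}.
- move=> T j a p v i [sT _ _ _ _] mx _ _ _ R Rj h c jc bc.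
  have bj : box T R j by apply: (sh_dn sT bc) => //; case/andP: (sh_bd sT bc).
  by have := h bj; have := mx _ bj; lia.
- move=> T j a p v i [sT _ _ _ _] mx _ _ _ R Rj h c jc bc.
  have bj : box T R j by apply: (sh_dn sT bc) => //; case/andP: (sh_bd sT bc).
  by have := h bj; have := mx _ bj; lia.
- move=> T j a p v x T1 r [sT _ _ _ _] [bx ax mx] _ cl IH R Rj h c jc bc.
  have bj : box T R j by apply: (sh_dn sT bc) => //; case/andP: (sh_bd sT bc).
  have xR : x <= R by rewrite leqNgt; apply/negP => Rx; have := mx _ Rx bj; have := h bj; lia.
  case: r cl IH => ty [i l] cl IH.
  have [jl _ _ _] := colins_cases cl.
  case: (ltnP j c) => jc'; last by rewrite /=; lia.
  apply: (IH R) => //; first by lia.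
  by move=> bR; apply: sh_in => //; lia.
- move=> T j a p v x T1 r [sT _ _ _ _] [bx ax mx] _ cl IH R Rj h c jc bc.
  have bj : box T R j by apply: (sh_dn sT bc) => //; case/andP: (sh_bd sT bc).
  have xR : x <= R by rewrite leqNgt; apply/negP => Rx; have := mx _ Rx bj; have := h bj; lia.
  case: r cl IH => ty [i l] cl IH.
  have [jl _ _ _] := colins_cases cl.
  case: (ltnP j c) => jc'; last by rewrite /=; lia.
  apply: (IH R) => //; [by lia | | by rewrite box_replace].
  rewrite box_replace // ent_other; last by apply/eqP => -[]; lia.
  by move=> bR; apply: sh_in => //; lia.
Qed.

(** * Comparison of two insertions in the columns *)

(** The row phase of the second insertion changes the tableau before its column
    phase starts, but it touches only entries smaller than c; column insertion of
    values that are at least c does not see them. *)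
Definition agree_from c (S T1 : tableau) k l : Prop :=
  ent S k l = ent T1 k l \/ (ent S k l < c /\ ent T1 k l < c).

(** What a comparison needs to know about the second path: it ends in this column,
    or it bumps an entry and goes on. *)
Lemma colinsE S j b q u S2 r : colins S j b q u S2 r ->
  (colmax S j b /\ r.2.2 = j) \/
  exists y u' S', [/\ leastc S j b y, colins S' j.+1 (ent S y j) y u' S2 r,
    forall k l, box S' k l = box S k l & forall k l, ent S' k l = ent S k l \/
      [/\ k = y, l = j & forall k', k' < y -> box S k' j -> ent S k' j < b]].
Proof.
case=> {S j b q u S2 r}.
- by move=> T j a p v i _ mx *; left.
- by move=> T j a p v i _ mx *; left.
- by move=> T j a p v x T1 r _ lx _ cl; right; exists x, true, T; split=> // k l; left.
- move=> T j a p v x T1 r _ lx hx cl; right; exists x, false, T.[(x, j) <- a].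
  have [bx _ _] := lx; split => // k l; first by rewrite box_replace.
  by rewrite ent_set; case: andP => [[/eqP -> /eqP ->]|_]; [right | left].
Qed.

Lemma colins_ge T j a p v T1 r : colins T j a p v T1 r -> j <= r.2.2.
Proof. by case: r => ty [i c] /colins_cases []. Qed.

(** A value that is smaller than the entry of row R in its column is smaller than
    all the entries of row R that it will meet: it comes from a row R' <= R, and
    the entries increase along rows and columns.  So it ends to the right of row
    R. *)
Lemma colins_pass S j b q u S2 r R : colins S j b q u S2 r ->
  R <= j -> (box S R j -> b < ent S R j) -> forall c, box S R c -> c < r.2.2.
Proof.
move=> cl Rj h c bc; case: (leqP j c) => jc; first exact: (colins_pass_right cl Rj h jc bc).
exact: leq_trans jc (colins_ge cl).
Qed.

(** The value b stays smaller than a.  After C4 the entry a is in the column, and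
    if C3 or C2 happened because the neighbour below is a, that neighbour is there;
    in both cases b bumps a box not above it.  If a was kept out by its left
    neighbour, b comes from a lower row, by [v -> q < p], so b is smaller than the
    entry below the box where a was kept out. *)
Lemma colins_lt T j a p v T1 r : colins T j a p v T1 r ->
  forall S b q u S2 r' c, colins S j b q u S2 r' ->
  (forall k l, box S k l = box T1 k l) -> (forall k l, j <= l -> agree_from c S T1 k l) ->
  c <= b -> b < a -> (v -> q < p) ->
  forall l, box T1 (endrow r) l -> l < r'.2.2.
Proof.
(* The second value comes from row q' < p', so it is smaller than the entry below
   (p', j'): the column increases above row q', and in row q' itself the strict
   clause of [col_state] applies. *)
have vert T' S j' p' b' q' u' x : col_state S j' b' q' u' -> (forall k l, box S k l = box T' k l) ->
    box T' p' j'.-1 -> shtab T' -> 1 < j' ->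
    q' < p' -> x = p' -> (forall k, 0 < k < x -> box T' k j') -> b' < ent S x.-1 j'.
  move=> [sS _ bq _ hq] bS bp sT j1 qp -> hb.
  have bd1 := sh_bd sS bq; have bd2 := sh_bd sT bp.
  have bqj : box S q' j' by rewrite bS; apply: hb; lia.
  have bpj : box S p'.-1 j' by rewrite bS; apply: hb; lia.
  have [h1 h2] := hq bqj; case: (ltnP q' p'.-1) => qq.
    by have := sh_in sS bqj bpj; lia.
  have -> : p'.-1 = q' by lia.
  by apply: h2; lia.
move=> h; elim: h => {T j a p v T1 r}.
- move=> T j a p v i [sT j1 bp _ _] mx fi ip sh S b q u S2 r' c cl bS sm cb ba vq l bl.
  have bi : box T.[(i, j) <- a] i j by rewrite box_set !eqxx.
  apply: (colins_pass cl (R := i)) => //=; last by rewrite bS.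
    by case/andP: (sh_bd sh bi).
  by move=> _; have := sm i j (leqnn j); rewrite /agree_from ent_same; lia.
- move=> T j a p v i [sT j1 bp _ _] mx fi ii hv S b q u S2 r' c cl bS sm cb ba vq l /= bl.
  apply: (colins_pass cl (R := i.-1)) => //=; [lia | | by rewrite bS].
  move=> bi; case: hv => [e|[hv ep]].
    by have := sm i.-1 j (leqnn j); rewrite /agree_from e; lia.
  have [_ _ hb] := fi.
  exact: (vert _ _ _ _ _ _ _ _ (colins_state cl) bS bp sT j1 (vq hv) ep hb).
- move=> T j a p v x T1 r [sT j1 bp _ _] [bx ax mx] hv cl1 IH S b q u S2 r' c cl bS sm cb ba vq.
  have fr k : box T1 k j = box T k j /\ ent T1 k j = ent T k j by exact: colins_frame cl1 _.
  have bxl k : 0 < k < x -> box T k j.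
    by move=> kx; apply: (sh_dn sT bx); have := sh_bd sT bx; lia.
  have bz : 1 < x -> box S x.-1 j by move=> x1; rewrite bS (fr _).1 bxl //; lia.
  have [x1 bS' ] : 1 < x /\ b < ent S x.-1 j.
    case: hv => [[x1 e]|[hv xp]].
      by split => //; have := sm x.-1 j (leqnn j); rewrite /agree_from (fr _).2 e; lia.
    have qp' := vq hv; have [sS _ bq _ _] := colins_state cl.
    have bdq := sh_bd sS bq; split; first lia.
    have bp1 : box T1 p j.-1 by rewrite (colins_frame _ cl1 _).1 //; lia.
    have sT1 : shtab T1 by case: (r) cl1 => ? [? ?] /colins_cases [].
    apply: (vert _ _ _ _ _ _ _ _ (colins_state cl) bS bp1 sT1 j1 qp' xp) => k kx.
    by rewrite (fr _).1 bxl.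
  have [[mxS _]|[y [u' [S' [[byS ay my] cl' bS2 eS2]]]]] := colinsE cl.
    by have := mxS _ (bz x1); lia.
  have yz : y <= x.-1 by rewrite leqNgt; apply/negP => zy; have := my _ zy (bz x1); lia.
  have ey : ent S y j = ent T y j.
    by have := sm y j (leqnn j); rewrite /agree_from (fr _).2; lia.
  apply: (IH S' (ent S y j) y u' S2 r' c) => //.
  + by move=> k l; rewrite bS2 bS.
  + by move=> k l jl; rewrite /agree_from; case: (eS2 k l) => [->|[_ ll _]]; [apply: sm; lia | lia].
  + lia.
  + rewrite ey; apply: (sh_in sT) => //; [by rewrite -(fr _).1 -bS|lia..].
  + lia.
- move=> T j a p v x T1 r [sT j1 bp _ _] [bx ax mx] hv cl1 IH S b q u S2 r' c cl bS sm cb ba vq.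
  have fr k : box T1 k j = box T k j /\ ent T1 k j = ent T.[(x, j) <- a] k j.
    by have [-> ->] := colins_frame k cl1 (ltnSn j); rewrite box_replace.
  have bz : box S x j by rewrite bS (fr _).1.
  have ez : ent S x j = a by have := sm x j (leqnn j); rewrite /agree_from (fr _).2 ent_same; lia.
  have [[mxS _]|[y [u' [S' [[byS ay my] cl' bS2 eS2]]]]] := colinsE cl.
    by have := mxS _ bz; lia.
  have yz : y <= x by rewrite leqNgt; apply/negP => zy; have := my _ zy bz; lia.
  have [sS _ _ _ _] := colins_state cl.
  have ey : ent S y j <= a.
    rewrite -ez; case: (ltngtP y x) yz => // [yx _|-> //].
    by apply: ltnW; apply: (sh_in sS) => //; lia.
  apply: (IH S' (ent S y j) y u' S2 r' c) => //.
  + by move=> k l; rewrite bS2 bS.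
  + by move=> k l jl; rewrite /agree_from; case: (eS2 k l) => [->|[_ ll _]]; [apply: sm; lia | lia].
  + lia.
  + lia.
Qed.

(** The value b stays at least a: whatever the first insertion leaves at its box is
    at most b, or is the bumped entry itself. *)
Lemma colins_le T j a p v T1 r : colins T j a p v T1 r ->
  forall S b q u S2 r' c, colins S j b q u S2 r' ->
  (forall k l, box S k l = box T1 k l) -> (forall k l, j <= l -> agree_from c S T1 k l) ->
  c <= b -> a <= b -> r'.2.2 <= r.2.2.
Proof.
move=> h; elim: h => {T j a p v T1 r}.
- move=> T j a p v i [sT j1 bp _ _] mx fi ip sh S b q u S2 r' c cl bS sm cb ba.
  have [[_ ->] //|[y [u' [S' [[byS ay my] cl' bS2 eS2]]]]] := colinsE cl.
  move: byS (sm y j (leqnn j)); rewrite bS box_set /agree_from ent_set eqxx andbT.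
  case: eqP => [_ _|_ /=]; first lia.
  by move=> /mx; lia.
- move=> T j a p v i [sT j1 bp _ _] mx fi ip _ S b q u S2 r' c cl bS sm cb ba.
  have [[_ ->] //|[y [u' [S' [[byS ay my] cl' bS2 eS2]]]]] := colinsE cl.
  by move: byS (sm y j (leqnn j)); rewrite bS => /mx; rewrite /agree_from; lia.
- move=> T j a p v x T1 r [sT j1 bp _ _] [bx ax mx] hv cl1 IH S b q u S2 r' c cl bS sm cb ba.
  have fr k : box T1 k j = box T k j /\ ent T1 k j = ent T k j by exact: colins_frame cl1 _.
  have [[_ ->]|[y [u' [S' [[byS ay my] cl' bS2 eS2]]]]] := colinsE cl.
    by apply: leq_trans (colins_ge cl1); lia.
  have ey : ent S y j = ent T y j.
    by have := sm y j (leqnn j); rewrite /agree_from (fr _).2; lia.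
  have byT : box T y j by rewrite -(fr _).1 -bS.
  have xy : x <= y by rewrite leqNgt; apply/negP => zy; have := mx _ zy byT; lia.
  apply: (IH S' (ent S y j) y u' S2 r' c) => //.
  + by move=> k l; rewrite bS2 bS.
  + by move=> k l jl; rewrite /agree_from; case: (eS2 k l) => [->|[_ ll _]]; [apply: sm; lia | lia].
  + lia.
  + rewrite ey; case: (ltngtP x y) xy => // [xy _|-> //].
    by apply: ltnW; apply: (sh_in sT) => //; lia.
- move=> T j a p v x T1 r [sT j1 bp _ _] [bx ax mx] hv cl1 IH S b q u S2 r' c cl bS sm cb ba.
  have fr k : box T1 k j = box T k j /\ ent T1 k j = ent T.[(x, j) <- a] k j.
    by have [-> ->] := colins_frame k cl1 (ltnSn j); rewrite box_replace.
  have [[_ ->]|[y [u' [S' [[byS ay my] cl' bS2 eS2]]]]] := colinsE cl.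
    by apply: leq_trans (colins_ge cl1); lia.
  have byT : box T y j by rewrite -(fr _).1 -bS.
  have := sm y j (leqnn j); rewrite /agree_from (fr _).2 ent_set eqxx andbT => ey.
  have [ne ey'] : y <> x /\ ent S y j = ent T y j.
    by case: (y =P x) ey => [_|ne] ey; split=> //; lia.
  have xy : x <= y by rewrite leqNgt; apply/negP => zy; have := mx _ zy byT; lia.
  apply: (IH S' (ent S y j) y u' S2 r' c) => //.
  + by move=> k l; rewrite bS2 bS.
  + by move=> k l jl; rewrite /agree_from; case: (eS2 k l) => [->|[_ ll _]]; [apply: sm; lia | lia].
  + lia.
  + by rewrite ey'; apply: ltnW; apply: (sh_in sT) => //; lia.
Qed.

(** * Insertion paths in the rows *)

(** The state with outer box in row i and value a.  As for columns, p is the column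
    of the box of row i-1 that a comes from, and v tells that it still contains a.
    For i = 1 there is no such box, v is false, and p is the first free column. *)
Definition row_state (T : tableau) (i a p : nat) (v : bool) : Prop :=
  [/\ shtab T /\ (forall k, box T k k -> ~~ odd (ent T k k)), 0 < i,
      1 < i -> [/\ box T i.-1 p, i <= p & if v then ent T i.-1 p = a else ent T i.-1 p < a],
      box T i p -> a < ent T i p &
      v -> 1 < i /\ (p = i -> box T i i)].

(** The analogue of [colins] for a state with outer box in a row.  The hypotheses on
    the numbers in D1 and D4 are those that the nonvanishing of the reading word
    guarantees. *)
Inductive rowins : tableau -> nat -> nat -> nat -> bool -> tableau -> result -> Prop :=
| RowR1 T i a p v j : row_state T i a p v -> rowmax T i a -> firstr T i j ->
    shtab T.[(i, j) <- a] -> rowins T i a p v T.[(i, j) <- a] (R1, (i, j))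
| RowR2 T i a p v j : row_state T i a p v -> rowmax T i a -> firstr T i j -> i < j ->
    ent T i j.-1 = a \/ (v /\ j = p) -> rowins T i a p v T (R2, (i, j))
| RowR3 T i a p v x T1 r : row_state T i a p v -> leastr T i a x -> i < x ->
    ent T i x.-1 = a \/ (v /\ x = p) ->
    rowins T i.+1 (ent T i x) x true T1 r -> rowins T i a p v T1 r
| RowR4 T i a p v x T1 r : row_state T i a p v -> leastr T i a x -> i < x ->
    rowins T.[(i, x) <- a] i.+1 (ent T i x) x false T1 r -> rowins T i a p v T1 r
| RowD1 T i a p v T1 r : row_state T i a p v -> leastr T i a i.+1 -> ~~ box T i.+1 i.+1 ->
    (ent T i i).+1 < ent T i i.+1 -> ent T i i = a \/ (v /\ p = i.+1) ->
    colins T i.+1 (ent T i i.+1) i false T1 r -> rowins T i a p v T1 r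
| RowD2 T i a p v T1 r : row_state T i a p v -> leastr T i a i -> ~~ odd a ->
    v -> p = i -> colins T i.+1 (ent T i i) i true T1 r -> rowins T i a p v T1 r
| RowD3 T i a p v T1 r : row_state T i a p v -> leastr T i a i -> ~~ odd a ->
    colins T.[(i, i) <- a] i.+1 (ent T i i) i false T1 r -> rowins T i a p v T1 r
| RowD4 T i a p v T1 r : row_state T i a p v -> leastr T i a i -> odd a ->
    ent T i i = a.+1 -> colins T i.+1 a.+2 i false T1 r -> rowins T i a p v T1 r.

Lemma rowins_state T i a p v T1 r : rowins T i a p v T1 r -> row_state T i a p v.
Proof. by case. Qed.

Lemma raised_from_mono c c' T T1 k l : c <= c' -> raised_from c' T T1 k l -> raised_from c T T1 k l.
Proof. by move=> cc; apply: raised_from_trans (raised_from_refl _ _ _ _). Qed.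

(** The rows below row i are changed only by the column phase, whose values exceed
    those of the row phase. *)
Lemma rowins_frame T i a p v T1 r k l : rowins T i a p v T1 r -> k < i ->
  raised_from a.+1 T T1 k l.
Proof.
have same (T' : tableau) i' j' a' : k < i' -> raised_from a'.+1 T' T'.[(i', j') <- a'] k l.
  move=> ki; split; rewrite box_set ent_set (ltn_eqF ki) //=; first by split=> //; left.
  by move=> -> /negP.
elim => {T i a p v T1 r}.
- by move=> T i a p v j _ _ _ _; exact: same.
- by move=> *; exact: raised_from_refl.
- move=> T i a p v x T1 r _ [bx ax _] _ _ _ IH ki.
  by apply: raised_from_mono (IH _); lia.
- move=> T i a p v x T1 r _ [bx ax _] _ _ IH ki.
  by apply: raised_from_trans (IH _); [apply: ltnW ax | exact: same | lia].
- move=> T i a p v T1 r _ [bx ax _] _ _ _ /(@colins_raised _ _ _ _ _ _ _ k l) h _.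
  by apply: raised_from_mono h; lia.
- move=> T i a p v T1 r _ [bx ax _] _ _ _ /(@colins_raised _ _ _ _ _ _ _ k l) h _.
  by apply: raised_from_mono h; lia.
- move=> T i a p v T1 r _ [bx ax _] _ /(@colins_raised _ _ _ _ _ _ _ k l) h ki.
  by apply: raised_from_trans h; [exact: ax | exact: same].
- move=> T i a p v T1 r _ [bx ax _] _ _ /(@colins_raised _ _ _ _ _ _ _ k l) h _.
  by apply: raised_from_mono h; lia.
Qed.

(** How T1 arises from T: the shape is unchanged for R2 and C2 and gains the label
    for R1 and C1, and the label of a column path that ends with C1 is not on the
    diagonal. *)
Definition outcome_of (T T1 : tableau) (r : result) : Prop :=
  let: (ty, (i, j)) := r in
  match ty with
  | R1 => firstr T i j /\ (forall k l, box T1 k l = ((k == i) && (l == j)) || box T k l)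
  | R2 => [/\ firstr T i j, i < j & forall k l, box T1 k l = box T k l]
  | C1 => [/\ firstc T i j, i < j & forall k l, box T1 k l = ((k == i) && (l == j)) || box T k l]
  | C2 => [/\ firstc T i j, 1 < i <= j & forall k l, box T1 k l = box T k l]
  | _ => False
  end.

Lemma outcome_of_box (T T' T1 : tableau) r :
  (forall k l, box T' k l = box T k l) -> outcome_of T' T1 r -> outcome_of T T1 r.
Proof.
move=> E; have fr i j : firstr T' i j -> firstr T i j.
  by case=> h1 h2 h3; split=> [//||k /h3]; rewrite -?E.
have fc i j : firstc T' i j -> firstc T i j.
  by case=> h1 h2 h3; split=> [//||k /h3]; rewrite -?E.
case: r => -[] [i j] //=.
- by case=> /fr h1 h2; split=> // k l; rewrite -E.
- by case=> /fr h1 h2 h3; split=> // k l; rewrite -E.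
- by case=> /fc h1 h2 h3; split=> // k l; rewrite -E.
- by case=> /fc h1 h2 h3; split=> // k l; rewrite -E.
Qed.

Lemma colins_outcome T j a p v T1 r : colins T j a p v T1 r -> shtab T1 /\ outcome_of T T1 r.
Proof.
by case: r => ty [i c] /colins_cases [_ sT1 fc [[-> [? ?]]|[-> [? ?]]]].
Qed.

Lemma rowins_outcome T i a p v T1 r : rowins T i a p v T1 r ->
  [/\ shtab T1, outcome_of T T1 r, ~~ prim r -> i <= r.2.1 & box T1 i i].
Proof.
elim => {T i a p v T1 r}.
- move=> T i a p v j _ _ fr sh; split => //=.
    by split=> // k l; rewrite box_set.
  have [ij _ _] := fr.
  have bj : box T.[(i, j) <- a] i j by rewrite box_set !eqxx.
  by apply: (sh_dn sh bj) => //; case/andP: (sh_bd sh bj).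
- move=> T i a p v j [[sT _] i0 _ _ _] _ fr ij _; split => //=.
  by case: fr => _ _; apply; rewrite leqnn.
- move=> T i a p v x T1 r [[sT _] i0 _ _ _] [bx _ _] ix _ _ [h1 h2 h3 h4]; split=> //.
    by move/h3/ltnW.
  by apply: (sh_dn h1 h4).
- move=> T i a p v x T1 r [[sT _] i0 _ _ _] [bx _ _] ix _ [h1 h2 h3 h4]; split=> //.
  + by apply: outcome_of_box h2 => k l; rewrite box_replace.
  + by move/h3/ltnW.
  + by apply: (sh_dn h1 h4).
- move=> T i a p v T1 r [[sT _] i0 _ _ _] [bx _ _] _ _ _ cl.
  have [h1 h2] := colins_outcome cl; split => //; first by rewrite (colins_prim cl).
  by rewrite (colins_frame _ cl (ltnSn i)).1; apply: (sh_dn sT bx).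
- move=> T i a p v T1 r [[sT _] i0 _ _ _] [bx _ _] _ _ _ cl.
  have [h1 h2] := colins_outcome cl; split => //; first by rewrite (colins_prim cl).
  by rewrite (colins_frame _ cl (ltnSn i)).1.
- move=> T i a p v T1 r [[sT _] i0 _ _ _] [bx _ _] _ cl.
  have [h1 h2] := colins_outcome cl; split => //.
  + by apply: outcome_of_box h2 => k l; rewrite box_replace.
  + by rewrite (colins_prim cl).
  + by rewrite (colins_frame _ cl (ltnSn i)).1 box_replace.
- move=> T i a p v T1 r [[sT _] i0 _ _ _] [bx _ _] _ _ cl.
  have [h1 h2] := colins_outcome cl; split => //; first by rewrite (colins_prim cl).
  by rewrite (colins_frame _ cl (ltnSn i)).1.
Qed.

(** * Comparison of two insertions across a turn *)

(** Diagonal entries exceed each other by at least 2, so a value that is smaller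
    than the diagonal entry of its column j is bumped from there, and remains
    smaller than the next diagonal entries.  The last clause makes up for the case
    D2 of the other insertion, where the strict inequality has to come from the
    parity of the values. *)
Lemma colins_advance S j b q u S2 r m : colins S j b q u S2 r ->
  j <= m -> box S m m -> b < ent S j j -> exists S' b' q' u',
  [/\ colins S' m.+1 b' q' u' S2 r, forall k l, box S' k l = box S k l,
      forall k l, m < l -> ent S' k l = ent S k l, b <= b' &
      [/\ b' <= ent S m m, b' <= ent S2 m m &
      (box S q j -> b < ent S q j \/ odd b) -> ~~ odd (ent S m.-1 m) ->
      q' < m /\ b' <= ent S m.-1 m]].
Proof.
move=> cl jm; elim: {jm}(m - j) {-2}j (erefl (m - j)) jm S b q u cl => [|n IH] j' E jm S b q u cl bm hb.
  have {E jm} jm : j' = m by lia.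
  subst j'; have [sS m1 bq hu hq] := colins_state cl.
  have bdq := sh_bd sS bq.
  have bqm : box S q m by apply: (sh_dn sS bm); lia.
  have bm1 : box S m.-1 m by apply: (sh_dn sS bm); lia.
  have [hq1 hq2] := hq bqm.
  have qle : ent S q m <= ent S m.-1 m.
    case: (ltngtP q m.-1) => [?|?|-> //]; last by lia.
    by apply: ltnW; apply: (sh_in sS) => //; lia.
  have [[mx _]|[y [u' [S' [[byS ay my] cl' bS2 eS2]]]]] := colinsE cl.
    by have := mx _ bm; lia.
  have ym := sh_bd sS byS.
  have yle : ent S y m <= ent S m m.
    case: (ltngtP y m) => [?|?|-> //]; last by lia.
    by apply: ltnW; apply: (sh_in sS) => //; lia.
  exists S', (ent S y m), y, u'; split => //.
  - by move=> k l ml; case: (eS2 k l) => // -[]; lia.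
  - exact: ltnW.
  split => //.
    rewrite (colins_frame _ cl' (ltnSn m)).2; case: (eS2 m m) => [-> //|[my' _ hh]].
    by have := hh q _ bqm; lia.
  move=> hs od; have bl : b < ent S m.-1 m.
    case: (ltngtP q m.-1) => [?|?|qe]; [|by lia|].
      by apply: leq_trans (hq2 _) qle; lia.
    case: (hs bqm) => [?|ob]; first by apply: leq_trans qle.
    by move: hq1 od ob; rewrite qe leq_eqVlt => /orP[/eqP -> /negbTE ->|].
  have ym1 : y <= m.-1 by rewrite leqNgt; apply/negP => h; have := my _ h bm1; lia.
  split; first lia.
  case: (ltngtP y m.-1) => [?|?|-> //]; last by lia.
  by apply: ltnW; apply: (sh_in sS) => //; lia.
have [sS j1 bq hu hq] := colins_state cl.
have bj : box S j' j' by apply: (sh_dn sS bm); lia.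
have bj1 : box S j'.+1 j'.+1 by apply: (sh_dn sS bm); lia.
have [[mx _]|[y [u' [S' [[byS ay my] cl' bS2 eS2]]]]] := colinsE cl.
  by have := mx _ bj; lia.
have ym := sh_bd sS byS; clear hq hu.
have eS3 k l : j' < l -> ent S' k l = ent S k l.
  by move=> ml; case: (eS2 k l) => // -[]; lia.
have byj : box S y j'.+1 by apply: (sh_dn sS bj1); lia.
have h1 : ent S y j' < ent S y j'.+1 by apply: (sh_in sS) => //; lia.
have h2 : ent S y j'.+1 <= ent S j'.+1 j'.+1.
  by apply: ltnW; apply: (sh_in sS) => //; lia.
have E' : m - j'.+1 = n by lia.
have jm' : j'.+1 <= m by lia.
have bm' : box S' m m by rewrite bS2.
have hb' : ent S y j' < ent S' j'.+1 j'.+1 by rewrite eS3 //; exact: leq_trans h1 h2.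
have [S3 [b3 [q3 [u3 [c1 c2 c3 c4 [c5 c6 c7]]]]]] := IH _ E' jm' S' _ _ _ cl' bm' hb'.
exists S3, b3, q3, u3; split => //.
- by move=> k l; rewrite c2 bS2.
- by move=> k l ml; rewrite c3 // eS3 //; exact: leq_trans jm' (ltnW ml).
- by apply: leq_trans c4; apply: ltnW.
split => //.
  by move: c5; rewrite eS3.
by move=> _ od; move: c7; rewrite !eS3 //; last lia; apply => //; left.
Qed.

(** What a comparison needs to know about the second path: it ends in this row, goes
    up, or turns; c is the value that it carries after the turn. *)
Inductive rowspec S i b S2 (r : result) : Prop :=
| SpecStop of rowmax S i b & r.2.1 = i & ~~ prim r
| SpecUp y u' S' of i < y & leastr S i b y &
    rowins S' i.+1 (ent S i y) y u' S2 r &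
    (forall k l, box S' k l = box S k l) &
    (forall k l, ent S' k l = ent S k l \/ [/\ k = i, l = y & ent S' k l = b])
| SpecTurn y c u' S' of leastr S i b y & colins S' i.+1 c i u' S2 r &
    (forall k l, box S' k l = box S k l) &
    (forall k l, i < l -> ent S' k l = ent S k l) & b < c &
    [\/ [/\ y = i.+1, ~~ box S i.+1 i.+1 & c = ent S i i.+1],
        [/\ y = i, ~~ odd b & c = ent S i i] |
        [/\ y = i, odd b, ent S i i = b.+1 & c = b.+2]].

Lemma rowinsE S i b q u S2 r : rowins S i b q u S2 r -> rowspec S i b S2 r.
Proof.
case=> {S i b q u S2 r}.
- by move=> T i a p v j _ mx _ _; exact: SpecStop.
- by move=> T i a p v j _ mx _ _ _; exact: SpecStop.
- by move=> T i a p v x T1 r _ lx ix _ h; apply: (SpecUp ix lx h) => // k l; left.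
- move=> T i a p v x T1 r _ lx ix h; have [bx _ _] := lx; apply: (SpecUp ix lx h).
    by move=> k l; rewrite box_replace.
  by move=> k l; rewrite ent_set; case: andP => [[/eqP -> /eqP ->]|_]; [right|left].
- move=> T i a p v T1 r _ lx nb _ _ h; have [_ ax _] := lx.
  by apply: (SpecTurn lx h) => //; constructor 1.
- move=> T i a p v T1 r _ lx nb _ _ h; have [_ ax _] := lx.
  by apply: (SpecTurn lx h) => //; constructor 2.
- move=> T i a p v T1 r _ lx od h; have [bx ax _] := lx.
  apply: (SpecTurn lx h) => //; last by constructor 2.
    by move=> k l; rewrite box_replace.
  by move=> k l il; rewrite ent_other // xpair_eqE negb_and (gtn_eqF il) orbT.
- move=> T i a p v T1 r _ lx nb ? h; have [_ ax _] := lx.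
  by apply: (SpecTurn lx h) => //; constructor 3.
Qed.

Lemma rowins_ge T i a p v T1 r : rowins T i a p v T1 r -> ~~ prim r -> i <= r.2.1.
Proof. by case/rowins_outcome. Qed.

(** The row analogue of [colins_pass], for paths that do not turn. *)
Lemma rowins_pass S i b q u S2 r z : rowins S i b q u S2 r ->
  i <= z -> box S i z -> b < ent S i z ->
  prim r \/ forall k, box S k z -> k < r.2.1.
Proof.
move=> h; elim: h z => {S i b q u S2 r}.
- by move=> T i a p v j _ mx _ _ z _ bz az; have := mx _ bz; lia.
- by move=> T i a p v j _ mx _ _ _ z _ bz az; have := mx _ bz; lia.
- move=> T i a p v x T1 r [[sT _] i0 _ _ _] [bx ax mx] ix _ rw IH z iz bz az.
  case: (boolP (prim r)) => [|np]; [by left | right => k bk].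
  have g := rowins_ge rw np; case: (leqP k i) => ki; first lia.
  have kz := sh_bd sT bk.
  have xz : x <= z by rewrite leqNgt; apply/negP => h; have := mx _ h bz; lia.
  have bz1 : box T i.+1 z by apply: (sh_dn sT bk); lia.
  have [||pr|hk] := IH z _ bz1; [lia | by apply: (sh_in sT) => //; lia| |exact: hk].
  by rewrite pr in np.
- move=> T i a p v x T1 r [[sT _] i0 _ _ _] [bx ax mx] ix rw IH z iz bz az.
  case: (boolP (prim r)) => [|np]; [by left | right => k bk].
  have g := rowins_ge rw np; case: (leqP k i) => ki; first lia.
  have kz := sh_bd sT bk.
  have xz : x <= z by rewrite leqNgt; apply/negP => h; have := mx _ h bz; lia.
  have bz1 : box T i.+1 z by apply: (sh_dn sT bk); lia.
  have [|||pr|hk] := IH z; [lia | by rewrite box_replace | | |by apply: hk; rewrite box_replace].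
    by rewrite ent_other; [apply: (sh_in sT) => //; lia | apply/eqP => -[]; lia].
  by rewrite pr in np.
- by move=> T i a p v T1 r _ _ _ _ _ /colins_prim; left.
- by move=> T i a p v T1 r _ _ _ _ _ /colins_prim; left.
- by move=> T i a p v T1 r _ _ _ /colins_prim; left.
- by move=> T i a p v T1 r _ _ _ _ /colins_prim; left.
Qed.

(** The second path has turned first, at a row below the turn of the first one.  By
    the time it reaches the column where the first path starts in the columns, its
    value is at most the diagonal entry that the first path met, hence smaller than
    the value which that path carries on. *)
Lemma mix_lt T i a p v T1 r : rowins T i a p v T1 r ->
  forall S j b q u S2 r', colins S j b q u S2 r' ->
  (forall k l, box S k l = box T1 k l) -> j <= i ->
  (forall k l, j <= l -> j <= k.+1 -> ent S k l = ent T1 k l) ->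
  (forall k l, j <= l -> agree_from b S T1 k l) ->
  (box S q j -> b < ent S q j \/ odd b) -> b < ent S j j -> prim r ->
  forall l, box T1 (endrow r) l -> l < r'.2.2.
Proof.
elim => {T i a p v T1 r}.
- by [].
- by [].
- move=> T i a p v x T1 r _ _ _ _ _ IH S j b q u S2 r' cl bS ji ex sm st bj pr l.
  by apply: (IH S j b q u S2 r' cl) => //; apply: leqW.
- move=> T i a p v x T1 r _ _ _ _ IH S j b q u S2 r' cl bS ji ex sm st bj pr l.
  by apply: (IH S j b q u S2 r' cl) => //; apply: leqW.
- move=> T i a p v T1 r [[sT _] i0 _ _ _] [bx ax mx] _ ed _ cl1 S j b q u S2 r' cl bS ji ex sm st bj pr.
  have [fb fe] := colins_frame i cl1 (ltnSn i).
  have bi : box T i i by apply: (sh_dn sT bx).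
  have bSi : box S i i by rewrite bS fb.
  have [S' [b' [q' [u' [c1 c2 c3 c4 [c5 c6 c7]]]]]] := colins_advance cl ji bSi bj.
  apply: (colins_lt cl1 (c := b) c1) => //; first by move=> k l; rewrite c2 bS.
    by move=> k l il; rewrite /agree_from c3 //; apply: sm; apply: ltnW; exact: leq_ltn_trans ji il.
  by clear c7; move: c5; rewrite ex ?fe; lia.
- move=> T i a p v T1 r [[sT dg] i0 hp _ hv] [bx ax mx] od vv pi cl1 S j b q u S2 r' cl bS ji ex sm st bj pr.
  have [fb fe] := colins_frame i cl1 (ltnSn i).
  have [fb1 fe1] := colins_frame i.-1 cl1 (ltnSn i).
  have bSi : box S i i by rewrite bS fb.
  have [S' [b' [q' [u' [c1 c2 c3 c4 [c5 c6 c7]]]]]] := colins_advance cl ji bSi bj.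
  have [i1 _] := hv vv; have [] := hp i1; rewrite vv pi => bi1 _ ea.
  have e1 : ent S i.-1 i = a by rewrite ex ?fe1 ?prednK.
  have [|qi ba] := c7 st _; first by rewrite e1.
  apply: (colins_lt cl1 (c := b) c1) => //; first by move=> k l; rewrite c2 bS.
    by move=> k l il; rewrite /agree_from c3 //; apply: sm; apply: ltnW; exact: leq_ltn_trans ji il.
  by rewrite e1 in ba; exact: leq_ltn_trans ax.
- move=> T i a p v T1 r [[sT dg] i0 hp _ hv] [bx ax mx] od cl1 S j b q u S2 r' cl bS ji ex sm st bj pr.
  have [fb fe] := colins_frame i cl1 (ltnSn i).
  have bSi : box S i i by rewrite bS fb box_replace.
  have [S' [b' [q' [u' [c1 c2 c3 c4 [c5 c6 c7]]]]]] := colins_advance cl ji bSi bj.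
  apply: (colins_lt cl1 (c := b) c1) => //; first by move=> k l; rewrite c2 bS.
    by move=> k l il; rewrite /agree_from c3 //; apply: sm; apply: ltnW; exact: leq_ltn_trans ji il.
  by clear c7; move: c5; rewrite ex ?fe ?ent_same; clear hp hv st sm; lia.
- move=> T i a p v T1 r [[sT dg] i0 hp _ hv] [bx ax mx] od ea cl1 S j b q u S2 r' cl bS ji ex sm st bj pr.
  have [fb fe] := colins_frame i cl1 (ltnSn i).
  have bSi : box S i i by rewrite bS fb.
  have [S' [b' [q' [u' [c1 c2 c3 c4 [c5 c6 c7]]]]]] := colins_advance cl ji bSi bj.
  apply: (colins_lt cl1 (c := b) c1) => //; first by move=> k l; rewrite c2 bS.
    by move=> k l il; rewrite /agree_from c3 //; apply: sm; apply: ltnW; exact: leq_ltn_trans ji il.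
  by clear c7; move: c5; rewrite ex ?fe ?ea; clear hp hv st sm; lia.
Qed.

(** The first path has turned first.  The second one turns at a diagonal box that
    the first one has passed, and what the first path carried beyond it is at most
    the entry there. *)
Lemma mix_le S i b q u S2 r' : rowins S i b q u S2 r' ->
  forall T j a p v T1 r, colins T j a p v T1 r ->
  (forall k l, box S k l = box T1 k l) -> j <= i ->
  (forall k l, i <= k -> ent S k l = ent T1 k l) ->
  (forall k l, agree_from b.+1 S T1 k l) ->
  (box T j j -> a < ent T j j) -> prim r' -> r'.2.2 <= r.2.2.
Proof.
have boxT T j a p v T1 r m : colins T j a p v T1 r -> box T1 m m -> box T m m.
  case: r => ty [k l] /colins_cases [_ _ _ [[_ [kl ->]]|[_ [_ ->]] //]].
  by case: eqP => //= ->; rewrite (ltn_eqF kl).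
elim => {S i b q u S2 r'}.
- by [].
- by [].
- move=> S i b q u x S2 r' _ [bx bb mx] _ _ rw IH T j a p v T1 r cl bT ji ex sm st pr.
  apply: (IH _ _ _ _ _ _ _ cl) => //; [lia | by move=> k l ik; apply: ex; lia|].
  by move=> k l; case: (sm k l) => [|?]; [left | right; lia].
- move=> S i b q u x S2 r' _ [bx bb mx] _ rw IH T j a p v T1 r cl bT ji ex sm st pr.
  apply: (IH _ _ _ _ _ _ _ cl) => //.
  + by move=> k l; rewrite box_replace.
  + lia.
  + by move=> k l ik; rewrite ent_other ?ex //; [lia| apply/eqP => -[]; lia].
  + move=> k l; rewrite /agree_from ent_set; case: andP => [[/eqP -> /eqP ->]|_].
      by right; rewrite -ex //; lia.
    by case: (sm k l) => [|?]; [left | right; lia].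
- move=> S i b q u S2 r' [[sS _] i0 _ _ _] [bx bb mx] _ ed _ cl' T j a p v T1 r cl bT ji ex sm st pr.
  have bi : box S i i by apply: (sh_dn sS bx).
  have bTi : box T i i by apply: (boxT _ _ _ _ _ _ _ _ cl); rewrite -bT.
  have bTj : box T j j by case: (colins_state cl) => sT j1 _ _ _; apply: (sh_dn sT bTi); lia.
  have [T' [a' [p' [v' [c1 c2 c3 c4 [c5 c6 c7]]]]]] := colins_advance cl ji bTi (st bTj).
  apply: (colins_le c1 (c := b.+1) cl') => //.
  by clear c7; move: c6; rewrite -ex //; clear sm st; lia.
- move=> S i b q u S2 r' [[sS _] i0 _ _ _] [bi bb mx] _ _ _ cl' T j a p v T1 r cl bT ji ex sm st pr.
  have bTi : box T i i by apply: (boxT _ _ _ _ _ _ _ _ cl); rewrite -bT.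
  have bTj : box T j j by case: (colins_state cl) => sT j1 _ _ _; apply: (sh_dn sT bTi); lia.
  have [T' [a' [p' [v' [c1 c2 c3 c4 [c5 c6 c7]]]]]] := colins_advance cl ji bTi (st bTj).
  apply: (colins_le c1 (c := b.+1) cl') => //.
  by clear c7; move: c6; rewrite -ex //; clear sm st; lia.
- move=> S i b q u S2 r' [[sS _] i0 _ _ _] [bi bb mx] _ cl' T j a p v T1 r cl bT ji ex sm st pr.
  have bTi : box T i i by apply: (boxT _ _ _ _ _ _ _ _ cl); rewrite -bT.
  have bTj : box T j j by case: (colins_state cl) => sT j1 _ _ _; apply: (sh_dn sT bTi); lia.
  have [T' [a' [p' [v' [c1 c2 c3 c4 [c5 c6 c7]]]]]] := colins_advance cl ji bTi (st bTj).
  apply: (colins_le c1 (c := b.+1) cl') => //.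
  + by move=> k l; rewrite box_replace.
  + by move=> k l il; rewrite /agree_from ent_other; [exact: sm | apply/eqP => -[]; lia].
  + by clear c7; move: c6; rewrite -ex //; clear sm st; lia.
- move=> S i b q u S2 r' [[sS _] i0 _ _ _] [bi bb mx] _ eb cl' T j a p v T1 r cl bT ji ex sm st pr.
  have bTi : box T i i by apply: (boxT _ _ _ _ _ _ _ _ cl); rewrite -bT.
  have bTj : box T j j by case: (colins_state cl) => sT j1 _ _ _; apply: (sh_dn sT bTi); lia.
  have [T' [a' [p' [v' [c1 c2 c3 c4 [c5 c6 c7]]]]]] := colins_advance cl ji bTi (st bTj).
  apply: (colins_le c1 (c := b.+1) cl') => //.
  by clear c7; move: c6; rewrite -ex //; clear sm st; lia.
Qed.

(** * Comparison of two insertions in the rows *)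

(** The second path, with last transition r', ends beyond the first one. *)
Definition later T1 r r' : Prop :=
  if prim r then prim r' /\ forall l, box T1 (endrow r) l -> l < r'.2.2
  else prim r' \/ forall k, box T1 k (endcol r) -> k < r'.2.1.

Lemma rowins_keep T i a p v T1 r k l : rowins T i a p v T1 r -> k < i ->
  box T k l -> ent T k l <= a -> box T1 k l /\ ent T1 k l = ent T k l.
Proof. by move=> h ki b e; case: (rowins_frame l h ki) => /(_ b) [-> hh] _; split => //; lia. Qed.

(** The step of [rowins_lt] in which the first path goes up: some entry at column z
    of the row is larger than b and smaller than the value a' that the first path
    carries on. *)
Lemma lt_up T' i a' x v' T1 r S b q u S2 r' z :
  rowins T' i.+1 a' x v' T1 r ->
  (forall S b q u S2 r', rowins S i.+1 b q u S2 r' ->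
    (forall k l, box S k l = box T1 k l) ->
    (forall k l, i.+1 <= k -> ent S k l = ent T1 k l) ->
    (forall k l, agree_from b.+1 S T1 k l) ->
    b < a' -> (v' -> q < x) -> later T1 r r') ->
  rowins S i b q u S2 r' ->
  (forall k l, box S k l = box T1 k l) ->
  (forall k l, i <= k -> ent S k l = ent T1 k l) ->
  (forall k l, agree_from b.+1 S T1 k l) ->
  box S i z -> b < ent S i z -> ent S i z < a' -> z <= x -> (v' -> z < x) -> later T1 r r'.
Proof.
move=> rw1 IH rw bS ex sm bz bb za zx vz.
have [[sS _] i0 _ _ _] := rowins_state rw.
case: (rowinsE rw) => [mx _ _|y u' S' iy [by_ hy my] rw' bS' eS'|y c u' S' [by_ hy my] cl bS' eS' bc hc].
- by have := mx _ bz; lia.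
- have yz : y <= z by rewrite leqNgt; apply/negP => h; have := my _ h bz; lia.
  have ez : ent S i y <= ent S i z.
    case: (ltngtP y z) => [?|?|-> //]; last by lia.
    by apply: ltnW; apply: (sh_in sS) => //; lia.
  apply: (IH _ _ _ _ _ _ rw') => //.
  + by move=> k l; rewrite bS' bS.
  + by move=> k l ik; case: (eS' k l) => [->|[]]; [apply: ex; lia | lia].
  + move=> k l; rewrite /agree_from; case: (eS' k l) => [->|[-> -> ->]].
      by case: (sm k l) => [|?]; [left | right; lia].
    by right; rewrite -ex //; lia.
  + by apply: leq_ltn_trans za.
  + by move/vz; apply: leq_ltn_trans.
- have pr' := colins_prim cl; rewrite /later pr'; case: (boolP (prim r)) => pr; last by left.
  split=> //; clear IH vz.
  have [sT1 _ _ b11] := rowins_outcome rw1.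
  have b22 : box S i.+1 i.+1 by rewrite bS.
  have bii : box S i i by apply: (sh_dn sS b22).
  have bi1 : box S i i.+1 by apply: (sh_dn sS b22).
  have e1 : ent S i i < ent S i i.+1 by apply: (sh_in sS) => //; lia.
  have e2 : ent S i i.+1 < ent S i.+1 i.+1 by apply: (sh_in sS) => //; lia.
  apply: (mix_lt rw1 cl) => //.
  + by move=> k l; rewrite bS' bS.
  + by move=> k l il ik; rewrite eS' // ex.
  + by move=> k l il; rewrite /agree_from eS' //; case: (sm k l) => [|?]; [left | right; lia].
  + rewrite eS' // => _; case: hc => [[_ /negP //]|[_ _ ->]|[_ od _ ->]]; first by left.
    by right; rewrite /= negbK.
  + rewrite eS' //; case: hc => [[_ /negP //]|[_ _ ->]|[_ od ee ->]]; lia.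
Qed.

(** If a was kept out by the box below, then b, which comes from further left, is
    smaller than the entry on the left of that position. *)
Lemma lt_vert S i b q u p : row_state S i b q u -> 1 < i -> q < p -> box S i p.-1 ->
  b < ent S i p.-1.
Proof.
move=> [[sS _] i0 hq hb _] i1 qp bz; have [bq iq _] := hq i1.
have bSq : box S i q by apply: (sh_dn sS bz); lia.
apply: leq_trans (hb bSq) _; case: (ltngtP q p.-1) => [qq| |->] //; last by lia.
by apply: ltnW; apply: (sh_in sS) => //; lia.
Qed.

(** The step in which both paths turn at row i. *)
Lemma lt_turn T' i c v' T1 r S b q u S2 r' : colins T' i.+1 c i v' T1 r ->
    rowins S i b q u S2 r' -> (forall k l, box S k l = box T1 k l) ->
    (forall k l, agree_from b.+1 S T1 k l) -> v' = false ->
    box S i i -> b < ent S i i ->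
    (~~ odd b -> ent S i i < c) -> (odd b -> ent S i i = b.+1 -> b.+2 < c) ->
    later T1 r r'.
Proof.
  move=> cl1 rw bS sm v0 bi hb h1 h2.
  case: (rowinsE rw) => [mx _ _|y u' S' iy [by_ hy my] rw' bS' eS'|y c' u' S' [by_ hy my] cl bS' eS' bc hc].
  - by have := mx _ bi; lia.
  - by have := my _ iy bi; lia.
  - have y0 : y != i.+1 by apply/eqP => ye; have := my i _ bi; rewrite ye; lia.
    rewrite /later (colins_prim cl) (colins_prim cl1); split=> //.
    apply: (colins_lt cl1 (c := b.+1) cl) => //.
    + by move=> k l; rewrite bS' bS.
    + by move=> k l il; rewrite /agree_from eS' //; exact: sm.
    + case: hc => [[ye]|[_ od ->]|[_ od ee ->]]; first by rewrite ye eqxx in y0.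
        exact: h1.
      exact: h2.
    + by rewrite v0.
Qed.

(** The row analogue of [colins_lt].  When the first path turns, so does the second
    one, at the same row or before, and its value is smaller: for D1 by the gap
    between the diagonal entry and its right neighbour, for D3 because diagonal
    entries are even, and for D4 because two odd values that are both one less than
    the same diagonal entry would be equal. *)
Lemma rowins_lt T i a p v T1 r : rowins T i a p v T1 r ->
  forall S b q u S2 r', rowins S i b q u S2 r' ->
  (forall k l, box S k l = box T1 k l) ->
  (forall k l, i <= k -> ent S k l = ent T1 k l) ->
  (forall k l, agree_from b.+1 S T1 k l) ->
  b < a -> (v -> q < p) -> later T1 r r'.
Proof.
move=> h; elim: h => {T i a p v T1 r}.
- move=> T i a p v j [[sT dg] i0 hp hbp hv] mx fr sh S b q u S2 r' rw bS ex sm ba vq.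
  rewrite /later /=; have [ij nj _] := fr.
  have := rowins_pass rw ij; rewrite bS box_set !eqxx ex // ent_same => /(_ isT ba) [pr|hk].
    by left.
  by right => k bk; apply: hk; rewrite bS.
- move=> T i a p v j [[sT dg] i0 hp hbp hv] mx fr ij he S b q u S2 r' rw bS ex sm ba vq.
  have [_ nj hj] := fr; have bz : box S i j.-1 by rewrite bS; apply: hj; lia.
  have zz : b < ent S i j.-1.
    case: he => [e|[vv ej]]; first by rewrite ex // e.
    by rewrite ej in bz *; apply: (lt_vert (rowins_state rw)) => //; [case: (hv vv) | exact: vq].
  rewrite /later /=; have [|pr|hk] := rowins_pass rw _ bz zz; first lia.
    by left.
  by right => k bk; apply: hk; rewrite bS.
- move=> T i a p v x T1 r [[sT dg] i0 hp hbp hv] [bx ax mx] ix he rw1 IH S b q u S2 r' rw bS ex sm ba vq.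
  have bxT : box T i x.-1 by apply: (sh_dn sT bx); lia.
  have exa : ent T i x.-1 <= a by apply: mx => //; lia.
  have [bz1 ez1] : box T1 i x.-1 /\ ent T1 i x.-1 = ent T i x.-1.
    by apply: (rowins_keep rw1) => //; lia.
  have bz : box S i x.-1 by rewrite bS.
  have ez : ent S i x.-1 = ent T i x.-1 by rewrite ex.
  have zz : b < ent S i x.-1.
    case: he => [e|[vv ej]]; first by rewrite ez e.
    by rewrite ej in bz *; apply: (lt_vert (rowins_state rw)) => //; [case: (hv vv) | exact: vq].
  apply: (lt_up rw1 IH rw bS ex sm bz zz); [|lia..].
  by rewrite ez; apply: (sh_in sT) => //; lia.
- move=> T i a p v x T1 r [[sT dg] i0 hp hbp hv] [bx ax mx] ix rw1 IH S b q u S2 r' rw bS ex sm ba vq.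
  have [bz1 ez1] : box T1 i x /\ ent T1 i x = ent T.[(i, x) <- a] i x.
    by apply: (rowins_keep rw1) => //; rewrite ?box_replace ?ent_same //; lia.
  have bz : box S i x by rewrite bS.
  have ez : ent S i x = a by rewrite ex // ez1 ent_same.
  by apply: (lt_up rw1 IH rw bS ex sm bz); rewrite ?ez.
- move=> T i a p v T1 r [[sT dg] i0 hp hbp hv] [bx ax mx] nb ed he cl S b q u S2 r' rw bS ex sm ba vq.
  have bi : box T i i by apply: (sh_dn sT bx).
  have [fb fe] := colins_frame i cl (ltnSn i).
  have bz : box S i i by rewrite bS fb.
  have ez : ent S i i = ent T i i by rewrite ex.
  have zz : b < ent S i i.
    case: he => [e|[vv ej]]; first by rewrite ez e.
    have : b < ent S i p.-1.
      by apply: (lt_vert (rowins_state rw)); [case: (hv vv) | exact: vq | rewrite ej].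
    by rewrite ej.
  by apply: (lt_turn cl rw) => //; rewrite ez; [move=> _; lia | move=> _ e; lia].
(* Now p = i, but a value that goes up from row i-1 comes from column i or from
   further right. *)
- move=> T i a p v T1 r [[sT dg] i0 hp hbp hv] [bx ax mx] od vv pi cl S b q u S2 r' rw bS ex sm ba vq.
  have [[sS _] _ hq _ _] := rowins_state rw; have [i1 _] := hv vv.
  by have [_ iq _] := hq i1; have := vq vv; rewrite pi; lia.
- move=> T i a p v T1 r [[sT dg] i0 hp hbp hv] [bx ax mx] od cl S b q u S2 r' rw bS ex sm ba vq.
  have [fb fe] := colins_frame i cl (ltnSn i).
  have bz : box S i i by rewrite bS fb box_replace.
  have ez : ent S i i = a by rewrite ex // fe ent_same.
  apply: (lt_turn cl rw) => //; rewrite ez //.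
  (* If b is odd and a = b+1, the even diagonal entry, which exceeds a, is at least
     b+3. *)
  move=> ob e; have := dg _ bx; case: (ltngtP b.+2 (ent T i i)) => [//| |<-]; last by rewrite /= ob.
  by rewrite e in ax *; lia.
- move=> T i a p v T1 r [[sT dg] i0 hp hbp hv] [bx ax mx] od ea cl S b q u S2 r' rw bS ex sm ba vq.
  have [fb fe] := colins_frame i cl (ltnSn i).
  have bz : box S i i by rewrite bS fb.
  have ez : ent S i i = a.+1 by rewrite ex // fe.
  by apply: (lt_turn cl rw) => //; rewrite ez //; lia.
Qed.

Definition earlier r r' : Prop :=
  if prim r then prim r' -> r'.2.2 <= r.2.2 else ~~ prim r' /\ r'.2.1 <= r.2.1.

Lemma le_up T' i a' x v' T1 r S b q u S2 r' c :
  rowins T' i.+1 a' x v' T1 r ->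
  (forall S b q u S2 r', rowins S i.+1 b q u S2 r' ->
    (forall k l, box S k l = box T1 k l) ->
    (forall k l, i.+1 <= k -> ent S k l = ent T1 k l) ->
    (forall k l, agree_from b.+1 S T1 k l) -> a' <= b -> earlier r r') ->
  rowins S i b q u S2 r' ->
  (forall k l, box S k l = box T1 k l) ->
  (forall k l, i <= k -> ent S k l = ent T1 k l) ->
  (forall k l, agree_from b.+1 S T1 k l) ->
  c <= b -> (forall l, box T1 i l -> c < ent T1 i l -> a' <= ent T1 i l) ->
  ent S i i <= c -> earlier r r'.
Proof.
move=> rw1 IH rw bS ex sm ba hc hi.
case: (rowinsE rw) => [mx r2 np|y u' S' iy [by_ hy my] rw' bS' eS'|y d u' S' [by_ hy my] cl bS' eS' bd hd].
- rewrite /earlier (negbTE np); case: (boolP (prim r)) => // pr; split => //.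
  by have := rowins_ge rw1 pr; rewrite r2; apply: ltnW.
- apply: (IH _ _ _ _ _ _ rw').
  + by move=> k l; rewrite bS' bS.
  + by move=> k l ik; case: (eS' k l) => [->|[]]; [apply: ex; exact: ltnW | lia].
  + move=> k l; rewrite /agree_from; case: (eS' k l) => [->|[-> -> ->]].
      by case: (sm k l) => [|?]; [left | right; lia].
    by right; rewrite -ex //; lia.
  + rewrite ex //; apply: hc; first by rewrite -bS.
    by rewrite -ex //; apply: leq_ltn_trans hy.
- case: hd => [[_ nb _]|[yi _ _]|[yi _ _ _]].
  + by have [_ _ _ b11] := rowins_outcome rw1; rewrite bS b11 in nb.
  + by rewrite yi in hy; lia.
  + by rewrite yi in hy; lia.
Qed.

Lemma le_turn T' i c v' T1 r S b q u S2 r' : colins T' i.+1 c i v' T1 r ->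
  rowins S i b q u S2 r' ->
  (forall k l, box S k l = box T1 k l) ->
  (forall k l, i <= k -> ent S k l = ent T1 k l) ->
  (forall k l, agree_from b.+1 S T1 k l) ->
  (box T' i.+1 i.+1 -> c < ent T' i.+1 i.+1) ->
  (~~ odd b -> b < ent S i i -> c <= ent S i i) ->
  (odd b -> ent S i i = b.+1 -> c <= b.+2) ->
  (ent S i i <= b -> box S i i.+1 -> c <= ent S i i.+1) ->
  earlier r r'.
Proof.
move=> cl1 rw bS ex sm hT h1 h2 h3; rewrite /earlier (colins_prim cl1).
have [[sS _] i0 _ _ _] := rowins_state rw.
case: (rowinsE rw) => [mx r2 np|y u' S' iy [by_ hy my] rw' bS' eS'|y d u' S' [by_ hy my] cl bS' eS' bd hd].
- by rewrite (negbTE np).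
- apply: (mix_le rw' cl1) => //.
  + by move=> k l; rewrite bS' bS.
  + by move=> k l ik; case: (eS' k l) => [->|[]]; [apply: ex; exact: ltnW | lia].
  + move=> k l; rewrite /agree_from; case: (eS' k l) => [->|[-> -> ->]].
      by case: (sm k l) => [|?]; [left | right; lia].
    by right; rewrite -ex //; lia.
- move=> _; apply: (colins_le cl1 (c := b.+1) cl) => //.
  + by move=> k l; rewrite bS' bS.
  + by move=> k l il; rewrite /agree_from eS' //; exact: sm.
  + case: hd => [[yi _ ->]|[yi ob ->]|[yi ob ee ->]].
    * rewrite yi in by_ my; apply: h3 => //; apply: my => //.
      by apply: (sh_dn sS by_).
    * by rewrite yi in hy; exact: h1.
    * exact: h2.
Qed.

(** The row analogue of [colins_le].  The first insertion leaves an entry at most a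
    on the diagonal as long as its path goes up, so the second path cannot turn
    before the first one. *)
Lemma rowins_le T i a p v T1 r : rowins T i a p v T1 r ->
  forall S b q u S2 r', rowins S i b q u S2 r' ->
  (forall k l, box S k l = box T1 k l) ->
  (forall k l, i <= k -> ent S k l = ent T1 k l) ->
  (forall k l, agree_from b.+1 S T1 k l) -> a <= b -> earlier r r'.
Proof.
move=> h; elim: h => {T i a p v T1 r}.
- move=> T i a p v j [[sT dg] i0 hp hbp hv] mx fr sh S b q u S2 r' rw bS ex sm ab.
  have mxS : rowmax S i b.
    move=> k; rewrite bS box_set ex // ent_set eqxx /=.
    by case: eqP => //= _ /mx h; exact: leq_trans ab.
  case: (rowinsE rw) => [_ r2 np|y u' S' iy [by_ hy my]|y d u' S' [by_ hy my]].
  + by rewrite /earlier /= r2.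
  + by have := mxS _ by_; lia.
  + by have := mxS _ by_; lia.
- move=> T i a p v j [[sT dg] i0 hp hbp hv] mx fr ij he S b q u S2 r' rw bS ex sm ab.
  have mxS : rowmax S i b.
    by move=> k; rewrite bS ex // => /mx h; exact: leq_trans ab.
  case: (rowinsE rw) => [_ r2 np|y u' S' iy [by_ hy my]|y d u' S' [by_ hy my]].
  + by rewrite /earlier /= r2.
  + by have := mxS _ by_; lia.
  + by have := mxS _ by_; lia.
- move=> T i a p v x T1 r [[sT dg] i0 hp hbp hv] [bx ax mx] ix he rw1 IH S b q u S2 r' rw bS ex sm ab.
  have bi : box T i i by apply: (sh_dn sT bx) => //; exact: ltnW.
  apply: (le_up rw1 IH rw bS ex sm ab).
    move=> l bl al; have [h1 h2] := rowins_frame l rw1 (ltnSn i).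
    case: (boolP (box T i l)) => btl; last by apply: ltnW; apply: h2.
    case: (h1 btl) => _ [e|/andP[e _]]; last exact: ltnW.
    rewrite e in al *; case: (ltngtP l x) => [lx|xl|-> //].
      by have := mx _ lx btl; lia.
    by apply: ltnW; apply: (sh_in sT) => //; lia.
  rewrite ex //; have [||_ ->] := @rowins_keep _ _ _ _ _ _ _ i i rw1 _ bi => //.
    by apply: ltnW; apply: leq_ltn_trans ax; apply: mx.
  exact: mx.
- move=> T i a p v x T1 r [[sT dg] i0 hp hbp hv] [bx ax mx] ix rw1 IH S b q u S2 r' rw bS ex sm ab.
  have bi : box T i i by apply: (sh_dn sT bx) => //; exact: ltnW.
  apply: (le_up rw1 IH rw bS ex sm ab).
    move=> l bl al; have [] := rowins_frame l rw1 (ltnSn i).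
    rewrite box_replace // ent_set eqxx /= => h1 h2.
    case: (boolP (box T i l)) => btl; last by apply: ltnW; apply: h2.
    case: (h1 btl) => _ [e|/andP[e _]]; last exact: ltnW.
    move: e; case: eqP => [_ e|_ e]; first by rewrite e ltnn in al.
    rewrite e in al *; case: (ltngtP l x) => [lx|xl|-> //].
      by have := mx _ lx btl; lia.
    by apply: ltnW; apply: (sh_in sT) => //; lia.
  have ei : ent T.[(i, x) <- a] i i = ent T i i.
    by rewrite ent_other //; apply/eqP => -[]; lia.
  rewrite ex //; have [|||_ ->] := @rowins_keep _ _ _ _ _ _ _ i i rw1; rewrite ?ei ?box_replace //.
    by apply: ltnW; apply: leq_ltn_trans ax; apply: mx.
  exact: mx.
- move=> T i a p v T1 r [[sT dg] i0 hp hbp hv] [bx ax mx] nb ed he cl S b q u S2 r' rw bS ex sm ab.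
  have bi : box T i i by apply: (sh_dn sT bx).
  have [fb fe] := colins_frame i cl (ltnSn i).
  have ai := mx i (ltnSn i) bi.
  apply: (le_turn cl rw bS ex sm); rewrite ?ex // ?fe.
  + by move=> h; rewrite h in nb.
  + by move=> _; rewrite ltnNge (leq_trans ai ab).
  + by move=> _ e; move: (leq_trans ai ab); rewrite e ltnn.
  + by move=> _ bb; case: (colins_raised i i.+1 cl) => /(_ bx) [_ [->|/andP[]]].
- move=> T i a p v T1 r [[sT dg] i0 hp hbp hv] [bx ax mx] od vv pi cl S b q u S2 r' rw bS ex sm ab.
  have [fb fe] := colins_frame i cl (ltnSn i).
  have [sT1 _] := colins_outcome cl.
  apply: (le_turn cl rw bS ex sm); rewrite ?ex // ?fe.
  + by move=> h; apply: (sh_in sT); lia.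
  + by move=> *; exact: leqnn.
  + by move=> _ ->.
  + by move=> _; rewrite bS -fe => bb; apply: ltnW; apply: (sh_in sT1); rewrite ?fb //; lia.
- move=> T i a p v T1 r [[sT dg] i0 hp hbp hv] [bx ax mx] od cl S b q u S2 r' rw bS ex sm ab.
  have [fb fe] := colins_frame i cl (ltnSn i).
  apply: (le_turn cl rw bS ex sm); rewrite ?ex // ?fe ?ent_same.
  + rewrite box_replace // ent_other; last by apply/eqP => -[]; lia.
    by move=> h; apply: (sh_in sT); lia.
  + by move=> _; rewrite ltnNge ab.
  + by move=> _ e; move: ab; rewrite e ltnn.
  + rewrite bS => _ bb; case: (colins_raised i i.+1 cl).
    rewrite box_replace // ent_other; last by apply/eqP => -[]; lia.
    case: (boolP (box T i i.+1)) => [b1 /(_ isT) [_ [->|/andP[h _]]] _|nb1 _ h].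
    * by apply: ltnW; apply: (sh_in sT); lia.
    * exact: h.
    * exact: h.
- move=> T i a p v T1 r [[sT dg] i0 hp hbp hv] [bx ax mx] od ea cl S b q u S2 r' rw bS ex sm ab.
  have [fb fe] := colins_frame i cl (ltnSn i).
  have [sT1 _] := colins_outcome cl.
  apply: (le_turn cl rw bS ex sm); rewrite ?ex // ?fe ?ea.
  + move=> h; have b1 : box T i i.+1 by apply: (sh_dn sT h).
    have h1 : ent T i i < ent T i i.+1 by apply: (sh_in sT); lia.
    have h2 : ent T i i.+1 < ent T i.+1 i.+1 by apply: (sh_in sT); lia.
    by apply: leq_ltn_trans h2; rewrite -ea.
  + move=> ob; rewrite ltnS => ba; have e : a = b by lia.
    by rewrite -e od in ob.
  + move=> _; rewrite bS => bb; rewrite -ea -fe; apply: (sh_in sT1); rewrite ?fb //; lia.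
Qed.

(** * Row and column reading words *)

Definition row_seg T i s := [seq ent T i j | j <- s & box T i j].
Definition col_seg T j s := [seq ent T i j | i <- s & box T i j].
Definition row_letters N T i := row_seg T i (iota 1 N).
Definition col_letters N T j := col_seg T j (rev (iota 1 N)).
Definition rows N T s := flatten [seq row_letters N T i | i <- s].
Definition cols N T s := flatten [seq col_letters N T j | j <- s].
(** The bound N only has to be large enough to cover the boxes of T. *)
Definition row_word N T := rows N T (rev (iota 1 N)).
Definition col_word N T := cols N T (iota 1 N).

Lemma all_row_seg (P : pred nat) T i s :
  (forall j, j \in s -> box T i j -> P (ent T i j)) -> all P (row_seg T i s).
Proof.
move=> h; rewrite all_map; apply/allP => j; rewrite mem_filter => /andP[b js].
exact: h.
Qed.

Lemma all_col_seg (P : pred nat) T j s :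
  (forall i, i \in s -> box T i j -> P (ent T i j)) -> all P (col_seg T j s).
Proof.
move=> h; rewrite all_map; apply/allP => i; rewrite mem_filter => /andP[b js].
exact: h.
Qed.

Lemma eq_row_seg T T' i s :
  (forall j, j \in s -> box T' i j = box T i j) ->
  (forall j, j \in s -> ent T' i j = ent T i j) -> row_seg T' i s = row_seg T i s.
Proof.
move=> h1 h2; rewrite /row_seg (eq_in_filter h1); apply/eq_in_map => j.
by rewrite mem_filter => /andP[_ /h2].
Qed.

Lemma eq_col_seg T T' j s :
  (forall i, i \in s -> box T' i j = box T i j) ->
  (forall i, i \in s -> ent T' i j = ent T i j) -> col_seg T' j s = col_seg T j s.
Proof.
move=> h1 h2; rewrite /col_seg (eq_in_filter h1); apply/eq_in_map => i.
by rewrite mem_filter => /andP[_ /h2].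
Qed.

Lemma iota_split x N : 0 < x <= N -> iota 1 N = iota 1 x.-1 ++ x :: iota x.+1 (N - x).
Proof.
move=> h; have -> : N = (x.-1 + (N - x).+1)%N by lia.
rewrite iotaD /=; do 2!f_equal; first lia.
by f_equal; lia.
Qed.

Lemma row_seg_cat T i s t : row_seg T i (s ++ t) = row_seg T i s ++ row_seg T i t.
Proof. by rewrite /row_seg filter_cat map_cat. Qed.
Lemma col_seg_cat T i s t : col_seg T i (s ++ t) = col_seg T i s ++ col_seg T i t.
Proof. by rewrite /col_seg filter_cat map_cat. Qed.

Lemma row_seg1 T i j s : row_seg T i (j :: s) = (if box T i j then [:: ent T i j] else [::]) ++ row_seg T i s.
Proof. by rewrite /row_seg /=; case: ifP. Qed.
Lemma col_seg1 T j i s : col_seg T j (i :: s) = (if box T i j then [:: ent T i j] else [::]) ++ col_seg T j s.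
Proof. by rewrite /col_seg /=; case: ifP. Qed.

Lemma row_letters_split N T i x : 0 < x <= N -> row_letters N T i =
  row_seg T i (iota 1 x.-1) ++ (if box T i x then [:: ent T i x] else [::]) ++
  row_seg T i (iota x.+1 (N - x)).
Proof. by move=> h; rewrite /row_letters (iota_split h) row_seg_cat row_seg1. Qed.

Lemma col_letters_split N T j x : 0 < x <= N -> col_letters N T j =
  col_seg T j (rev (iota x.+1 (N - x))) ++ (if box T x j then [:: ent T x j] else [::]) ++
  col_seg T j (rev (iota 1 x.-1)).
Proof.
move=> h; rewrite /col_letters (iota_split h) rev_cat rev_cons cat_rcons col_seg_cat.
by rewrite col_seg1.
Qed.

Lemma rows_cat N T s t : rows N T (s ++ t) = rows N T s ++ rows N T t.
Proof. by rewrite /rows map_cat flatten_cat. Qed.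
Lemma cols_cat N T s t : cols N T (s ++ t) = cols N T s ++ cols N T t.
Proof. by rewrite /cols map_cat flatten_cat. Qed.
Lemma rows1 N T i s : rows N T (i :: s) = row_letters N T i ++ rows N T s. Proof. by []. Qed.
Lemma cols1 N T i s : cols N T (i :: s) = col_letters N T i ++ cols N T s. Proof. by []. Qed.

Lemma eq_rows N T T' s :
  (forall i, i \in s -> row_letters N T' i = row_letters N T i) -> rows N T' s = rows N T s.
Proof. by move=> h; rewrite /rows; congr flatten; apply/eq_in_map. Qed.
Lemma eq_cols N T T' s :
  (forall i, i \in s -> col_letters N T' i = col_letters N T i) -> cols N T' s = cols N T s.
Proof. by move=> h; rewrite /cols; congr flatten; apply/eq_in_map. Qed.

Lemma all_rows (P : pred nat) N T s :
  (forall i j, i \in s -> box T i j -> P (ent T i j)) -> all P (rows N T s).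
Proof.
move=> h; rewrite /rows; elim: s h => //= i s IH h; rewrite all_cat IH ?andbT.
  by apply: all_row_seg => j _; apply: h; rewrite mem_head.
by move=> k j ks; apply: h; rewrite inE ks orbT.
Qed.
Lemma all_cols (P : pred nat) N T s :
  (forall i j, j \in s -> box T i j -> P (ent T i j)) -> all P (cols N T s).
Proof.
move=> h; rewrite /cols; elim: s h => //= j s IH h; rewrite all_cat IH ?andbT.
  by apply: all_col_seg => i _; apply: h; rewrite mem_head.
by move=> i k ks; apply: h; rewrite inE ks orbT.
Qed.

Definition rows_above N i := rev (iota i.+1 (N - i)).
Definition rows_below i := rev (iota 1 i.-1).
Definition cols_left j := iota 1 j.-1.
Definition cols_right N j := iota j.+1 (N - j).

Lemma mem_rows_above N i k : (k \in rows_above N i) = (i < k <= N).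
Proof. by rewrite mem_rev mem_iota; lia. Qed.
Lemma mem_rows_below i k : (k \in rows_below i) = (0 < k < i).
Proof. by rewrite mem_rev mem_iota; lia. Qed.
Lemma mem_cols_left j k : (k \in cols_left j) = (0 < k < j).
Proof. by rewrite mem_iota; lia. Qed.
Lemma mem_cols_right N j k : (k \in cols_right N j) = (j < k <= N).
Proof. by rewrite mem_iota; lia. Qed.

Lemma rows_aboveS N i : i < N -> rows_above N i = rcons (rows_above N i.+1) i.+1.
Proof. by move=> h; rewrite /rows_above -rev_cons; congr rev; have -> : (N - i = (N - i.+1).+1)%N by lia. Qed.
Lemma rows_belowS i : 0 < i -> rows_below i.+1 = i :: rows_below i.
Proof.
move=> h; rewrite /rows_below -rev_rcons; congr rev.
have -> : i.+1.-1 = (i.-1 + 1)%N by lia.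
by rewrite iotaD -cats1 /=; do 2!f_equal; lia.
Qed.
Lemma cols_leftS i : 0 < i -> cols_left i.+1 = rcons (cols_left i) i.
Proof.
move=> h; rewrite /cols_left; have -> : i.+1.-1 = (i.-1 + 1)%N by lia.
by rewrite iotaD -cats1 /=; do 2!f_equal; lia.
Qed.
Lemma cols_rightS N i : i < N -> cols_right N i = i.+1 :: cols_right N i.+1.
Proof. by move=> h; rewrite /cols_right; have -> : (N - i = (N - i.+1).+1)%N by lia. Qed.

Lemma row_word_split N T i : 0 < i <= N ->
  row_word N T = rows N T (rows_above N i) ++ row_letters N T i ++ rows N T (rows_below i).
Proof.
by move=> h; rewrite /row_word (iota_split h) rev_cat rev_cons cat_rcons rows_cat.
Qed.
Lemma col_word_split N T j : 0 < j <= N ->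
  col_word N T = cols N T (cols_left j) ++ col_letters N T j ++ cols N T (cols_right N j).
Proof. by move=> h; rewrite /col_word (iota_split h) cols_cat. Qed.

(** For two boxes that the row reading and the column reading order differently,
    one lies strictly above and to the right of the other. *)
Definition spread (T : tableau) := forall i j k l, box T i j -> box T k l -> i < k -> j < l ->
  (ent T i j).+1 < ent T k l.

Definition rboxes N (T : tableau) := [seq p <- [seq (i, j) | i <- rev (iota 1 N), j <- iota 1 N] | p \in domf T].
Definition cboxes N (T : tableau) := [seq p <- [seq (i, j) | j <- iota 1 N, i <- rev (iota 1 N)] | p \in domf T].

Lemma row_word_boxes N T : row_word N T = map (entry T) (rboxes N T).
Proof.
rewrite /row_word /rows /rboxes; elim: (rev _) => //= i s IH.
by rewrite filter_cat map_cat -IH /row_letters /row_seg filter_map -map_comp.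
Qed.
Lemma col_word_boxes N T : col_word N T = map (entry T) (cboxes N T).
Proof.
rewrite /col_word /cols /cboxes /col_letters; move: (rev _) => u; elim: (iota 1 N) => //= j s IH.
by rewrite filter_cat map_cat -IH /col_seg filter_map -map_comp.
Qed.

Lemma pairwise_allpairs (I J K : eqType) (ri : rel I) (r : rel K) (f : I -> J -> K) s t :
  (forall i, pairwise r [seq f i j | j <- t]) ->
  (forall i i' j j', ri i i' -> r (f i j) (f i' j')) ->
  pairwise ri s -> pairwise r [seq f i j | i <- s, j <- t].
Proof.
move=> h1 h2; elim: s => //= i s IH /andP[/allP is_ /IH ps].
rewrite pairwise_cat h1 ps andbT /=; apply/andP; split=> //.
apply/allrelP => x y /mapP[j jt ->] /allpairsP[[k j'] /= [ks jt' ->]].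
exact/h2/is_.
Qed.

Definition rrel : rel pos := fun p q => (q.1 < p.1) || ((p.1 == q.1) && (p.2 < q.2)).
Definition crel : rel pos := fun p q => (p.2 < q.2) || ((p.2 == q.2) && (q.1 < p.1)).

Lemma pairwise_iota m n : pairwise ltn (iota m n).
Proof. by rewrite -sorted_pairwise ?iota_ltn_sorted //; exact: ltn_trans. Qed.

Lemma pairwise_riota m n : pairwise gtn (rev (iota m n)).
Proof.
rewrite -sorted_pairwise; first by rewrite rev_sorted iota_ltn_sorted.
by move=> x y z h1 h2; apply: ltn_trans h2 h1.
Qed.

Lemma rboxes_pw N T : pairwise rrel (rboxes N T).
Proof.
apply: pairwise_filter; apply: (pairwise_allpairs (ri := gtn)); last exact: pairwise_riota.
  move=> i; rewrite pairwise_map; apply: sub_pairwise (pairwise_iota _ _) => x y xy.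
  by rewrite /rrel /= eqxx (xy : x < y) orbT.
by move=> i i' j j' h; rewrite /rrel /= (h : i' < i).
Qed.

Lemma cboxes_pw N T : pairwise crel (cboxes N T).
Proof.
apply: pairwise_filter.
apply: (@pairwise_allpairs _ _ _ ltn crel (fun j i => (i, j))); last exact: pairwise_iota.
  move=> i; rewrite pairwise_map; apply: sub_pairwise (pairwise_riota _ _) => x y xy.
  by rewrite /crel /= eqxx (xy : y < x) orbT.
by move=> i i' j j' h; rewrite /crel /= (h : i < i').
Qed.

Lemma row_word_col_word N T o : spread T -> (forall i j, box T i j -> 0 < ent T i j) ->
  act o (row_word N T) = act o (col_word N T).
Proof.
move=> sp pos; rewrite row_word_boxes col_word_boxes.
apply: (act_reorder (r1 := rrel) (r2 := crel)); first last.
- move=> [i j] [k l]; rewrite !mem_filter => /andP[p1 _] /andP[p2 _].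
  rewrite /rrel /crel /far /= => h1 h2.
  have h : k < i /\ l < j by lia.
  have := sp _ _ _ _ p2 p1 h.1 h.2; have := pos _ _ p1; have := pos _ _ p2.
  by rewrite /ent; lia.
- exact: cboxes_pw.
- exact: rboxes_pw.
apply: uniq_perm.
- by apply: (pairwise_uniq _ (rboxes_pw N T)) => -[i j]; rewrite /rrel /= !ltnn andbF.
- by apply: (pairwise_uniq _ (cboxes_pw N T)) => -[i j]; rewrite /crel /= !ltnn andbF.
move=> [i j]; rewrite !mem_filter; congr andb.
by apply/allpairsP/allpairsP => -[[a b] /= [h1 h2 [-> ->]]]; exists (b, a).
Qed.

(** The box in the corner between the two is in T and its entry lies strictly
    between theirs. *)
Lemma shtab_spread T : shtab T -> spread T.
Proof.
move=> sT i j k l b1 b2 ik jl.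
have := sh_bd sT b1; have := sh_bd sT b2 => h1 h2.
have b3 : box T i l by apply: (sh_dn sT b2); lia.
have e1 : ent T i j < ent T i l by apply: (sh_in sT); lia.
have e2 : ent T i l < ent T k l by apply: (sh_in sT); lia.
exact: leq_ltn_trans e1 e2.
Qed.

(** In the words of a state the value of the outer box is read at the end of its row,
    or at the beginning of its column. *)
Definition row_reading N T i a := rows N T (rows_above N i) ++ row_letters N T i ++ a :: rows N T (rows_below i).
Definition col_reading N T j a := cols N T (cols_left j) ++ a :: col_letters N T j ++ cols N T (cols_right N j).

Lemma row_reading_next N (T T' : tableau) i a b o : i < N -> 0 < i ->
  (forall k, k != i -> row_letters N T' k = row_letters N T k) ->
  (forall o, act o (row_letters N T i ++ a :: rows N T (rows_below i)) =
             act o (b :: row_letters N T' i ++ rows N T (rows_below i))) ->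
  act o (row_reading N T i a) = act o (row_reading N T' i.+1 b).
Proof.
move=> iN i0 hk h; rewrite /row_reading rows_belowS // rows_aboveS // -cats1 !rows_cat !rows1 cats0.
rewrite -catA [RHS]act_cat [LHS]act_cat (@eq_rows N T T' (rows_above N i.+1)); last first.
  by move=> k; rewrite mem_rows_above => hh; apply: hk; lia.
rewrite (@eq_rows N T T' (rows_below i)); last first.
  by move=> k; rewrite mem_rows_below => hh; apply: hk; lia.
by rewrite hk ?act_cat; [rewrite -act_cat -[in RHS]act_cat h act_cat|lia].
Qed.

Lemma col_reading_next N (T T' : tableau) j a b o : j < N -> 0 < j ->
  (forall k, k != j -> col_letters N T' k = col_letters N T k) ->
  (forall o, act o (cols N T (cols_left j) ++ a :: col_letters N T j) =
             act o (cols N T (cols_left j) ++ col_letters N T' j ++ [:: b])) ->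
  act o (col_reading N T j a) = act o (col_reading N T' j.+1 b).
Proof.
move=> jN j0 hk h; rewrite /col_reading cols_leftS // cols_rightS // -cats1 !cols_cat !cols1 cats0.
rewrite (@eq_cols N T T' (cols_left j)); last first.
  by move=> k; rewrite mem_cols_left => hh; apply: hk; lia.
rewrite (@eq_cols N T T' (cols_right N j.+1)); last first.
  by move=> k; rewrite mem_cols_right => hh; apply: hk; lia.
rewrite (hk j.+1); last by lia.
rewrite -cat_cons catA act_cat h -act_cat; congr act.
by rewrite -!catA.
Qed.

(** * Reading words along the transitions *)

Definition narrower N (T : tableau) := forall i j, box T i j -> j < N.

Definition row_before T i x := row_seg T i (iota 1 x.-1).
Definition row_after N T i x := row_seg T i (iota x.+1 (N - x)).
Definition col_below T j x := col_seg T j (rev (iota 1 x.-1)).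
Definition col_above N T j x := col_seg T j (rev (iota x.+1 (N - x))).

Lemma row_letters_at N T i x : 0 < x <= N -> box T i x ->
  row_letters N T i = row_before T i x ++ ent T i x :: row_after N T i x.
Proof. by move=> h b; rewrite (row_letters_split _ _ h) b. Qed.

Lemma col_letters_at N T j x : 0 < x <= N -> box T x j ->
  col_letters N T j = col_above N T j x ++ ent T x j :: col_below T j x.
Proof. by move=> h b; rewrite (col_letters_split _ _ h) b. Qed.

Lemma row_letters_set N T i x a : 0 < x <= N ->
  row_letters N T.[(i, x) <- a] i = row_before T i x ++ a :: row_after N T i x.
Proof.
move=> h; rewrite (@row_letters_at _ _ _ x) ?box_set ?eqxx // ent_same; congr (_ ++ _ :: _).
  apply: eq_row_seg => k; rewrite mem_iota => hk.
    by rewrite box_set eqxx (_ : (k == x) = false) //; lia.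
  by rewrite ent_set eqxx (_ : (k == x) = false) //; lia.
apply: eq_row_seg => k; rewrite mem_iota => hk.
  by rewrite box_set eqxx (_ : (k == x) = false) //; lia.
by rewrite ent_set eqxx (_ : (k == x) = false) //; lia.
Qed.

Lemma col_letters_set N T j x a : 0 < x <= N ->
  col_letters N T.[(x, j) <- a] j = col_above N T j x ++ a :: col_below T j x.
Proof.
move=> h; rewrite (@col_letters_at _ _ _ x) ?box_set ?eqxx // ent_same; congr (_ ++ _ :: _).
  apply: eq_col_seg => k; rewrite mem_rev mem_iota => hk.
    by rewrite box_set eqxx (_ : (k == x) = false) //; lia.
  by rewrite ent_set eqxx (_ : (k == x) = false) //; lia.
apply: eq_col_seg => k; rewrite mem_rev mem_iota => hk.
  by rewrite box_set eqxx (_ : (k == x) = false) //; lia.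
by rewrite ent_set eqxx (_ : (k == x) = false) //; lia.
Qed.

Lemma row_letters_other N T i x a k : k != i -> row_letters N T.[(i, x) <- a] k = row_letters N T k.
Proof.
by move=> ki; apply: eq_row_seg => l _; rewrite ?box_set ?ent_set (negbTE ki).
Qed.

Lemma col_letters_other N T j x a k : k != j -> col_letters N T.[(x, j) <- a] k = col_letters N T k.
Proof.
by move=> ki; apply: eq_col_seg => l _; rewrite ?box_set ?ent_set (negbTE ki) andbF.
Qed.

Lemma all_row_before (P : pred nat) T i x :
  (forall k, 0 < k < x -> box T i k -> P (ent T i k)) -> all P (row_before T i x).
Proof. by move=> h; apply: all_row_seg => k; rewrite mem_iota => hk; apply: h; lia. Qed.
Lemma all_row_after (P : pred nat) N T i x :
  (forall k, x < k -> box T i k -> P (ent T i k)) -> all P (row_after N T i x).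
Proof. by move=> h; apply: all_row_seg => k; rewrite mem_iota => hk; apply: h; lia. Qed.
Lemma all_col_below (P : pred nat) T j x :
  (forall k, 0 < k < x -> box T k j -> P (ent T k j)) -> all P (col_below T j x).
Proof. by move=> h; apply: all_col_seg => k; rewrite mem_rev mem_iota => hk; apply: h; lia. Qed.
Lemma all_col_above (P : pred nat) N T j x :
  (forall k, x < k -> box T k j -> P (ent T k j)) -> all P (col_above N T j x).
Proof. by move=> h; apply: all_col_seg => k; rewrite mem_rev mem_iota => hk; apply: h; lia. Qed.

Lemma row_beforeS T i x : 0 < x -> box T i x -> row_before T i x.+1 = row_before T i x ++ [:: ent T i x].
Proof.
move=> x0 b; rewrite /row_before; have -> : x.+1.-1 = (x.-1 + 1)%N by lia.
rewrite iotaD row_seg_cat; congr (_ ++ _); have -> : (1 + x.-1)%N = x by lia.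
by rewrite /= row_seg1 b.
Qed.
Lemma col_belowS T j x : 0 < x -> box T x j -> col_below T j x.+1 = ent T x j :: col_below T j x.
Proof.
move=> x0 b; rewrite /col_below; have -> : x.+1.-1 = (x.-1 + 1)%N by lia.
rewrite iotaD rev_cat col_seg_cat; have -> : (1 + x.-1)%N = x by lia.
by rewrite /= col_seg1 b.
Qed.

Lemma row_after0 N T i x : (forall k, x < k -> ~~ box T i k) -> row_after N T i x = [::].
Proof.
move=> h; rewrite /row_after /row_seg (_ : [seq _ <- _ | _] = [::]) //.
by rewrite -(@filter_pred0 _ (iota x.+1 (N - x))); apply: eq_in_filter => k;
  rewrite mem_iota => hk; apply: negbTE; apply: h; lia.
Qed.
Lemma row_before0 T i x : (forall k, k < x -> ~~ box T i k) -> row_before T i x = [::].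
Proof.
move=> h; rewrite /row_before /row_seg (_ : [seq _ <- _ | _] = [::]) //.
by rewrite -(@filter_pred0 _ (iota 1 x.-1)); apply: eq_in_filter => k;
  rewrite mem_iota => hk; apply: negbTE; apply: h; lia.
Qed.
Lemma col_above0 N T j x : (forall k, x < k -> ~~ box T k j) -> col_above N T j x = [::].
Proof.
move=> h; rewrite /col_above /col_seg (_ : [seq _ <- _ | _] = [::]) //.
by rewrite -(@filter_pred0 _ (rev (iota x.+1 (N - x)))); apply: eq_in_filter => k;
  rewrite mem_rev mem_iota => hk; apply: negbTE; apply: h; lia.
Qed.

Lemma gt_right T i x : shtab T -> box T i x -> forall k, x < k -> box T i k -> ent T i x < ent T i k.
Proof. by move=> sT b k xk bk; apply: (sh_in sT); lia. Qed.
Lemma gt_up T j x : shtab T -> box T x j -> forall k, x < k -> box T k j -> ent T x j < ent T k j.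
Proof. by move=> sT b k xk bk; apply: (sh_in sT); lia. Qed.

Lemma row_reading_R4 N T i a x o : shtab T -> narrower N T -> 0 < a -> leastr T i a x ->
  (forall k, k < x -> box T i k -> ent T i k < a) ->
  act o (row_reading N T i a) = act o (row_reading N T.[(i, x) <- a] i.+1 (ent T i x)).
Proof.
move=> sT bd a0 [bx ax mx] lt; have hb := sh_bd sT bx; have xN := bd _ _ bx.
apply: row_reading_next; [lia|lia|by move=> k; exact: row_letters_other|move=> o'].
have xN' : 0 < x <= N by lia.
rewrite (row_letters_at xN' bx) (row_letters_set _ _ _ xN').
have := @act_bump (row_before T i x) (ent T i x) (row_after N T i x) a o'.
rewrite !actE => -> //; first by rewrite a0.
  by apply: all_row_before => k hk bk; rewrite (sh_gt0 sT bk) lt //; lia.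
by apply: all_row_after => k hk bk; apply: gt_right.
Qed.

Lemma row_reading_R3h N T i a x o : shtab T -> narrower N T -> 0 < a -> leastr T i a x ->
  i < x -> ent T i x.-1 = a ->
  act o (row_reading N T i a) = act o (row_reading N T i.+1 (ent T i x)).
Proof.
move=> sT bd a0 [bx ax mx] ix ea; have hb := sh_bd sT bx; have xN := bd _ _ bx.
apply: row_reading_next; [lia|lia|by []|move=> o'].
have xN' : 0 < x <= N by lia.
have bx1 : box T i x.-1 by apply: (sh_dn sT bx); lia.
have := @row_beforeS T i x.-1 _ bx1; rewrite prednK; last lia.
rewrite ea (row_letters_at xN' bx) => ->; last lia.
have := @act_bump_eq (row_before T i x.-1) (ent T i x) (row_after N T i x) a o'.
rewrite !actE => -> //; first by rewrite a0.
  apply: all_row_before => k hk bk; rewrite (sh_gt0 sT bk) -ea.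
  by apply: (sh_in sT) => //; lia.
by apply: all_row_after => k hk bk; apply: gt_right.
Qed.

(** These letters of row i-1 commute with a, so that a second copy of a is absorbed
    by the first one. *)
Lemma row_before_gap T i x a : shtab T -> 1 < i -> i < x -> box T i x.-1 -> ent T i x.-1 < a ->
  all (fun y => 0 < y < a.-1) (row_before T i.-1 x).
Proof.
move=> sT i1 ix bx1 ea; apply: all_row_before => k hk bk.
have hb := sh_bd sT bk; rewrite (sh_gt0 sT bk).
have b1 : box T i.-1 x.-1 by apply: (sh_dn sT bx1); lia.
have e1 : ent T i.-1 x.-1 < ent T i x.-1 by apply: (sh_in sT) => //; lia.
have e2 : ent T i.-1 k <= ent T i.-1 x.-1.
  case: (ltngtP k x.-1) => [?|?|->]; [|lia|exact: leqnn].
  by apply: ltnW; apply: (sh_in sT) => //; lia.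
by clear -ea e1 e2; lia.
Qed.

(** Here a is kept out by the entry a below its position. *)
Lemma row_reading_R3v N T i a x o : shtab T -> narrower N T -> 0 < a -> leastr T i a x ->
  1 < i -> i < x -> box T i.-1 x -> ent T i.-1 x = a -> ent T i x.-1 < a ->
  act o (row_reading N T i a) = act o (row_reading N T i.+1 (ent T i x)).
Proof.
move=> sT bd a0 [bx ax mx] i1 ix bx' ea lt; have hb := sh_bd sT bx; have xN := bd _ _ bx.
apply: row_reading_next; [lia|lia|by []|move=> o'].
have xN' : 0 < x <= N by lia.
have bx1 : box T i x.-1 by apply: (sh_dn sT bx); lia.
have -> : rows_below i = i.-1 :: rows_below i.-1.
  by rewrite -rows_belowS ?prednK //; lia.
rewrite !rows1 (row_letters_at xN' bx) (row_letters_at xN' bx') ea.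
have := @act_bump_absorb (row_before T i x) (ent T i x) (row_after N T i x) a (row_before T i.-1 x) o'.
rewrite !actE => -> //; first by rewrite a0.
- apply: all_row_before => k hk bk; rewrite (sh_gt0 sT bk); apply: leq_ltn_trans lt.
  case: (ltngtP k x.-1) => [?|?|->]; [|lia|exact: leqnn].
  by apply: ltnW; apply: (sh_in sT) => //; lia.
- by apply: all_row_after => k hk bk; apply: gt_right.
- exact: row_before_gap.
Qed.

Lemma row_letters_end N T i j : shtab T -> 0 < i -> firstr T i j -> j <= N -> row_letters N T i = row_before T i j.
Proof.
move=> sT i0 [ij nj hj] jN; have jN' : 0 < j <= N by lia.
rewrite (row_letters_split _ _ jN') (negbTE nj) cat0s -/(row_after N T i j) row_after0 ?cats0 // => k jk.
by apply: contra nj => bk; apply: (sh_dn sT bk); lia.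
Qed.

Lemma row_reading_R1 N T i a j o : shtab T -> narrower N T -> 0 < i -> firstr T i j -> j <= N -> i <= N ->
  act o (row_reading N T i a) = act o (row_word N T.[(i, j) <- a]).
Proof.
move=> sT bd i0 fr jN iN; have [ij nj hj] := fr; have jN' : 0 < j <= N by lia.
rewrite (@row_word_split _ _ i) ?i0 // (row_letters_set _ _ _ jN') /row_reading (row_letters_end sT i0 fr jN).
rewrite row_after0.
  rewrite -catA; congr (act _ (_ ++ (_ ++ _ :: _))).
    by apply: esym; apply: eq_rows => k; rewrite mem_rows_above => hk; apply: row_letters_other; lia.
  by apply: esym; apply: eq_rows => k; rewrite mem_rows_below => hk; apply: row_letters_other; lia.
by move=> k jk; apply: contra nj => bk; apply: (sh_dn sT bk); lia.
Qed.

Lemma row_reading_R2h N T i a j o : shtab T -> narrower N T -> 0 < a -> 0 < i -> firstr T i j -> j <= N ->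
  i < j -> ent T i j.-1 = a ->
  act o (row_reading N T i a) = act o (row_word N T).
Proof.
move=> sT bd a0 i0 fr jN ij ea; have [_ nj hj] := fr; have jN' : 0 < j <= N by lia.
have bj : box T i j.-1 by apply: hj; lia.
rewrite (@row_word_split _ _ i) ?i0 //; last lia.
rewrite /row_reading (row_letters_end sT i0 fr jN); have := @row_beforeS T i j.-1 _ bj; rewrite prednK; last lia.
by rewrite ea => ->; [rewrite !actE step_idem | lia].
Qed.

Lemma row_reading_R2v N T i a j o : shtab T -> narrower N T -> 0 < a -> 1 < i -> firstr T i j -> j <= N ->
  i < j -> box T i.-1 j -> ent T i.-1 j = a -> ent T i j.-1 < a ->
  act o (row_reading N T i a) = act o (row_word N T).
Proof.
move=> sT bd a0 i1 fr jN ij bj' ea lt; have [_ nj hj] := fr; have jN' : 0 < j <= N by lia.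
have bj : box T i j.-1 by apply: hj; lia.
rewrite (@row_word_split _ _ i) /row_reading; last lia.
have -> : rows_below i = i.-1 :: rows_below i.-1.
  by rewrite -rows_belowS ?prednK //; lia.
rewrite !rows1 (row_letters_at jN' bj') ea.
have := @act_absorb a (row_before T i.-1 j) (act (act o (rows N T (rows_above N i))) (row_letters N T i)) a0 _.
by rewrite !actE => -> //; exact: row_before_gap.
Qed.

Lemma col_reading_C4 N T j a x o : shtab T -> narrower N T -> 0 < a -> leastc T j a x ->
  (forall k, k < x -> box T k j -> ent T k j < a) ->
  act o (col_reading N T j a) = act o (col_reading N T.[(x, j) <- a] j.+1 (ent T x j)).
Proof.
move=> sT bd a0 [bx ax mx] lt; have hb := sh_bd sT bx; have xN := bd _ _ bx.
apply: col_reading_next; [lia|lia|by move=> k; exact: col_letters_other|move=> o'].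
have xN' : 0 < x <= N by lia.
rewrite (col_letters_at xN' bx) (col_letters_set _ _ _ xN').
have := @act_bump_rev (col_below T j x) (ent T x j) (col_above N T j x) a (act o' (cols N T (cols_left j))).
rewrite !actE => -> //; first by rewrite a0.
  by apply: all_col_below => k hk bk; rewrite (sh_gt0 sT bk) lt //; lia.
by apply: all_col_above => k hk bk; apply: gt_up.
Qed.

Lemma col_reading_C3h N T j a x o : shtab T -> narrower N T -> 0 < a -> leastc T j a x ->
  1 < x -> ent T x.-1 j = a ->
  act o (col_reading N T j a) = act o (col_reading N T j.+1 (ent T x j)).
Proof.
move=> sT bd a0 [bx ax mx] x1 ea; have hb := sh_bd sT bx; have xN := bd _ _ bx.
apply: col_reading_next; [lia|lia|by []|move=> o'].
have xN' : 0 < x <= N by lia.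
have bx1 : box T x.-1 j by apply: (sh_dn sT bx); lia.
have := @col_belowS T j x.-1 _ bx1; rewrite prednK; last lia.
rewrite ea (col_letters_at xN' bx) => ->; last lia.
have := @act_bump_eq_rev (col_below T j x.-1) (ent T x j) (col_above N T j x) a (act o' (cols N T (cols_left j))).
rewrite !actE => -> //; first by rewrite a0.
  apply: all_col_below => k hk bk; rewrite (sh_gt0 sT bk) -ea.
  by apply: (sh_in sT) => //; lia.
by apply: all_col_above => k hk bk; apply: gt_up.
Qed.

Lemma col_below_gap T j x a : shtab T -> 1 < j -> 0 < x -> box T x j.-1 ->
  (1 < x -> box T x.-1 j /\ ent T x.-1 j < a) ->
  all (fun y => 0 < y < a.-1) (col_below T j.-1 x).
Proof.
move=> sT j1 x0 bp h; apply: all_col_below => k hk bk.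
have [b1 e0] : box T x.-1 j /\ ent T x.-1 j < a by apply: h; lia.
have hb := sh_bd sT bp; rewrite (sh_gt0 sT bk).
have b2 : box T x.-1 j.-1 by apply: (sh_dn sT bp); lia.
have e1 : ent T x.-1 j.-1 < ent T x.-1 j by apply: (sh_in sT) => //; lia.
have e2 : ent T k j.-1 <= ent T x.-1 j.-1.
  case: (ltngtP k x.-1) => [?|?|->]; [|lia|exact: leqnn].
  by apply: ltnW; apply: (sh_in sT) => //; lia.
by clear -e0 e1 e2; lia.
Qed.

Lemma col_reading_C3v N T j a x o : shtab T -> narrower N T -> 0 < a -> leastc T j a x ->
  1 < j -> box T x j.-1 -> ent T x j.-1 = a -> (forall k, k < x -> box T k j -> ent T k j < a) ->
  act o (col_reading N T j a) = act o (col_reading N T j.+1 (ent T x j)).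
Proof.
move=> sT bd a0 [bx ax mx] j1 bp ea lt; have hb := sh_bd sT bx; have xN := bd _ _ bx.
apply: col_reading_next; [lia|lia|by []|move=> o'].
have xN' : 0 < x <= N by lia.
have -> : cols_left j = rcons (cols_left j.-1) j.-1 by rewrite -cols_leftS ?prednK //; lia.
rewrite -cats1 cols_cat cols1 cats0 (col_letters_at xN' bx) (col_letters_at xN' bp) ea.
have := @act_absorb_rev a (col_below T j.-1 x) (act (act o' (cols N T (cols_left j.-1))) (col_above N T j.-1 x)) a0 _.
rewrite !actE => ->; last first.
  apply: col_below_gap => //; first lia.
  move=> x1; have b1 : box T x.-1 j by apply: (sh_dn sT bx); lia.
  by split => //; apply: lt => //; lia.
have hd : all (far (ent T x j)) (col_below T j x).
  by apply: all_col_below => k hk bk; have := lt k _ bk; have := sh_gt0 sT bk; rewrite /far; lia.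
by rewrite -(act_pass _ hd) step_idem //; lia.
Qed.

Lemma col_letters_end N T j i : shtab T -> firstc T i j -> i <= N -> i <= j.+1 -> col_letters N T j = col_below T j i.
Proof.
move=> sT [i0 nj hj] iN ij; have iN' : 0 < i <= N by lia.
rewrite (col_letters_split _ _ iN') (negbTE nj) -/(col_above N T j i) col_above0 // => k ik.
by apply: contra nj => bk; apply: (sh_dn sT bk); have := sh_bd sT bk; lia.
Qed.

Lemma col_reading_C1 N T j a i o : shtab T -> narrower N T -> firstc T i j -> i <= N -> i <= j -> j <= N ->
  act o (col_reading N T j a) = act o (col_word N T.[(i, j) <- a]).
Proof.
move=> sT bd fr iN ij jN; have [i0 nj hj] := fr; have iN' : 0 < i <= N by lia.
rewrite (@col_word_split _ _ j); last lia.
rewrite (col_letters_set _ _ _ iN') /col_reading (col_letters_end sT fr iN) ?leqW // col_above0.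
  congr (act _ (_ ++ (_ :: (_ ++ _)))).
    by apply: esym; apply: eq_cols => k; rewrite mem_cols_left => hk; apply: col_letters_other; lia.
  by apply: esym; apply: eq_cols => k; rewrite mem_cols_right => hk; apply: col_letters_other; lia.
by move=> k ik; apply: contra nj => bk; apply: (sh_dn sT bk); have := sh_bd sT bk; lia.
Qed.

Lemma col_reading_C2h N T j a i o : shtab T -> narrower N T -> 0 < a -> firstc T i j -> i <= N -> i <= j ->
  j <= N -> 1 < i -> ent T i.-1 j = a ->
  act o (col_reading N T j a) = act o (col_word N T).
Proof.
move=> sT bd a0 fr iN ij jN i1 ea; have [i0 nj hj] := fr; have iN' : 0 < i <= N by lia.
have bj : box T i.-1 j by apply: hj; lia.
rewrite (@col_word_split _ _ j); last lia.
rewrite /col_reading (col_letters_end sT fr iN) ?leqW //; have := @col_belowS T j i.-1 _ bj; rewrite prednK; last lia.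
by rewrite ea => ->; [rewrite !actE step_idem | lia].
Qed.

Lemma col_reading_C2v N T j a i o : shtab T -> narrower N T -> 0 < a -> firstc T i j -> i <= N -> i <= j ->
  j <= N -> 1 < j -> box T i j.-1 -> ent T i j.-1 = a -> (1 < i -> ent T i.-1 j < a) ->
  act o (col_reading N T j a) = act o (col_word N T).
Proof.
move=> sT bd a0 fr iN ij jN j1 bp ea lt; have [i0 nj hj] := fr; have iN' : 0 < i <= N by lia.
rewrite (@col_word_split _ _ j); last lia.
rewrite /col_reading; have -> : cols_left j = rcons (cols_left j.-1) j.-1 by rewrite -cols_leftS ?prednK //; lia.
rewrite -cats1 cols_cat cols1 cats0 (col_letters_at iN' bp) ea.
have := @act_absorb_rev a (col_below T j.-1 i) (act (act o (cols N T (cols_left j.-1))) (col_above N T j.-1 i)) a0 _.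
rewrite !actE => -> //; apply: col_below_gap => // i1.
by split; [apply: hj; lia | apply: lt].
Qed.

Lemma step_odd a : odd a -> step Theta_state a = None.
Proof. exact: (@act_odd a [::]). Qed.

Lemma dead_step a : step None a = None. Proof. by []. Qed.

Lemma row_letters_diag N T i : shtab T -> narrower N T -> box T i i ->
  row_letters N T i = ent T i i :: row_after N T i i.
Proof.
move=> sT bd b; have h := sh_bd sT b; have iN := bd _ _ b.
rewrite (@row_letters_at _ _ _ i) ?row_before0 //; last lia.
by move=> k ki; apply/negP => /(sh_bd sT); lia.
Qed.

Lemma col_letters_diag N T i : shtab T -> narrower N T -> box T i i ->
  col_letters N T i = ent T i i :: col_below T i i.
Proof.
move=> sT bd b; have h := sh_bd sT b; have iN := bd _ _ b.
rewrite (@col_letters_at _ _ _ i) ?col_above0 //; last lia.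
by move=> k ki; apply/negP => /(sh_bd sT); lia.
Qed.

Lemma row_letters_diag2 N T i : shtab T -> narrower N T -> box T i i.+1 ->
  row_letters N T i = [:: ent T i i] ++ ent T i i.+1 :: row_after N T i i.+1.
Proof.
move=> sT bd bx; have h := sh_bd sT bx; have iN := bd _ _ bx.
have i0 : 0 < i by lia.
have b : box T i i by apply: (sh_dn sT bx); lia.
have xN : 0 < i.+1 <= N by lia.
rewrite (row_letters_at xN bx) (row_beforeS i0 b) row_before0 // => k ki.
by apply/negP => /(sh_bd sT); lia.
Qed.

Lemma far_rows_above N T i : shtab T -> box T i i ->
  all (fun y => (ent T i i).+1 < y) (rows N T (rows_above N i)).
Proof.
move=> sT b; apply: all_rows => k l; rewrite mem_rows_above => hk bk.
by apply: (shtab_spread sT b bk); have := sh_bd sT bk; lia.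
Qed.

Lemma far_cols_left N T i : shtab T -> box T i i ->
  all (fun y => 0 < y < (ent T i i).-1) (cols N T (cols_left i)).
Proof.
move=> sT b; apply: all_cols => k l; rewrite mem_cols_left => hk bk.
have := sh_gt0 sT bk; have := sh_bd sT bk => h.
by have := shtab_spread sT bk b; lia.
Qed.

(** A diagonal entry is the first letter of its row and commutes with all letters
    of the rows above, so the reading word is equivalent to one that starts with
    it. *)
Lemma diag_even N T : shtab T -> narrower N T -> act Theta_state (row_word N T) <> None ->
  forall k, box T k k -> ~~ odd (ent T k k).
Proof.
move=> sT bd nz k b; apply/negP => od; apply: nz.
have h := sh_bd sT b; have kN := bd _ _ b; have e0 := sh_gt0 sT b.
rewrite (@row_word_split _ _ k); last lia.
rewrite (row_letters_diag sT bd b) !actE -act_pass.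
  by rewrite step_odd // !(act_None, dead_step).
by apply: sub_all_in (far_rows_above N sT b) _ => y; rewrite /far; lia.
Qed.

(** A letter that commutes with columns 1, ..., i can be moved from the front of the
    word to its place before column i+1. *)
Lemma col_reading_insert N T i c o : shtab T -> i < N -> 0 < i ->
  (forall k l, l <= i -> box T k l -> far c (ent T k l)) ->
  act o (c :: row_word N T) = act o (col_reading N T i.+1 c).
Proof.
move=> sT iN i0 hf; rewrite act_cons row_word_col_word; [|exact: shtab_spread|exact: (sh_gt0 sT)].
rewrite (@col_word_split _ _ i.+1) // !actE act_pass //.
by apply: all_cols => k l; rewrite mem_cols_left => hl; apply: hf; lia.
Qed.

Lemma even_lt a b : ~~ odd a -> ~~ odd b -> a < b -> a.+1 < b.
Proof. by move=> oa ob ab; case: (ltngtP a.+1 b) => // [|e]; [lia|rewrite -e /= oa in ob]. Qed.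

(** Both a and the diagonal entry are even, so they commute, and the diagonal entry
    can be moved to the front, and from there to column i+1. *)
Lemma row_reading_D3 N T i a o : shtab T -> narrower N T -> 0 < a -> leastr T i a i ->
  ~~ odd a -> ~~ odd (ent T i i) -> shtab T.[(i, i) <- a] ->
  act o (row_reading N T i a) = act o (col_reading N T.[(i, i) <- a] i.+1 (ent T i i)).
Proof.
move=> sT bd a0 [b ax mx] oa oe sT'; have h := sh_bd sT b; have iN := bd _ _ b.
have ae := even_lt oa oe ax.
have fab : far (ent T i i) a by rewrite /far; lia.
have b' : box T.[(i, i) <- a] i i by rewrite box_replace.
have bd' : narrower N T.[(i, i) <- a] by move=> k l; rewrite box_replace //; exact: bd.
have fA : all (far (ent T i i)) (rows N T (rows_above N i)).
  by apply: sub_all_in (far_rows_above N sT b) _ => y; rewrite /far; lia.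
have fS : all (far a) (row_after N T i i).
  by apply: all_row_after => k ik bk; have := gt_right sT b ik bk; rewrite /far; lia.
rewrite -col_reading_insert //; try lia.
  rewrite (@row_word_split _ _ i); last lia.
  rewrite (@eq_rows N T _ (rows_above N i)); last first.
    by move=> k; rewrite mem_rows_above => hk; apply: row_letters_other; lia.
  rewrite (@eq_rows N T _ (rows_below i)); last first.
    by move=> k; rewrite mem_rows_below => hk; apply: row_letters_other; lia.
  rewrite /row_reading (row_letters_set _ _ _ (_ : 0 < i <= N)); last lia.
  rewrite (row_letters_diag sT bd b) row_before0; last by move=> k ki; apply/negP => /(sh_bd sT); lia.
  by rewrite !actE -(act_pass _ fS) -(act_pass _ fA).
move=> k l li bk; have hk := sh_bd sT' bk; have k0 := sh_gt0 sT' bk.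
have : ent T.[(i, i) <- a] k l <= ent T.[(i, i) <- a] i i.
  case: (ltnP (k + l) (i + i)) => e; first by apply: ltnW; apply: (sh_in sT') => //; lia.
  by have [-> ->] : k = i /\ l = i by lia.
by rewrite ent_same /far; move: k0; clear -a0 ae; lia.
Qed.

Lemma rows_below_split i : 1 < i -> rows_below i = i.-1 :: rows_below i.-1.
Proof. by move=> h; rewrite -rows_belowS ?prednK //; lia. Qed.

(** The value a is absorbed in row i-1, and the diagonal entry is repeated after
    column i, where it is absorbed by itself. *)
Lemma row_reading_D2 N T i a o : shtab T -> narrower N T -> 0 < a -> leastr T i a i ->
  ~~ odd a -> (forall k, box T k k -> ~~ odd (ent T k k)) ->
  1 < i -> box T i.-1 i -> ent T i.-1 i = a ->
  act o (row_reading N T i a) = act o (col_reading N T i.+1 (ent T i i)).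
Proof.
move=> sT bd a0 [b ax mx] oa od i1 b1 ea; have h := sh_bd sT b; have iN := bd _ _ b.
have ae := even_lt oa (od _ b) ax; have e0 := sh_gt0 sT b.
have -> : act o (row_reading N T i a) = act o (row_word N T).
  rewrite (@row_word_split _ _ i) /row_reading; last lia.
  rewrite (rows_below_split i1) !rows1 (row_letters_at (_ : 0 < i <= N) b1) ?ea; last lia.
  have := @act_absorb a (row_before T i.-1 i) (act (act o (rows N T (rows_above N i))) (row_letters N T i)) a0 _.
  rewrite !actE => -> //; apply: all_row_before => k hk bk; rewrite (sh_gt0 sT bk).
  have hb := sh_bd sT bk; have ek : k = i.-1 by lia.
  subst k; have : ent T i.-1 i.-1 < ent T i.-1 i by apply: (sh_in sT); lia.
  by rewrite ea => /(even_lt (od _ bk) oa); clear; lia.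
rewrite row_word_col_word; [|exact: shtab_spread|exact: (sh_gt0 sT)].
rewrite (@col_word_split _ _ i) /col_reading; last lia.
have i0 : 0 < i by lia.
rewrite (cols_leftS i0) (cols_rightS iN) -cats1 cols_cat !cols1 cats0.
rewrite (col_letters_diag sT bd b).
have := @act_absorb_rev (ent T i i) (col_below T i i) (act o (cols N T (cols_left i))) e0 _.
rewrite !actE => -> //; apply: all_col_below => k hk bk; rewrite (sh_gt0 sT bk).
have : ent T k i <= ent T i.-1 i.
  case: (ltngtP k i.-1) => [?|?|->]; [|lia|exact: leqnn].
  by apply: ltnW; apply: (sh_in sT) => //; lia.
by rewrite ea; clear -ae; lia.
Qed.

Lemma no_rows_above N T i : shtab T -> ~~ box T i.+1 i.+1 -> rows N T (rows_above N i) = [::].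
Proof.
move=> sT nb; have : all pred0 (rows N T (rows_above N i)).
  apply: all_rows => k l; rewrite mem_rows_above => hk bk.
  by move/negP: nb; case; apply: (sh_dn sT bk); have := sh_bd sT bk; lia.
by case: (rows N T _).
Qed.

(** Row i is the last one.  The bumped entry e differs from the diagonal entry by at
    least 2, so the repeated e can be moved past it; after the turn it is read
    next to the top of column i+1, which is e as well. *)
Lemma row_reading_D1 N T i a o : shtab T -> narrower N T -> 0 < a -> leastr T i a i.+1 ->
  ~~ box T i.+1 i.+1 -> (ent T i i).+1 < ent T i i.+1 ->
  ent T i i = a \/ [/\ ent T i i < a, 1 < i, box T i.-1 i.+1 & ent T i.-1 i.+1 = a] ->
  act o (row_reading N T i a) = act o (col_reading N T i.+1 (ent T i i.+1)).
Proof.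
move=> sT bd a0 [bx ax mx] nb ed he; have h := sh_bd sT bx; have iN := bd _ _ bx.
have b : box T i i by apply: (sh_dn sT bx); lia.
have d0 := sh_gt0 sT b; have e0 := sh_gt0 sT bx.
have fed : far (ent T i i.+1) (ent T i i) by rewrite /far; lia.
have rwE := row_letters_diag2 sT bd bx.
have fS : all (fun y => ent T i i.+1 < y) (row_after N T i i.+1).
  by apply: all_row_after => k ik bk; apply: gt_right.
have -> : act o (row_reading N T i a) = act o (row_word N T).
  rewrite (@row_word_split _ _ i) /row_reading; last lia.
  rewrite (no_rows_above N sT nb) rwE.
  case: he => [ea|[lt i1 b1 ea]].
    have := @act_bump_eq [::] (ent T i i.+1) (row_after N T i i.+1) a o.
    rewrite -ea !actE => -> //; last by rewrite d0 (ltn_trans _ ed).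
    by rewrite (act_swap _ fed) step_idem // -ea (act_swap _ fed).
  rewrite (rows_below_split i1) !rows1 (row_letters_at (_ : 0 < i.+1 <= N) b1) ?ea; last lia.
  have := @act_bump_absorb [:: ent T i i] (ent T i i.+1) (row_after N T i i.+1) a (row_before T i.-1 i.+1) o.
  rewrite !actE => -> //; first by rewrite (act_swap _ fed) step_idem.
  - by rewrite a0.
  - by rewrite /= d0 lt.
  - exact: row_before_gap.
rewrite row_word_col_word; [|exact: shtab_spread|exact: (sh_gt0 sT)].
rewrite (@col_word_split _ _ i.+1) /col_reading; last lia.
rewrite (@col_letters_at _ _ _ i) ?col_above0 //; try lia.
  by rewrite !actE step_idem.
move=> k ik; apply: contra nb => bk; apply: (sh_dn sT bk); have := sh_bd sT bk; lia.
Qed.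

(** Otherwise row i starts with d (d+1) and receives d; the word is equivalent to
    one that starts with the odd letter d+1. *)
Lemma D1_gap N T i a : shtab T -> narrower N T -> leastr T i a i.+1 -> ~~ box T i.+1 i.+1 ->
  ~~ odd (ent T i i) -> ent T i i = a ->
  act Theta_state (row_reading N T i a) <> None -> (ent T i i).+1 < ent T i i.+1.
Proof.
move=> sT bd [bx ax mx] nb od ea nz; have h := sh_bd sT bx; have iN := bd _ _ bx.
have b : box T i i by apply: (sh_dn sT bx); lia.
have d0 := sh_gt0 sT b.
have lt : ent T i i < ent T i i.+1 by apply: (sh_in sT) => //; lia.
case: (ltngtP (ent T i i).+1 (ent T i i.+1)) => // [|e]; first by rewrite ltnS leqNgt lt.
case: nz; rewrite /row_reading (no_rows_above N sT nb) cat0s.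
have hh : act Theta_state (row_letters N T i ++ [:: a]) = None.
  rewrite (row_letters_diag2 sT bd bx) -ea.
  have := @act_bump_eq [::] (ent T i i.+1) (row_after N T i i.+1) (ent T i i) Theta_state.
  have oe : odd (ent T i i.+1) by rewrite -e /= od.
  rewrite !actE => -> //; first by rewrite step_odd // !(act_None, dead_step).
    by rewrite d0.
  by apply: all_row_after => k ik bk; apply: gt_right.
by rewrite -cat_rcons -cats1 act_cat hh act_None.
Qed.

(** Otherwise the odd letter a commutes with the diagonal entry and with everything
    else that is read before it. *)
Lemma D4_gap N T i a : shtab T -> narrower N T -> 0 < a -> leastr T i a i -> odd a ->
  act Theta_state (row_reading N T i a) <> None -> ent T i i <= a.+1.
Proof.
move=> sT bd a0 [b ax mx] oa nz; have h := sh_bd sT b; have iN := bd _ _ b.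
rewrite leqNgt; apply/negP => ab; apply: nz.
have fA : all (far a) (rows N T (rows_above N i)).
  by apply: sub_all_in (far_rows_above N sT b) _ => y; rewrite /far; lia.
have fS : all (far a) (row_after N T i i).
  by apply: all_row_after => k ik bk; have := gt_right sT b ik bk; rewrite /far; lia.
have fb : far (ent T i i) a by rewrite /far; lia.
rewrite /row_reading (row_letters_diag sT bd b) !actE -(act_pass _ fS) (act_swap _ fb) -(act_pass _ fA).
by rewrite step_odd // !(act_None, dead_step).
Qed.

(** With b = a+1 the diagonal entry, b and a can be moved to the front, where
    b (b-1) is replaced by b (b+1).  Then b and b+1 are moved back, through the
    tableau without its box (i, i), which is now read by columns. *)
Lemma row_reading_D4 N T i a : shtab T -> narrower N T -> leastr T i a i -> odd a ->
  ent T i i = a.+1 ->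
  act Theta_state (row_reading N T i a) = act Theta_state (col_reading N T i.+1 a.+2).
Proof.
move=> sT bd [b ax mx] oa ea; have h := sh_bd sT b; have iN := bd _ _ b.
have a0 : 0 < a by case: (a) oa.
have i0 : 0 < i by lia.
pose T0 : tableau := T.[~ (i, i)].
have bT0 k l : box T0 k l = ((k, l) != (i, i)) && box T k l.
  by rewrite /box mem_remf1.
have eT0 k l : (k, l) != (i, i) -> ent T0 k l = ent T k l.
  by move=> ne; rewrite /ent /entry fnd_rem1 ne.
have rE : row_word N T0 = rows N T (rows_above N i) ++ row_after N T i i ++ rows N T (rows_below i).
  rewrite (@row_word_split _ _ i); last lia.
  congr (_ ++ (_ ++ _)).
  - apply: eq_rows => k; rewrite mem_rows_above => hk; apply: eq_row_seg => l _.
      by rewrite bT0 xpair_eqE (_ : (k == i) = false) //; lia.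
    by apply: eT0; rewrite xpair_eqE (_ : (k == i) = false) //; lia.
  - rewrite (@row_letters_split _ _ _ i) ?bT0 ?eqxx /=; last lia.
    rewrite -/(row_before T0 i i) row_before0 /=.
      apply: eq_row_seg => k; rewrite mem_iota => hk; rewrite ?bT0 ?eT0 // xpair_eqE eqxx /= (_ : (k == i) = false) //; lia.
    by move=> k ki; rewrite bT0 negb_and orbC; apply/orP; left; apply/negP => /(sh_bd sT); lia.
  - apply: eq_rows => k; rewrite mem_rows_below => hk; apply: eq_row_seg => l _.
      by rewrite bT0 xpair_eqE (_ : (k == i) = false) //; lia.
    by apply: eT0; rewrite xpair_eqE (_ : (k == i) = false) //; lia.
have cE : col_word N T0 = cols N T (cols_left i) ++ col_below T i i ++ cols N T (cols_right N i).
  rewrite (@col_word_split _ _ i); last lia.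
  congr (_ ++ (_ ++ _)).
  - apply: eq_cols => k; rewrite mem_cols_left => hk; apply: eq_col_seg => l _.
      by rewrite bT0 xpair_eqE (_ : (k == i) = false) ?andbF //; lia.
    by apply: eT0; rewrite xpair_eqE (_ : (k == i) = false) ?andbF //; lia.
  - rewrite (@col_letters_split _ _ _ i) ?bT0 ?eqxx /=; last lia.
    rewrite -/(col_above N T0 i i) col_above0 /=.
      apply: eq_col_seg => k; rewrite mem_rev mem_iota => hk; rewrite ?bT0 ?eT0 // xpair_eqE eqxx andbT /= (_ : (k == i) = false) //; lia.
    by move=> k ki; rewrite bT0 negb_and orbC; apply/orP; left; apply/negP => /(sh_bd sT); lia.
  - apply: eq_cols => k; rewrite mem_cols_right => hk; apply: eq_col_seg => l _.
      by rewrite bT0 xpair_eqE (_ : (k == i) = false) ?andbF //; lia.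
    by apply: eT0; rewrite xpair_eqE (_ : (k == i) = false) ?andbF //; lia.
have rc o : act o (row_word N T0) = act o (col_word N T0).
  apply: row_word_col_word.
    move=> k l k' l'; rewrite !bT0 => /andP[n1 b1] /andP[n2 b2] kk ll.
    by rewrite !eT0 //; apply: (shtab_spread sT).
  by move=> k l; rewrite bT0 => /andP[n1 b1]; rewrite eT0 //; apply: (sh_gt0 sT).
have fbA : all (far a.+1) (rows N T (rows_above N i)).
  by apply: sub_all_in (far_rows_above N sT b) _ => y; rewrite ea /far; lia.
have fA : all (far a) (rows N T (rows_above N i)).
  by apply: sub_all_in (far_rows_above N sT b) _ => y; rewrite ea /far; lia.
have fS : all (far a) (row_after N T i i).
  by apply: all_row_after => k ik bk; have := gt_right sT b ik bk; rewrite ea /far; lia.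
have fL : all (far a.+1) (cols N T (cols_left i)).
  by apply: sub_all_in (far_cols_left N sT b) _ => y; rewrite ea /far; lia.
have fL2 : all (far a.+2) (cols N T (cols_left i)).
  by apply: sub_all_in (far_cols_left N sT b) _ => y; rewrite ea /far; lia.
have fD : all (far a.+2) (col_below T i i).
  apply: all_col_below => k hk bk; have := sh_gt0 sT bk.
  have : ent T k i < ent T i i by apply: (sh_in sT) => //; lia.
  by rewrite ea /far; clear; lia.
have E := @act_even a.+1 (row_word N T0) isT; rewrite /= oa in E.
have {}E := E isT.
rewrite /row_reading (row_letters_diag sT bd b) ea !actE -(act_pass _ fS) -(act_pass _ fbA) -(act_pass _ fA).
transitivity (act (step (step Theta_state a.+1) a.+2) (row_word N T0)).
  by rewrite -[RHS]E rE !actE.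
rewrite rc cE /col_reading (cols_leftS i0) (cols_rightS iN) -cats1 cols_cat !cols1 cats0 (col_letters_diag sT bd b) ea.
by rewrite !actE (act_pass _ fL2) (act_pass _ fD) -(act_pass _ fL).
Qed.

(** * Shifted shapes *)

Local Open Scope fset_scope.

Lemma incrP T : reflect (forall i j k l, box T i j -> box T k l -> i <= k -> j <= l ->
    i + j < k + l -> ent T i j < ent T k l) (increasing T).
Proof.
apply: (iffP allP) => h.
  move=> i j k l b1 b2 ik jl lt; move/allP: (h _ b1) => /(_ _ b2) /implyP; apply.
  by rewrite /= ik jl xpair_eqE; lia.
move=> [i j] b1; apply/allP => -[k l] b2; apply/implyP; rewrite xpair_eqE => hh.
by apply: (h i j k l) => //; move: hh => /=; lia.
Qed.

Lemma nth_strict lam i j : strict_partition lam -> i <= j -> j < size lam ->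
  j + nth 0 lam j <= i + nth 0 lam i.
Proof.
move=> hl; elim: j => [|j IH]; first by rewrite leqn0 => /eqP ->.
rewrite leq_eqVlt => /orP[/eqP -> //|ij] jl; apply: leq_trans (IH ij (ltnW jl)).
rewrite addSnnS leq_add2l; case/andP: hl => sl _.
have := sorted_ltn_nth (fun y x z (h1 : y < x) h2 => ltn_trans h2 h1 : z < x) 0 sl.
by apply; rewrite ?inE // ltnW.
Qed.

Lemma shifted_closed T : shifted T -> (forall i j, box T i j -> 0 < i <= j) /\
  (forall i j k l, box T i j -> 0 < k -> k <= i -> l <= j -> k <= l -> box T k l).
Proof.
case/asboolP => lam hl dT; split.
  by move=> i j; rewrite /box dT mem_shifted_shape => /and4P[-> _ ->].
move=> i j k l; rewrite /box dT !mem_shifted_shape => /and4P[i0 il ij jl] k0 ki lj kl.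
have h := @nth_strict lam k.-1 i.-1 hl _ _; have {}h := h ltac:(lia) ltac:(lia).
by apply/and4P; split; lia.
Qed.

(** The parts of the strict partition are the lengths of the initial runs of boxes
    in the rows; they decrease because shapes are closed downwards. *)
Lemma closed_shifted T : (forall i j, box T i j -> 0 < i <= j) ->
  (forall i j k l, box T i j -> 0 < k -> k <= i -> l <= j -> k <= l -> box T k l) ->
  shifted T.
Proof.
move=> bd dn.
pose len i := find (fun k => ~~ box T i (i + k)) (iota 0 (ncols T).+1).
have bc i j : box T i j -> j <= ncols T by move=> b; exact: (ncols_ge b).
have lenP i j : 0 < i -> box T i j = (i <= j < i + len i).
  move=> i0; have hs : has (fun k => ~~ box T i (i + k)) (iota 0 (ncols T).+1).
    apply/hasP; exists (ncols T); first by rewrite mem_iota /=; lia.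
    by apply/negP => /bc; lia.
  have sl : len i < (ncols T).+1 by rewrite -[X in _ < X](size_iota 0) -has_find.
  have nl : ~~ box T i (i + len i).
    by have := nth_find 0 hs; rewrite nth_iota // add0n.
  apply/idP/andP => [b|[ij jl]].
    have h := bd _ _ b; split; first lia.
    rewrite ltnNge; apply: contra nl => lj; apply: (dn _ _ _ _ b) => //; lia.
  have jl' : j - i < len i by lia.
  have := before_find 0 jl'; rewrite nth_iota; last lia.
  by rewrite add0n subnKC // => /negbFE.
have len_dec i : 0 < i -> 0 < len i.+1 -> len i.+1 < len i.
  move=> i0 l0; have b : box T i.+1 (i.+1 + (len i.+1).-1) by rewrite lenP //; lia.
  have : box T i (i.+1 + (len i.+1).-1) by apply: (dn _ _ _ _ b) => //; lia.
  by rewrite lenP //; lia.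
have len_pos i : 0 < i <= nrows T -> 0 < len i.
  move=> hi; have [p pT hp] : exists2 p, p \in domf T & i <= p.1.
    case: (boolP (has (fun p => i <= p.1) (domf T))) => [/hasP[p pT hp]|hn]; first by exists p.
    have : nrows T <= i.-1.
      rewrite /nrows; apply/bigmax_leqP_seq => p pT _.
      by move/hasPn: hn => /(_ _ pT) /=; lia.
    by lia.
  case: p pT hp => k l b /= hp; have h := bd _ _ b.
  have : box T i i by apply: (dn _ _ _ _ b); lia.
  by rewrite lenP //; lia.
pose lam := [seq len i | i <- iota 1 (nrows T)].
have nl i : i < nrows T -> nth 0 lam i = len i.+1.
  by move=> h; rewrite (nth_map 0) ?size_iota // nth_iota // add1n.
apply/asboolP; exists lam.
  apply/andP; split.
    apply/(sortedP 0) => i; rewrite size_map size_iota => h.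
    rewrite !nl //; last lia.
    by apply: len_dec => //; apply: len_pos; lia.
  apply/negP => /mapP[i]; rewrite mem_iota => hi e.
  by have := len_pos i; lia.
apply/fsetP => -[i j]; rewrite mem_shifted_shape size_map size_iota -/(box T i j).
apply/idP/and4P => [b|[i0 il ij jl]].
  have h := bd _ _ b; have il := nrows_ge b; rewrite /= in il.
  split; [lia|lia|lia|]; rewrite nl; last lia.
  by rewrite prednK; [move: b; rewrite lenP; lia | lia].
by rewrite nl in jl; [rewrite prednK // in jl; rewrite lenP //; lia | lia].
Qed.

Lemma shtabP T : (forall i j, box T i j -> 0 < ent T i j) ->
  (shtab T <-> increasing T && shifted T).
Proof.
move=> pos; split.
  by case=> h1 h2 h3 _; apply/andP; split; [apply/incrP | apply: closed_shifted].
by case/andP => /incrP h3 /shifted_closed [h1 h2].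
Qed.

Lemma shtab_replace T i x a : shtab T -> box T i x -> 0 < a < ent T i x ->
  (i < x -> ent T i x.-1 < a) -> (1 < i -> ent T i.-1 x < a) -> shtab T.[(i, x) <- a].
Proof.
move=> sT b ha hl hd; have hb := sh_bd sT b; split.
- by move=> k l; rewrite box_replace //; exact: sh_bd.
- by move=> k l k' l'; rewrite !box_replace //; exact: (sh_dn sT).
- move=> k l k' l'; rewrite !box_replace // !ent_set => b1 b2 h1 h2 h3.
  have lt := sh_in sT b1 b2 h1 h2 h3.
  case: (boolP ((k == i) && (l == x))) => e1; case: (boolP ((k' == i) && (l' == x))) => e2 //.
  + by lia.
  + by case/andP: e1 lt => /eqP -> /eqP ->; lia.
  case/andP: e2 => /eqP ? /eqP ?; subst k' l'; have hk := sh_bd sT b1.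
  case: (ltnP k i) => ki.
    have i1 : 1 < i by lia.
    apply: leq_ltn_trans (hd i1); have b3 : box T i.-1 x by apply: (sh_dn sT b); lia.
    case: (ltnP (k + l) (i.-1 + x)) => s; first by apply: ltnW; apply: (sh_in sT) => //; lia.
    by have [-> ->] : k = i.-1 /\ l = x by lia.
  have ix : i < x by lia.
  apply: leq_ltn_trans (hl ix); have b3 : box T i x.-1 by apply: (sh_dn sT b); lia.
  case: (ltnP (k + l) (i + x.-1)) => s; first by apply: ltnW; apply: (sh_in sT) => //; lia.
  by have [-> ->] : k = i /\ l = x.-1 by lia.
- move=> k l; rewrite box_replace // ent_set => bk; case: ifP => _; [lia | exact: sh_gt0 bk].
Qed.

Lemma shtab_new T i j a : shtab T -> ~~ box T i j -> 0 < i <= j -> 0 < a ->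
  (i < j -> box T i j.-1 /\ ent T i j.-1 < a) ->
  (1 < i -> box T i.-1 j /\ ent T i.-1 j < a) -> shtab T.[(i, j) <- a].
Proof.
move=> sT nb ij a0 hl hd.
have big k l : box T k l -> i <= k -> j <= l -> False.
  by move=> b ik jl; move/negP: nb; apply; apply: (sh_dn sT b); lia.
have small k l : box T k l -> k <= i -> l <= j -> ent T k l < a.
  move=> b ki lj; have hk := sh_bd sT b.
  case: (ltnP k i) => ki'.
    have i1 : 1 < i by lia.
    have [b3 lt] := hd i1; apply: leq_ltn_trans lt.
    case: (ltnP (k + l) (i.-1 + j)) => s; first by apply: ltnW; apply: (sh_in sT) => //; lia.
    by have [-> ->] : k = i.-1 /\ l = j by lia.
  have lj' : l < j by rewrite ltnNge; apply/negP => jl; exact: (big k l b ki' jl).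
  have ij' : i < j by lia.
  have [b3 lt] := hl ij'; apply: leq_ltn_trans lt.
  case: (ltnP (k + l) (i + j.-1)) => s; first by apply: ltnW; apply: (sh_in sT) => //; lia.
  by have [-> ->] : k = i /\ l = j.-1 by lia.
split.
- move=> k l; rewrite box_set => /orP[/andP[/eqP -> /eqP ->] //|]; exact: sh_bd.
- move=> k l k' l'; rewrite !box_set => /orP[/andP[/eqP -> /eqP ->]|b] k0 ki lj kl.
    case: (boolP ((k' == i) && (l' == j))) => //= ne.
    case: (ltnP k' i) => ki'.
      have i1 : 1 < i by lia.
      by apply: (sh_dn sT (hd i1).1); lia.
    have ij' : i < j by lia.
    by apply: (sh_dn sT (hl ij').1); lia.
  by rewrite (sh_dn sT b) // orbT.
- move=> k l k' l'; rewrite !box_set !ent_set.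
  case: (boolP ((k == i) && (l == j))) => [/andP[/eqP -> /eqP ->]|e1];
  case: (boolP ((k' == i) && (l' == j))) => [/andP[/eqP -> /eqP ->]|e2] /=.
  + by move=> *; lia.
  + by move=> _ b h1 h2; case: (big _ _ b h1 h2).
  + by move=> b _ h1 h2 _; exact: small.
  + exact: (sh_in sT).
- by move=> k l; rewrite box_set ent_set; case: ifP => //= _; exact: sh_gt0.
Qed.

(** * Transitions of states *)

Lemma box_ncols T i j : box T i j -> j <= ncols T.
Proof. exact: ncols_ge. Qed.
Lemma box_nrows T i j : box T i j -> i <= nrows T.
Proof. exact: nrows_ge. Qed.
Lemma nrows_ncols T : shtab T -> nrows T <= ncols T.
Proof. by move=> sT; apply: upper_nrows => -[i j]; exact: (sh_bd sT). Qed.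

(** If the entry below the position of a is at least a, it is the box that a comes
    from: the path moves weakly to the left, and the entries of row i-1 to the left
    of that box are smaller than a. *)
Lemma row_state_vert T i a p v x : row_state T i a p v -> 1 < i -> box T i.-1 x -> i <= x ->
  (forall k, i <= k < x -> box T i k) ->
  (forall k, k < x -> box T i k -> ent T i k <= a) -> a <= ent T i.-1 x ->
  [/\ v, x = p & ent T i.-1 x = a].
Proof.
move=> [[sT _] i0 hp hb _] i1 bx ix hk mx le; have [bp ip hv] := hp i1.
case: (ltngtP x p) => [xp|px|xp].
- have : ent T i.-1 x < ent T i.-1 p by apply: (sh_in sT) => //; lia.
  by case: v hv {hp hb} => hv; lia.
- have b : box T i p by apply: hk; lia.
  by have := mx _ px b; have := hb b; lia.
by subst x; case: v hv {hp hb} => hv; [split | lia].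
Qed.

Lemma col_state_vert T j a p v x : col_state T j a p v -> box T x j.-1 ->
  (forall k, 0 < k < x -> box T k j) ->
  (forall k, k < x -> box T k j -> ent T k j <= a) -> a <= ent T x j.-1 ->
  [/\ v, x = p & ent T x j.-1 = a].
Proof.
move=> [sT j1 bp hv hb] bx hk mx le.
have h1 := sh_bd sT bp; have h2 := sh_bd sT bx.
case: (ltngtP x p) => [xp|px|xp].
- have : ent T x j.-1 < ent T p j.-1 by apply: (sh_in sT) => //; lia.
  by case: v hv {hb}; [case|]; lia.
- have b : box T p j by apply: hk; lia.
  by have [_ h3] := hb b; have := mx _ px b; have := h3 ltac:(lia); lia.
by subst x; case: v hv {hb}; [case; split | lia].
Qed.

Lemma firstrP T i : exists j, firstr T i j.
Proof.
have ex : exists j, (i <= j) && ~~ box T i j.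
  exists (maxn i (ncols T).+1); rewrite leq_maxl /=.
  by apply/negP => /box_ncols; lia.
case: (ex_minnP ex) => j /andP[ij nj] mn; exists j; split => // k /andP[ik kj].
by apply: contraTT kj => nb; rewrite -leqNgt; apply: mn; rewrite ik.
Qed.

Lemma firstcP T j : exists i, firstc T i j.
Proof.
have ex : exists i, (0 < i) && ~~ box T i j.
  exists (nrows T).+1 => /=.
  by apply/negP => /box_nrows; lia.
case: (ex_minnP ex) => i /andP[i0 ni] mn; exists i; split => // k /andP[k0 ki].
by apply: contraTT ki => nb; rewrite -leqNgt; apply: mn; rewrite k0.
Qed.

Lemma leastrP T i a k : box T i k -> a < ent T i k -> exists x, leastr T i a x.
Proof.
move=> bk ak; have ex : exists x, box T i x && (a < ent T i x) by exists k; rewrite bk.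
case: (ex_minnP ex) => x /andP[bx ax] mn; exists x; split => // l lx bl.
by rewrite leqNgt; apply/negP => al; have := mn l; rewrite bl al => /(_ isT); lia.
Qed.

Lemma leastcP T j a k : box T k j -> a < ent T k j -> exists x, leastc T j a x.
Proof.
move=> bk ak; have ex : exists x, box T x j && (a < ent T x j) by exists k; rewrite bk.
case: (ex_minnP ex) => x /andP[bx ax] mn; exists x; split => // l lx bl.
by rewrite leqNgt; apply/negP => al; have := mn l; rewrite bl al => /(_ isT); lia.
Qed.

Lemma shtab_of_incr T i x a : shtab T -> box T i x -> 0 < a ->
  increasing T.[(i, x) <- a] -> shtab T.[(i, x) <- a].
Proof.
move=> sT b a0 /incrP h; split => //.
- by move=> k l; rewrite box_replace //; exact: sh_bd.
- by move=> k l k' l'; rewrite !box_replace //; exact: (sh_dn sT).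
- by move=> k l; rewrite box_replace // ent_set => bk; case: ifP => // _; exact: sh_gt0 bk.
Qed.

(** One transition from a state in a row: the path ends, goes up, or turns.  In each
    case the action of the reading word is preserved, and a path from the target
    extends to a path from the source. *)
Inductive row_next N T i a p v (t : transition) : Prop :=
| RStop T1 of tr_target t = terminal_state T1 &
    rowins T i a p v T1 (tr_type t, tr_label t) &
    act Theta_state (row_reading N T i a) = act Theta_state (row_word N T1)
| RUp T' b x v' of tr_target t = add_outer T' (i.+1, (ncols T).+2) b &
    domf T' = domf T & row_state T' i.+1 b x v' & 0 < b &
    act Theta_state (row_reading N T i a) = act Theta_state (row_reading N T' i.+1 b) &
    (forall T1 r, rowins T' i.+1 b x v' T1 r -> rowins T i a p v T1 r)
| RTurn T' c v' of tr_target t = add_outer T' ((nrows T).+2, i.+1) c &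
    domf T' = domf T & col_state T' i.+1 c i v' & 0 < c &
    act Theta_state (row_reading N T i a) = act Theta_state (col_reading N T' i.+1 c) &
    (forall T1 r, colins T' i.+1 c i v' T1 r -> rowins T i a p v T1 r).

(** The nonvanishing of the reading word enters in D1 and D4 only. *)
Lemma row_forward N T i a p v : row_state T i a p v -> 0 < a -> i <= (nrows T).+1 ->
  ncols T < N -> act Theta_state (row_reading N T i a) <> None ->
  exists t, forward (add_outer T (i, (ncols T).+2) a) = Some t /\ row_next N T i a p v t.
Proof.
move=> inv a0 im nN nz; have [[sT dg] i0 _ _ _] := inv.
have bd : narrower N T by move=> k l /box_ncols; lia.
have mn := nrows_ncols sT.
have iN : i <= N by clear -im mn nN; lia.
set n := (ncols T).+2.
have pT : (i, n) \notin domf T by apply/negP => /box_ncols; rewrite /n; lia.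
have bU k l : box T.[(i, n) <- a] k l = ((k == i) && (l == n)) || box T k l by exact: box_set.
have eU k l : l < n -> ent T.[(i, n) <- a] k l = ent T k l.
  by move=> ln; rewrite ent_set (ltn_eqF ln) andbF.
have entn : entry T.[(i, n) <- a] (i, n) = a by rewrite /entry fnd_set eqxx.
have bn k l : box T k l -> l < n by move/box_ncols; rewrite /n; lia.
rewrite /forward /add_outer /= rm_outer // eqxx; eexists; split; first by [].
rewrite /row_transition rm_outer // entn.
case: ifP => [/allP hmx|/negbT/allPn[[k l] qU]].
  have mx : rowmax T i a.
    move=> k bk; have := hmx (i, k); rewrite -/(box _ _ _) bU bk orbT => /(_ isT) /=.
    by rewrite eqxx -/(ent _ _ _) eU // (bn _ _ bk).
  have [j fr] := firstrP T i; have [ij nj hj] := fr.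
  have jn : j <= (ncols T).+1.
    case: (ltnP i j) => h; last by lia.
    have /box_ncols : box T i j.-1 by apply: hj; lia.
    by lia.
  have jN := leq_trans jn nN.
  have -> : least (fun j0 => (i, j0) \notin domf T.[(i, n) <- a]) i n = j.
    apply: least_eq => [|| k /andP[ik kj]]; first by rewrite /n; lia.
      by rewrite -/(box _ _ _) bU (_ : (j == n) = false) ?andbF // /n; lia.
    by rewrite negbK -/(box _ _ _) bU hj ?orbT // ik.
  have pos k l : box T.[(i, j) <- a] k l -> 0 < ent T.[(i, j) <- a] k l.
    by rewrite box_set ent_set; case: ifP => //= _ ; exact: sh_gt0.
  case: ifP => [/(shtabP pos) sV|nV].
    apply: (@RStop _ _ _ _ _ _ _ T.[(i, j) <- a]) => //=; first exact: RowR1.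
    by apply: row_reading_R1.
  case: (boolP ((i < j) && (ent T i j.-1 == a))) => [/andP[lt /eqP e]|nh].
    apply: (@RStop _ _ _ _ _ _ _ T) => //=; first by apply: RowR2 => //; left.
    exact: (row_reading_R2h _ sT bd a0 i0 fr jN lt e).
  have hl : i < j -> box T i j.-1 /\ ent T i j.-1 < a.
    move=> lt; have b : box T i j.-1 by apply: hj; lia.
    split=> //; move: nh (mx _ b); rewrite lt /= leq_eqVlt.
    by move=> /negbTE ->.
  have [_ _ hp hb hv] := inv.
  (* The path moves weakly to the left: if j > p, then (i, p) would be in T, with
     an entry larger than a. *)
  have bv : 1 < i -> box T i.-1 j.
    move=> i1; have [bp ip _] := hp i1.
    case: (leqP j p) => jp; first by apply: (sh_dn sT bp); clear -ij jp i1; lia.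
    by have bp' : box T i p; [apply: hj; rewrite ip | have := hb bp'; rewrite ltnNge (mx _ bp')].
  have [i1 le] : 1 < i /\ a <= ent T i.-1 j.
    case: (leqP i 1) => i1; last first.
      case: (leqP a (ent T i.-1 j)) => // lt; move/negP: nV; case; apply/(shtabP pos).
      by apply: shtab_new => //; [rewrite i0 | move=> _; split=> //; exact: bv].
    move/negP: nV; case; apply/(shtabP pos); apply: shtab_new => //; first by rewrite i0.
    by rewrite ltnNge i1.
  have [vv jp e] := row_state_vert inv i1 (bv i1) ij hj (fun k _ => mx k) le.
  have lt : i < j.
    rewrite ltn_neqAle ij andbT; apply/eqP => ej; move/negP: nj; rewrite -ej; apply.
    by have [_ h] := hv vv; apply: h; rewrite ej.
  apply: (@RStop _ _ _ _ _ _ _ T) => //=; first by apply: RowR2 => //; right.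
  by have [bj ej] := hl lt; exact: (row_reading_R2v _ sT bd a0 i1 fr jN lt (bv i1) e ej).
rewrite negb_imply -ltnNge /= => /andP[/eqP ek al]; subst k.
have ln : l < n.
  move: qU; rewrite -/(box _ _ _) bU => /orP[/andP[_ /eqP e]|]; last exact: bn.
  by move: al; rewrite e entn ltnn.
have bl : box T i l by move: qU; rewrite -/(box _ _ _) bU (ltn_eqF ln) andbF.
have {}al : a < ent T i l by rewrite -(eU _ _ ln).
have [x lx] := leastrP bl al; have [bx ax mx] := lx.
have xn := bn _ _ bx; have hx := sh_bd sT bx.
have -> : least (fun x0 => ((i, x0) \in domf T.[(i, n) <- a]) &&
    (a < entry T.[(i, n) <- a] (i, x0))) 1 n = x.
  apply: least_eq => [||k /andP[k1 kx]]; first lia.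
    by rewrite -/(box _ _ _) bU bx orbT -/(ent _ _ _) eU.
  rewrite -/(box _ _ _) bU -/(ent _ _ _) eU ?(ltn_trans kx) //.
  rewrite (ltn_eqF (ltn_trans kx xn)) andbF /=; apply/negP => /andP[bk ak].
  by have := mx _ kx bk; lia.
rewrite -/(ent _ i x) eU //.
have dom' : domf T.[(i, x) <- a] = domf T by exact: domf_upd.
(* Only the neighbours on the left and below can keep a out, since the entry in
   (i, x) decreases; the one below does so only if a comes from there. *)
have nincr : increasing T.[(i, x) <- a] = false ->
    (i < x /\ ent T i x.-1 = a) \/
    ((i < x -> ent T i x.-1 < a) /\ [/\ 1 < i, box T i.-1 x, v, x = p & ent T i.-1 x = a]).
  move=> ni; case: (boolP ((i < x) && (ent T i x.-1 == a))) => [/andP[lt /eqP e]|nh].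
    by left.
  have hl : i < x -> ent T i x.-1 < a.
    move=> lt; have b : box T i x.-1 by apply: (sh_dn sT bx); lia.
    have xx : x.-1 < x by lia.
    move: nh (mx _ xx b); rewrite lt /= leq_eqVlt.
    by move=> /negbTE ->.
  right; split=> //.
  case: (leqP i 1) => i1.
    have sV : shtab T.[(i, x) <- a] by apply: shtab_replace => //; [rewrite a0 | lia].
    by case: sV => _ _ /incrP; rewrite ni.
  case: (leqP a (ent T i.-1 x)) => le; last first.
    have sV : shtab T.[(i, x) <- a] by apply: shtab_replace => //; rewrite a0.
    by case: sV => _ _ /incrP; rewrite ni.
  have b : box T i.-1 x by apply: (sh_dn sT bx); lia.
  have hk k : i <= k < x -> box T i k by move=> hk; apply: (sh_dn sT bx); lia.
  have ix : i <= x by lia.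
  by have [vv xp e] := row_state_vert inv i1 b ix hk mx le.
have e0 := sh_gt0 sT bx.
case: (ltnP i x) => ix.
  case: ifP => [/(shtab_of_incr sT bx a0) sV|/nincr hv'].
    have lt k : k < x -> box T i k -> ent T i k < a.
      move=> kx bk; have := sh_in sV (i := i) (j := k) (k := i) (l := x).
      rewrite !box_replace // ent_same ent_other; last by apply/eqP => -[]; lia.
      by apply => //; lia.
    apply: (@RUp _ _ _ _ _ _ _ T.[(i, x) <- a] (ent T i x) x false) => //=; last 2 first.
    - by apply: row_reading_R4.
    - by move=> T1 r; exact: RowR4.
    split => //=.
    - split => // k; rewrite box_replace // ent_other; first exact: dg.
      by apply/eqP => -[]; lia.
    - by rewrite box_replace // ent_same.
    - rewrite box_replace // ent_other; last by apply/eqP => -[]; lia.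
      by move=> b; apply: (sh_in sT) => //; lia.
  have hv2 : ent T i x.-1 = a \/ (v /\ x = p) by case: hv' => [[]|[_ [*]]]; [left|right].
  have eW : act Theta_state (row_reading N T i a) = act Theta_state (row_reading N T i.+1 (ent T i x)).
    case: hv' => [[_ e]|[e [i1 b vv xp e']]]; first exact: row_reading_R3h.
    by apply: row_reading_R3v => //; exact: e.
  have inc' : box T i.+1 x -> ent T i x < ent T i.+1 x.
    by move=> b; apply: (sh_in sT) => //; lia.
  case: ifP => [hh|/negbT].
    apply: (@RUp _ _ _ _ _ _ _ T (ent T i x) x true) => //=; last first.
      by move=> T1 r; exact: RowR3.
    split => //= _; split => // ex; subst x.
    case/orP: hh; first by rewrite ltnn.
    case/hasP => -[k' l'] hb /eqP /= ek.
    have {hb} b : box T i.+1 l'.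
      by have := hb : is_true (box T.[(i, n) <- a] k' l'); rewrite bU ek (gtn_eqF (ltnSn i)).
    by apply: (sh_dn sT b) => //; case/andP: (sh_bd sT b).
  rewrite negb_or -leqNgt => /andP[x1 nh]; have {x1} ex : x = i.+1 by lia.
  subst x; have nb : ~~ box T i.+1 i.+1.
    apply: contra nh => b; apply/hasP; exists (i.+1, i.+1) => //=.
    by have : is_true (box T.[(i, n) <- a] i.+1 i.+1); rewrite // bU b orbT.
  have b : box T i i by apply: (sh_dn sT bx).
  have gap : (ent T i i).+1 < ent T i i.+1.
    case: hv' => [[_ e]|[e _]]; first exact: (D1_gap sT bd lx nb (dg _ b) e nz).
    by apply: leq_ltn_trans (e ix) ax.
  apply: (@RTurn _ _ _ _ _ _ _ T (ent T i i.+1) false) => //=.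
  - by split => //=; [exact: ltnW | move=> _; split=> //; rewrite ltnn].
  - apply: (row_reading_D1 _ sT bd a0 lx nb gap); case: hv' => [[]|[e [i1 b1 vv xp e']]]; first by left.
    by right; split=> //; exact: e.
  - move=> T1 r; apply: RowD1 => //; case: hv2 => [e|[vv e]]; [by left | by right].
have {ix} ex : x = i by lia.
subst x; have oe := dg _ bx.
case: ifP => [/eqP oo|/eqP oo].
  have oa : ~~ odd a by rewrite oo.
  case: ifP => [/(shtab_of_incr sT bx a0) sV|/nincr hv'].
    apply: (@RTurn _ _ _ _ _ _ _ T.[(i, i) <- a] (ent T i i) false) => //=.
    - clear nincr; split => //=; rewrite ?box_replace ?ent_same //.
      rewrite ent_other; last by apply/eqP => -[]; lia.
      move=> b; split; last by rewrite ltnn.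
      by apply: ltnW; apply: (sh_in sT) => //; lia.
    - exact: row_reading_D3.
    - by move=> T1 r; exact: RowD3.
  case: hv' => [[]|[_ [i1 b1 vv xp e']]]; first by rewrite ltnn.
  apply: (@RTurn _ _ _ _ _ _ _ T (ent T i i) true) => //=.
  - clear nincr; split => //= b; split; last by rewrite ltnn.
    by apply: ltnW; apply: (sh_in sT) => //; lia.
  - exact: row_reading_D2.
  - by move=> T1 r; exact: RowD2.
have oa : odd a by move: oo; case: (odd a) => //; rewrite (negbTE oe).
have gap := D4_gap sT bd a0 lx oa nz.
have ee : ent T i i = a.+1 by lia.
apply: (@RTurn _ _ _ _ _ _ _ T a.+2 false) => //=.
- by rewrite ee.
- split => //=; try by rewrite ee.
  move=> b; split; last by rewrite ltnn.
  by rewrite -ee; apply: (sh_in sT) => //; lia.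
- exact: row_reading_D4.
- by move=> T1 r; exact: RowD4.
Qed.

Inductive col_next N T j a p v (t : transition) : Prop :=
| CStop T1 of tr_target t = terminal_state T1 &
    colins T j a p v T1 (tr_type t, tr_label t) &
    act Theta_state (col_reading N T j a) = act Theta_state (row_word N T1)
| CNext T' b x v' of tr_target t = add_outer T' ((nrows T).+2, j.+1) b &
    domf T' = domf T & col_state T' j.+1 b x v' & 0 < b &
    act Theta_state (col_reading N T j a) = act Theta_state (col_reading N T' j.+1 b) &
    (forall T1 r, colins T' j.+1 b x v' T1 r -> colins T j a p v T1 r).

Lemma ent_col_le T j y x : shtab T -> box T y j -> box T x j -> y <= x -> ent T y j <= ent T x j.
Proof.
move=> sT by_ bx; rewrite leq_eqVlt => /orP[/eqP -> //|yx].
by apply: ltnW; apply: (sh_in sT) => //; lia.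
Qed.

Lemma col_forward N T j a p v : col_state T j a p v -> 0 < a -> ncols T < N ->
  exists t, forward (add_outer T ((nrows T).+2, j) a) = Some t /\ col_next N T j a p v t.
Proof.
move=> inv a0 nN; have [sT j1 bp _ _] := inv.
have bd : narrower N T by move=> k l /box_ncols; lia.
have mn := nrows_ncols sT.
set m := (nrows T).+2.
have jn : j <= (ncols T).+1 by have := box_ncols bp; lia.
have jN := leq_trans jn nN.
have pT : (m, j) \notin domf T by apply/negP => /box_nrows; rewrite /m; lia.
have bU k l : box T.[(m, j) <- a] k l = ((k == m) && (l == j)) || box T k l by exact: box_set.
have eU k l : k < m -> ent T.[(m, j) <- a] k l = ent T k l.
  by move=> km; rewrite ent_set (ltn_eqF km).
have entm : entry T.[(m, j) <- a] (m, j) = a by rewrite /entry fnd_set eqxx.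
have bm k l : box T k l -> k < m by move/box_nrows; rewrite /m; lia.
rewrite /forward /add_outer /= rm_outer // ltn_eqF //; eexists; split; first by [].
rewrite /col_transition rm_outer // entm.
case: ifP => [/allP hmx|/negbT/allPn[[k l] qU]].
  have mx : colmax T j a.
    move=> k bk; have bkU : (k, j) \in domf T.[(m, j) <- a].
      by have : is_true (box T.[(m, j) <- a] k j); rewrite // bU bk orbT.
    by have := hmx _ bkU; rewrite /= eqxx -/(ent _ k j) eU // (bm _ _ bk).
  have [i fc] := firstcP T j; have [i0 ni hi] := fc.
  have im : i <= m.
    case: (ltnP 1 i) => h; last by rewrite /m; lia.
    have /box_nrows : box T i.-1 j by apply: hi; lia.
    by rewrite /m; lia.
  have bpd := sh_bd sT bp.
  have ij : i <= j.
    rewrite leqNgt; apply/negP => ji.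
    have bj : box T j j by apply: hi; lia.
    have bpj : box T p j by apply: (sh_dn sT bj); lia.
    have lt : ent T p j < ent T j j by apply: (sh_in sT) => //; lia.
    have [_ _ _ _ hb] := inv; have [h1 _] := hb bpj.
    by have := mx _ bj; rewrite leqNgt (leq_ltn_trans h1 lt).
  have iN := leq_trans ij jN.
  have im' : i != m.
    case: (ltnP 1 i) => h; last by rewrite /m; lia.
    have /box_nrows : box T i.-1 j by apply: hi; lia.
    by rewrite /m; lia.
  have -> : least (fun i0 => (i0, j) \notin domf T.[(m, j) <- a]) 1 m = i.
    apply: least_eq => [|| k /andP[k1 ki]]; first by rewrite i0.
      by have : is_true (~~ box T.[(m, j) <- a] i j); rewrite // bU (negbTE im').
    rewrite negbK; have : is_true (box T.[(m, j) <- a] k j); rewrite // bU hi ?orbT //.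
    by rewrite k1.
  have pos k l : box T.[(i, j) <- a] k l -> 0 < ent T.[(i, j) <- a] k l.
    by rewrite box_set ent_set; case: ifP => //= _ ; exact: sh_gt0.
  have pi : p < i -> [/\ i = j, 1 < i & ent T i.-1 j = a].
    move=> lt; have bpj : box T p j by apply: hi; lia.
    have [_ _ _ _ hb] := inv; have [h1 h2] := hb bpj; have h3 := mx _ bpj.
    have {h2} pj : ~~ (p.+1 < j) by apply/negP => /h2; rewrite ltnNge h3.
    have -> : i.-1 = p by lia.
    by split; [lia | lia | apply/eqP; rewrite eqn_leq h1 h3].
  case: ifP => [/(shtabP pos) sV|nV].
    have ip : i <= p.
      rewrite leqNgt; apply/negP => lt; have [ej i1 e] := pi lt.
      have := sh_in sV (i := i.-1) (j := j) (k := i) (l := j).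
      have b1 : box T i.-1 j by apply: hi; lia.
      rewrite !box_set !eqxx b1 orbT ent_same ent_other ?e; last by apply/eqP => -[]; lia.
      by move/(_ isT isT (leq_pred _) (leqnn _)); rewrite ltnn; lia.
    apply: (@CStop _ _ _ _ _ _ _ T.[(i, j) <- a]) => //=; first exact: ColC1.
    rewrite (col_reading_C1 _ _ sT bd fc iN ij jN); apply: esym; apply: row_word_col_word.
      exact: shtab_spread.
    exact: (sh_gt0 sV).
  have RC : act Theta_state (col_word N T) = act Theta_state (row_word N T).
    by apply: esym; apply: row_word_col_word; [exact: shtab_spread | exact: (sh_gt0 sT)].
  case: (boolP ((1 < i) && (ent T i.-1 j == a))) => [/andP[i1 /eqP e]|nh].
    apply: (@CStop _ _ _ _ _ _ _ T) => //=.
      by apply: ColC2 => //; [rewrite i1 | left].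
    by rewrite -RC; apply: (col_reading_C2h _ sT bd a0 fc iN ij jN i1 e).
  have ip : i <= p.
    by rewrite leqNgt; apply/negP => lt; have [_ i1 e] := pi lt; rewrite i1 e eqxx in nh.
  have lt : i < j by lia.
  have bl : box T i j.-1 by apply: (sh_dn sT bp); lia.
  have hd : 1 < i -> box T i.-1 j /\ ent T i.-1 j < a.
    move=> i1; have b : box T i.-1 j by apply: hi; lia.
    by split=> //; move: nh (mx _ b); rewrite i1 /= leq_eqVlt => /negbTE ->.
  have le : a <= ent T i j.-1.
    case: (leqP a (ent T i j.-1)) => // lt'; move/negP: nV; case; apply/(shtabP pos).
    by apply: shtab_new => //; rewrite i0.
  have [vv ep e] := col_state_vert inv bl hi (fun k _ => mx k) le.
  have i1 : 1 < i by have [_ _ _ hv _] := inv; move: hv; rewrite vv -ep => -[].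
  apply: (@CStop _ _ _ _ _ _ _ T) => //=.
    by apply: ColC2 => //; [rewrite i1 | right].
  rewrite -RC; apply: (col_reading_C2v _ sT bd a0 fc iN ij jN j1 bl e) => _.
  by case: (hd i1).
rewrite negb_imply -ltnNge /= => /andP[/eqP ek al]; subst l.
have km : k < m.
  have : is_true (box T.[(m, j) <- a] k j) by [].
  rewrite bU => /orP[/andP[/eqP e _]|]; last exact: bm.
  by move: al; rewrite e entm ltnn.
have bk : box T k j.
  by have : is_true (box T.[(m, j) <- a] k j) by []; rewrite bU (ltn_eqF km).
have {}al : a < ent T k j by rewrite -(eU _ _ km).
have [x lx] := leastcP bk al; have [bx ax mx] := lx.
have xm := bm _ _ bx; have hx := sh_bd sT bx.
have -> : least (fun x0 => ((x0, j) \in domf T.[(m, j) <- a]) &&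
    (a < entry T.[(m, j) <- a] (x0, j))) 1 m = x.
  apply: least_eq => [||y /andP[y1 yx]]; first lia.
    have : is_true (box T.[(m, j) <- a] x j && (a < ent T.[(m, j) <- a] x j)); last by [].
    by rewrite bU bx orbT eU.
  have : is_true (~~ (box T.[(m, j) <- a] y j && (a < ent T.[(m, j) <- a] y j))); last by [].
  have ym := ltn_trans yx xm.
  rewrite bU eU // (ltn_eqF ym) /=; apply/negP => /andP[by_ ay].
  by have := mx _ yx by_; rewrite leqNgt ay.
rewrite -/(ent _ x j) eU //.
have dom' : domf T.[(x, j) <- a] = domf T by exact: domf_upd.
have e0 := sh_gt0 sT bx; have bpd := sh_bd sT bp.
have next k' : x <= k' -> box T k' j.+1 -> ent T x j < ent T k' j.+1.
  by move=> xk b; apply: (sh_in sT) => //; lia.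
case: ifP => [/(shtab_of_incr sT bx a0) sV|ni].
  have lt y : y < x -> box T y j -> ent T y j < a.
    move=> yx b; have := sh_in sV (i := y) (j := j) (k := x) (l := j).
    rewrite !box_replace // ent_same ent_other; last by apply/eqP => -[]; lia.
    by apply => //; lia.
  apply: (@CNext _ _ _ _ _ _ _ T.[(x, j) <- a] (ent T x j) x false) => //=.
  - split => //=; rewrite ?box_replace ?ent_same //; first exact: ltnW.
    rewrite ent_other; last by apply/eqP => -[]; lia.
    by move=> b; split=> [|_]; [apply: ltnW|]; exact: next.
  - exact: col_reading_C4.
  - by move=> T1 r; exact: ColC4.
case: (boolP ((1 < x) && (ent T x.-1 j == a))) => [/andP[x1 /eqP e]|nh].
  apply: (@CNext _ _ _ _ _ _ _ T (ent T x j) x true) => //=.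
  - split => //=; first exact: ltnW.
    by move=> b; split=> [|_]; [apply: ltnW|]; exact: next.
  - exact: col_reading_C3h.
  - by move=> T1 r; apply: ColC3 => //; left.
have hd : 1 < x -> ent T x.-1 j < a.
  move=> x1; have b : box T x.-1 j by apply: (sh_dn sT bx); lia.
  have xx : x.-1 < x by lia.
  by move: nh (mx _ xx b); rewrite x1 /= leq_eqVlt => /negbTE ->.
have nV : ~ shtab T.[(x, j) <- a] by case=> _ _ /incrP; rewrite ni.
case: (ltnP x j) => xj; last first.
  by case: nV; apply: shtab_replace; rewrite // ?a0 // ltnNge xj.
have bl : box T x j.-1 by apply: (sh_dn sT bx); lia.
have le : a <= ent T x j.-1.
  case: (leqP a (ent T x j.-1)) => // lt'; case: nV.
  by apply: shtab_replace => //; rewrite a0.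
have hy y : 0 < y < x -> box T y j by move=> hy; apply: (sh_dn sT bx); clear -hy xj; lia.
have [vv ep e] := col_state_vert inv bl hy mx le.
have x1 : 1 < x by have [_ _ _ hv _] := inv; move: hv; rewrite vv -ep => -[].
apply: (@CNext _ _ _ _ _ _ _ T (ent T x j) x true) => //=.
- split => //=; first exact: ltnW.
  by move=> b; split=> [|_]; [apply: ltnW|]; exact: next.
- apply: (col_reading_C3v _ sT bd a0 lx j1 bl e) => y yx b.
  apply: leq_ltn_trans (hd x1); have b1 : box T x.-1 j.
    by apply: hy; clear -x1; lia.
  by apply: (ent_col_le sT b b1); clear -yx; lia.
- by move=> T1 r; apply: ColC3 => //; right.
Qed.

(** What is shown of an insertion path by induction from its end; X is N_Theta times
    the reading word of S, which all transitions preserve. *)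
Definition reaches N T1 r X (path : seq transition) (S : state) : Prop :=
  [/\ last S (map tr_target path) = terminal_state T1,
      exists t s, [/\ rev path = t :: s, tr_type t = r.1 & tr_label t = r.2] &
      X = act Theta_state (row_word N T1)].

Lemma follow_stop k T1 : follow k (terminal_state T1) = [::].
Proof. by case: k. Qed.

Lemma dom_rc (T' T : tableau) : domf T' = domf T -> nrows T' = nrows T /\ ncols T' = ncols T.
Proof. by move=> E; rewrite /nrows /ncols E. Qed.

Lemma follow1 k S t : forward S = Some t -> follow k.+1 S = t :: follow k (tr_target t).
Proof. by move=> /= ->. Qed.

Lemma reaches_step N T1 r X k S t S' : forward S = Some t -> tr_target t = S' ->
  reaches N T1 r X (follow k S') S' -> reaches N T1 r X (follow k.+1 S) S.
Proof.
move=> ft tt [h1 [t' [s [h2 h3 h4]]] h5].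
rewrite (follow1 _ ft) tt; split => //=; first by rewrite tt.
by exists t', (rcons s t); rewrite rev_cons h2.
Qed.

Lemma follow_col N k T j a p v : col_state T j a p v -> 0 < a -> ncols T < N ->
  (ncols T).+2 - j <= k ->
  exists T1 r, colins T j a p v T1 r /\
    reaches N T1 r (act Theta_state (col_reading N T j a)) (follow k (add_outer T ((nrows T).+2, j) a))
      (add_outer T ((nrows T).+2, j) a).
Proof.
elim: k T j a p v => [|k IH] T j a p v inv a0 nN hk.
  by have [_ _ bp _ _] := inv; have := box_ncols bp; lia.
have [t [ft [T1 tt ci eq|T' b x v' tt dT inv' b0 eq imp]]] := col_forward inv a0 nN.
  exists T1, (tr_type t, tr_label t); split => //.
  rewrite (follow1 _ ft) tt follow_stop; split => //=.
  by exists t, [::].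
have [nr nc] := dom_rc dT; rewrite -nc in nN.
have [|T1 [r [ci rc]]] := IH _ _ _ _ _ inv' b0 nN; first by rewrite nc; lia.
exists T1, r; split; first exact: imp.
by rewrite eq; apply: reaches_step ft tt _; rewrite -nr.
Qed.

Lemma follow_row N k T i a p v : row_state T i a p v -> 0 < a -> i <= (nrows T).+1 ->
  ncols T < N -> act Theta_state (row_reading N T i a) <> None ->
  ((nrows T).+2 - i) + (ncols T).+2 <= k ->
  exists T1 r, rowins T i a p v T1 r /\
    reaches N T1 r (act Theta_state (row_reading N T i a)) (follow k (add_outer T (i, (ncols T).+2) a))
      (add_outer T (i, (ncols T).+2) a).
Proof.
elim: k T i a p v => [|k IH] T i a p v inv a0 im nN nz hk; first by lia.
have [t [ft hn]] := row_forward inv a0 im nN nz.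
case: hn => [T1 tt ri eq|T' b x v' tt dT inv' b0 eq imp|T' c v' tt dT inv' c0 eq imp].
- exists T1, (tr_type t, tr_label t); split => //.
  rewrite (follow1 _ ft) tt follow_stop; split => //=.
  by exists t, [::].
- have [nr nc] := dom_rc dT; rewrite -nc in nN; rewrite eq in nz *.
  have im' : i.+1 <= (nrows T').+1.
    by have [_ _ hp _ _] := inv'; have [_ i0 _ _ _] := inv; have [//|bx _ _] := hp; exact: (box_nrows bx).
  have [|T1 [r [ci rc]]] := IH _ _ _ _ _ inv' b0 im' nN nz; first by rewrite nc nr; lia.
  exists T1, r; split; first exact: imp.
  by apply: reaches_step ft tt _; rewrite -nc.
- have [nr nc] := dom_rc dT; rewrite -nc in nN; rewrite eq in nz *.
  have [|T1 [r [ci rc]]] := @follow_col N k _ _ _ _ _ inv' c0 nN.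
    by rewrite nc; clear -hk im; lia.
  exists T1, r; split; first exact: imp.
  by apply: reaches_step ft tt _; rewrite -nr.
Qed.

Lemma row1_last T : shtab T -> least (fun j => (1, j) \notin domf T) 1 (ncols T).+1 = (ncols T).+1 /\
  least (fun j => (1, j) \notin domf T) (ncols T).+2 (ncols T).+2 = (ncols T).+2.
Proof.
move=> sT; have sh : shifted T by case: sT => h1 h2 _ _; exact: closed_shifted.
split; apply: least_eq; rewrite ?leqnn //.
- by rewrite shifted_row1 // ltnn.
- by move=> j; rewrite shifted_row1 // negbK ltnS.
- by rewrite shifted_row1 // negb_and orbC -ltnNge ltnW.
- by move=> j /andP[h1 h2]; move: (leq_ltn_trans h1 h2); rewrite ltnn.
Qed.

(** The insertion of a as computed by the transitions is described by [rowins], and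
    it preserves the action of the reading word. *)
Lemma insert_rowins N T a : shtab T -> (forall k, box T k k -> ~~ odd (ent T k k)) ->
  0 < a -> ncols T < N -> act Theta_state (row_word N T ++ [:: a]) <> None ->
  exists T1 r, [/\ rowins T 1 a (ncols T).+1 false T1 r, insertSp T a = T1,
    exists t s, [/\ rev (insertion_path T a) = t :: s, tr_type t = r.1 & tr_label t = r.2] &
    act Theta_state (row_word N T ++ [:: a]) = act Theta_state (row_word N T1)].
Proof.
move=> sT dg a0 nN nz.
have inv : row_state T 1 a (ncols T).+1 false by split => // /box_ncols; rewrite ltnn.
have W1 : row_reading N T 1 a = row_word N T ++ [:: a].
  by rewrite (@row_word_split _ _ 1) ?(leq_ltn_trans _ nN) // /row_reading /= !cats0 -catA.
rewrite -W1 in nz *.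
have [|T1 [r [ri [h1 h2 h3]]]] := @follow_row N ((nrows T).+2 + (ncols T).+2) _ _ _ _ _ inv a0 isT nN nz.
  by rewrite leq_add2r leq_subr.
have [l1 l2] := row1_last sT.
exists T1, r; split => //.
  by rewrite /insertSp /insertion_end /insertion_path /oplus l1 l2 h1.
by rewrite /insertion_path /oplus l1 l2.
Qed.

(** * Labels and recorded boxes *)

Definition top_of_col (T : tableau) c : nat := \max_(p <- domf T | p.2 == c) p.1.
Definition end_of_row (T : tableau) r : nat := \max_(p <- domf T | p.1 == r) p.2.

Lemma top_of_col_ge T k c : box T k c -> k <= top_of_col T c.
Proof. by move=> b; rewrite /top_of_col (big_rem (k, c)) //= eqxx leq_maxl. Qed.
Lemma end_of_row_ge T r l : box T r l -> l <= end_of_row T r.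
Proof. by move=> b; rewrite /end_of_row (big_rem (r, l)) //= eqxx leq_maxl. Qed.

Lemma max_mem (s : seq pos) (P : pred pos) (F : pos -> nat) p : p \in s -> P p ->
  exists2 q, q \in s & P q && (F q == \max_(x <- s | P x) F x).
Proof.
elim: s p => // x s IH p; rewrite inE big_cons => ps Pp.
case: (boolP (has P s)) => [/hasP[y ys Py]|hn].
  have [q qs /andP[Pq /eqP e]] := IH y ys Py; case: ifP => Px.
    case: (leqP (F x) (\max_(j <- s | P j) F j)) => h.
      by exists q; rewrite ?inE ?qs ?orbT // Pq e eqxx.
    by exists x; rewrite ?mem_head // Px eqxx.
  by exists q; rewrite ?inE ?qs ?orbT // Pq e eqxx.
have E : \max_(j <- s | P j) F j = 0.
  by rewrite big_seq_cond big1 // => j /andP[js Pj]; move/hasPn: hn => /(_ j js); rewrite Pj.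
have Ep : p = x.
  by case/orP: ps => [/eqP //|ps]; move/hasPn: hn => /(_ p ps); rewrite Pp.
by exists x; rewrite ?mem_head // -Ep Pp E maxn0 eqxx.
Qed.

Lemma top_of_col_box T k c : box T k c -> box T (top_of_col T c) c.
Proof.
move=> b; have [[i j] q /andP[/eqP /= e /eqP h]] :=
  @max_mem (domf T) (fun p => p.2 == c) fst (k, c) b (eqxx _).
by rewrite /top_of_col -h -e.
Qed.
Lemma end_of_row_box T r l : box T r l -> box T r (end_of_row T r).
Proof.
move=> b; have [[i j] q /andP[/eqP /= e /eqP h]] :=
  @max_mem (domf T) (fun p => p.1 == r) snd (r, l) b (eqxx _).
by rewrite /end_of_row -h -e.
Qed.

Definition recorded_box (T1 : tableau) (r : result) : pos :=
  match r.1 with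
  | R2 => (top_of_col T1 r.2.2.-1, r.2.2.-1)
  | C2 => (r.2.1.-1, end_of_row T1 r.2.1.-1)
  | _ => r.2
  end.

(** The three clauses in the definition of descents of a tableau, for a letter in box
    p followed by a letter in box q, where b and b' tell which of them is primed. *)
Definition descends (b : bool) (p : pos) (b' : bool) (q : pos) : bool :=
  [|| ~~ b && b', [&& ~~ b, ~~ b' & p.1 < q.1] | [&& b, b' & p.2 < q.2]].

Lemma later_descends T T1 T2 r r' : outcome_of T T1 r -> outcome_of T1 T2 r' -> later T1 r r' ->
  descends (prim r) (recorded_box T1 r) (prim r') (recorded_box T2 r').
Proof.
have ge_row (r0 : result) (T0 T3 : tableau) : outcome_of T0 T3 r0 -> ~~ prim r0 -> r0.2.1 <= (recorded_box T3 r0).1.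
  case: r0 => -[] [i j] //= [[_ _ hj] ij bb] _; apply: top_of_col_ge; rewrite bb; apply: hj; lia.
have ge_col (r0 : result) (T0 T3 : tableau) : outcome_of T0 T3 r0 -> prim r0 -> r0.2.2 <= (recorded_box T3 r0).2.
  case: r0 => -[] [i j] //= [[_ _ hj] ij bb] _; apply: end_of_row_ge; rewrite bb; apply: hj; lia.
move=> h1 h2; rewrite /later /descends; case: (boolP (prim r)) => pr /=.
  case=> pr' hl; rewrite pr' /=; apply: leq_trans (ge_col _ _ _ h2 pr'); apply: hl.
  case: r pr h1 => -[] [i j] //= _; rewrite /endrow /=.
    by case=> _ _ ->; rewrite !eqxx.
  case=> [[_ _ hj] ij bb]; apply: (@end_of_row_box _ _ j); rewrite bb; apply: hj; lia.
case: (boolP (prim r')) => pr' //= [//|hl]; rewrite orbF.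
apply: leq_trans (ge_row _ _ _ h2 pr'); apply: hl.
case: r pr h1 => -[] [i j] //= _; rewrite /endcol /=.
  by case=> _ ->; rewrite !eqxx.
case=> [[_ _ hj] ij bb]; apply: (@top_of_col_box _ i); rewrite bb; apply: hj; lia.
Qed.

(** A letter recorded after R2 or C2 sits at the end of a column or of a row rather
    than at the label.  If the second label is in an earlier line, its line ends no
    later, since the shape is closed downwards and the line of the first label ends
    at the recorded box. *)
Lemma earlier_descends T T1 T2 r r' : shtab T -> shtab T1 -> outcome_of T T1 r -> outcome_of T1 T2 r' ->
  earlier r r' -> ~~ descends (prim r) (recorded_box T1 r) (prim r') (recorded_box T2 r').
Proof.
move=> sT sT1; rewrite /earlier /descends; case: r r' => ty [i j] [ty' [i' j']].
case: ty => //=; case: ty' => //=; rewrite ?orbF //= -?leqNgt /recorded_box /=.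
- by move=> _ _ [].
- move=> [[ij nj hj] bb] [[ij' nj' hj'] ltj bb'] [_ ii].
  have := @top_of_col_box T2 i' j'.-1; set k := top_of_col _ _.
  have b0 : box T2 i' j'.-1 by rewrite bb'; apply: hj'; lia.
  have hb0 : 0 < i' by rewrite bb' in b0; case/andP: (sh_bd sT1 b0).
  move=> /(_ b0); rewrite bb' => bk.
  have hk := sh_bd sT1 bk; rewrite leqNgt; apply/negP => ik.
  have bij : box T1 i j by rewrite bb !eqxx.
  have hij := sh_bd sT1 bij.
  have b1 : box T1 i j'.-1 by apply: (sh_dn sT1 bk); lia.
  have j1 : j'.-1 <= j.
    rewrite leqNgt; apply/negP => jj; move: b1; rewrite bb (gtn_eqF jj) andbF /= => b1.
    by move/negP: nj; apply; apply: (sh_dn sT b1); lia.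
  case: (ltngtP j'.-1 j) j1 => // [jj _|jj _].
    by move/negP: nj'; apply; apply: (sh_dn sT1 bij); lia.
  move: bk; rewrite bb jj (gtn_eqF ik) /= => bk.
  by move/negP: nj; apply; apply: (sh_dn sT bk); lia.
- by move=> _ _ [].
- by move=> _ _ [].
- move=> [[ij nj hj] lt bb] [[ij' nj' hj'] bb'] [_ ii]; apply: leq_trans ii _.
  by apply: top_of_col_ge; rewrite bb; apply: hj; lia.
- move=> [[ij nj hj] lt bb] [[ij' nj' hj'] ltj bb'] [_ ii].
  have := @top_of_col_box T2 i' j'.-1; set k := top_of_col T2 _.
  have b0 : box T2 i' j'.-1 by rewrite bb'; apply: hj'; lia.
  have hb0 : 0 < i' by rewrite bb' in b0; case/andP: (sh_bd sT1 b0).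
  move=> /(_ b0); rewrite bb' => bk.
  have hk := sh_bd sT1 bk.
  have bij : box T1 i j.-1 by rewrite bb; apply: hj; lia.
  have hi := top_of_col_ge bij.
  case: (leqP k i) => ki; first by apply: leq_trans hi.
  have b1 : box T1 i j'.-1 by apply: (sh_dn sT1 bk); lia.
  have jj : j'.-1 < j.
    rewrite ltnNge; apply/negP => jj; move: b1; rewrite bb => b1.
    by move/negP: nj; apply; apply: (sh_dn sT b1); lia.
  case: (ltnP j' j) => jj'; last by apply: top_of_col_ge; have -> : j.-1 = j'.-1 by lia.
  have b2 : box T1 i j' by rewrite bb; apply: hj; lia.
  by move/negP: nj'; case; apply: (sh_dn sT1 b2); lia.
- by move=> _ _ [].
- by move=> _ _ [].
- by move=> _ _ /(_ isT).
- move=> [[i0 nj hj] ij bb] [[i0' nj' hj'] ltj bb'] /(_ isT) ii.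
  have := @end_of_row_box T2 i'.-1 j'; set c := end_of_row _ _.
  have b0 : box T2 i'.-1 j' by rewrite bb'; apply: hj'; lia.
  move=> /(_ b0); rewrite bb' => bk.
  have hk := sh_bd sT1 bk; rewrite leqNgt; apply/negP => jc.
  have bij : box T1 i j by rewrite bb !eqxx.
  have b1 : box T1 i'.-1 j by apply: (sh_dn sT1 bk); lia.
  have i1 : i'.-1 <= i.
    rewrite leqNgt; apply/negP => iix; move: b1; rewrite bb (gtn_eqF iix) /= => b1.
    by move/negP: nj; apply; apply: (sh_dn sT b1); lia.
  case: (ltngtP i'.-1 i) i1 => // [iix _|iix _].
    by move/negP: nj'; apply; apply: (sh_dn sT1 bij); lia.
  move: bk; rewrite bb iix (gtn_eqF jc) andbF /= => bk.
  by move/negP: nj; apply; apply: (sh_dn sT bk); lia.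
- move=> [[i0 nj hj] lt bb] [[i0' nj' hj'] ltj bb'] /(_ isT) ii; apply: leq_trans ii _.
  by apply: end_of_row_ge; rewrite bb; apply: hj; lia.
- move=> [[i0 nj hj] lt bb] [[i0' nj' hj'] ltj bb'] /(_ isT) ii.
  have := @end_of_row_box T2 i'.-1 j'; set c := end_of_row T2 _.
  have b0 : box T2 i'.-1 j' by rewrite bb'; apply: hj'; lia.
  move=> /(_ b0); rewrite bb' => bk.
  have hk := sh_bd sT1 bk.
  apply: end_of_row_ge; case: (ltnP i' i) => ix.
    have b1 : box T1 i' j by rewrite bb; apply: hj; lia.
    by move/negP: nj'; case; apply: (sh_dn sT1 b1); lia.
  by apply: (sh_dn sT1 bk); lia.
Qed.

Lemma consecutive_descends T a p T1 r b q T2 r' : shtab T ->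
  rowins T 1 a p false T1 r -> rowins T1 1 b q false T2 r' ->
  descends (prim r) (recorded_box T1 r) (prim r') (recorded_box T2 r') = (b < a).
Proof.
move=> sT h1 h2; have [sT1 rr _ _] := rowins_outcome h1; have [_ rr' _ _] := rowins_outcome h2.
have sm k l : agree_from b.+1 T1 T1 k l by left.
case: (ltnP b a) => ab.
  by apply: later_descends rr rr' _; apply: (rowins_lt h1 h2).
by apply: negbTE; apply: (earlier_descends sT sT1 rr rr'); apply: (rowins_le h1 h2).
Qed.

(** * Insertion of a word *)

Definition prefix_P w k := PSp (take k w).

Definition outcome w k : result :=
  if rev (insertion_path (prefix_P w k) (nth 0 w k)) is t :: _
  then (tr_type t, tr_label t) else (R1, (0, 0)).

Lemma prefix_PS w k : k < size w -> prefix_P w k.+1 = insertSp (prefix_P w k) (nth 0 w k).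
Proof. by move=> h; rewrite /prefix_P (take_nth 0 h) /PSp foldl_rcons. Qed.

Lemma row_word_nil N : row_word N [fmap] = [::].
Proof.
have : all pred0 (row_word N [fmap]) by apply: all_rows => i j _; rewrite /box inE.
by case: (row_word N _).
Qed.

Lemma box_empty i j : box [fmap] i j = false.
Proof. by rewrite /box inE. Qed.

Lemma shtab_empty : shtab [fmap].
Proof. by split=> [i j|i j k l|i j k l|i j]; rewrite box_empty. Qed.

(** The invariant: insertion of the first k letters of w gives a tableau whose
    reading word acts on N_Theta as these letters do. *)
Lemma prefix_P_good w k : all (leq 1) w -> act Theta_state w <> None -> k <= size w ->
  [/\ shtab (prefix_P w k), (forall i, box (prefix_P w k) i i -> ~~ odd (ent (prefix_P w k) i i)) &
      exists N0, forall N, N0 <= N -> act Theta_state (row_word N (prefix_P w k)) = act Theta_state (take k w)].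
Proof.
move=> w1 nz; elim: k => [|k IH] kw.
  rewrite /prefix_P take0; split; first exact: shtab_empty.
    by move=> i; rewrite box_empty.
  by exists 0 => N _; rewrite row_word_nil.
have [sT dg [N0 hN]] := IH (ltnW kw).
have a0 : 0 < nth 0 w k by apply: (allP w1); apply: mem_nth.
have E N : N0 <= N -> act Theta_state (row_word N (prefix_P w k) ++ [:: nth 0 w k]) = act Theta_state (take k.+1 w).
  by move=> h; rewrite act_cat hN // (take_nth 0 kw) -cats1 act_cat.
have nz' : act Theta_state (take k.+1 w) <> None.
  by move=> h; apply: nz; rewrite -(cat_take_drop k.+1 w) act_cat h act_None.
have good N : N0 <= N -> ncols (prefix_P w k) < N ->
    shtab (prefix_P w k.+1) /\ act Theta_state (row_word N (prefix_P w k.+1)) = act Theta_state (take k.+1 w).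
  move=> h1 h2; have [|T1 [r [ri eT _ e]]] := insert_rowins sT dg a0 h2; first by rewrite E.
  by rewrite prefix_PS // eT -e E //; have [sT1 _ _ _] := rowins_outcome ri; split.
have good' N : maxn N0 (ncols (prefix_P w k)).+1 <= N ->
    shtab (prefix_P w k.+1) /\ act Theta_state (row_word N (prefix_P w k.+1)) = act Theta_state (take k.+1 w).
  by rewrite geq_max => /andP[h1 h2]; exact: good.
have sT1 := (good' _ (leqnn _)).1.
split => //; last by exists (maxn N0 (ncols (prefix_P w k)).+1) => N /good' [].
pose N := maxn (maxn N0 (ncols (prefix_P w k)).+1) (ncols (prefix_P w k.+1)).+1.
apply: (@diag_even N) => //.
  by move=> i j /box_ncols h; rewrite /N; lia.
by rewrite (good' N _).2 // leq_maxl.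
Qed.

Lemma prefix_P_step w k : all (leq 1) w -> act Theta_state w <> None -> k < size w ->
  exists p, rowins (prefix_P w k) 1 (nth 0 w k) p false (prefix_P w k.+1) (outcome w k) /\
    exists t s, [/\ rev (insertion_path (prefix_P w k) (nth 0 w k)) = t :: s,
      tr_type t = (outcome w k).1 & tr_label t = (outcome w k).2].
Proof.
move=> w1 nz kw; have [sT dg [N0 hN]] := prefix_P_good w1 nz (ltnW kw).
have a0 : 0 < nth 0 w k by apply: (allP w1); apply: mem_nth.
pose N := maxn N0 (ncols (prefix_P w k)).+1.
have [||T1 [[ty lab] [ri e [t [s [h1 h2 h3]]] _]]] := @insert_rowins N _ (nth 0 w k) sT dg a0.
- by rewrite leq_maxr.
- rewrite act_cat hN ?leq_maxl // -act_cat cats1 -(take_nth 0 kw).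
  by move=> h; apply: nz; rewrite -(cat_take_drop k.+1 w) act_cat h act_None.
exists (ncols (prefix_P w k)).+1; rewrite prefix_PS // e /outcome h1.
by rewrite h2 h3; split => //; exists t, s; split.
Qed.

Definition prefix_Q w k : sv_tableau :=
  foldl (fun Q k => record_step Q k (insertion_path (PSp (take k.-1 w)) (nth 0 w k.-1)))
    [fmap] (iota 1 k).

Lemma prefix_QS w k : prefix_Q w k.+1 =
  record_step (prefix_Q w k) k.+1 (insertion_path (prefix_P w k) (nth 0 w k)).
Proof.
have E : iota 1 k.+1 = iota 1 k ++ [:: k.+1] by rewrite -[in LHS](addn1 k) iotaD add1n.
by rewrite /prefix_Q E foldl_cat.
Qed.

Definition place w k : pos := recorded_box (prefix_P w k.+1) (outcome w k).

Lemma fset1U_mem (D : {fset pos}) p : p \in D -> p |` D = D.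
Proof. by move=> pD; apply/fsetP => q; rewrite !inE; case: eqP => // ->. Qed.

Lemma record_stepE (T T1 : tableau) r Q k path : outcome_of T T1 r ->
  (exists t s, [/\ rev path = t :: s, tr_type t = r.1 & tr_label t = r.2]) ->
  domf Q = domf T ->
  record_step Q k path = add_letter Q (recorded_box T1 r) (k, prim r) /\
  domf (add_letter Q (recorded_box T1 r) (k, prim r)) = domf T1.
Proof.
move=> rr [t [s [h1 h2 h3]]] dQ.
rewrite /record_step h1 h2 h3; case: r rr {h2 h3} => -[] [i j] //=.
- case=> _ bb; split => //; apply/fsetP => -[k' l']; rewrite !inE dQ.
  by rewrite -[RHS]/(box T1 k' l') bb xpair_eqE.
- case=> [[_ _ hj] lt bb]; have dT1 : domf T1 = domf T by apply/fsetP => -[k' l']; exact: bb.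
  have b : box T1 i j.-1 by rewrite bb; apply: hj; lia.
  have b1 := top_of_col_box b.
  rewrite /recorded_box /= /last_in_col dQ /top_of_col dT1; split => //.
  by apply: fset1U_mem; move: b1; rewrite /box /top_of_col /end_of_row dT1.
- case=> _ _ bb; split => //; apply/fsetP => -[k' l']; rewrite !inE dQ.
  by rewrite -[RHS]/(box T1 k' l') bb xpair_eqE.
- case=> [[_ _ hj] lt bb]; have dT1 : domf T1 = domf T by apply/fsetP => -[k' l']; exact: bb.
  have b : box T1 i.-1 j by rewrite bb; apply: hj; lia.
  have b1 := end_of_row_box b.
  rewrite /recorded_box /= /last_in_row dQ /end_of_row dT1; split => //.
  by apply: fset1U_mem; move: b1; rewrite /box /top_of_col /end_of_row dT1.
Qed.

Lemma sv_entry_add Q p x q : sv_entry (add_letter Q p x) q =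
  if q == p then x |` sv_entry Q p else sv_entry Q q.
Proof. by rewrite /sv_entry /add_letter fnd_set; case: eqP. Qed.

Lemma sv_size_add Q p x : x \notin sv_entry Q p -> sv_size (add_letter Q p x) = (sv_size Q).+1.
Proof.
move=> nx.
have E : sv_size Q = \sum_(q <- p |` domf Q) #|` sv_entry Q q|.
  case: (boolP (p \in domf Q)) => pQ.
    by rewrite /sv_size; congr bigop; congr enum_fset; apply/fsetP => q; rewrite !inE; case: eqP => // ->.
  by rewrite big_fsetU1 //= /sv_size {2}/sv_entry not_fnd // cardfs0 add0n.
rewrite E /sv_size dom_setf (big_fsetD1 p) ?fset1U1 //= [in RHS](big_fsetD1 p) ?fset1U1 //=.
rewrite sv_entry_add eqxx cardfsU1 nx -addSn add1n; congr addn.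
apply: eq_big_seq => q; rewrite !inE => /andP[qp _].
by rewrite sv_entry_add (negbTE qp).
Qed.

(** The shapes of the insertion tableau and of the recording tableau agree, and every
    letter is in exactly one box. *)
Lemma prefix_Q_letters w k : all (leq 1) w -> act Theta_state w <> None -> k <= size w ->
  [/\ domf (prefix_Q w k) = domf (prefix_P w k), sv_size (prefix_Q w k) = k &
    forall p x, (x \in sv_entry (prefix_Q w k) p) <->
      exists2 m, m < k & x = (m.+1, prim (outcome w m)) /\ p = place w m].
Proof.
move=> w1 nz; elim: k => [|k IH] kw.
  rewrite /prefix_P take0 /prefix_Q /=; split => //.
    by rewrite /sv_size big_nil.
  by move=> p x; rewrite /sv_entry fnd_fmap0 inE; split => // -[].
have [dQ sz mem] := IH (ltnW kw); rewrite prefix_QS.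
have [p0 [ri hp]] := prefix_P_step w1 nz kw; have [_ rr _ _] := rowins_outcome ri.
have [-> dQ'] := record_stepE k.+1 rr hp dQ; split => //.
  rewrite sv_size_add ?sz //; apply/negP => /mem [m mk [[em _] _]].
  by move: mk; rewrite em ltnn.
move=> p x; rewrite sv_entry_add; case: eqP => [->|np].
  rewrite !inE; split.
    case/orP => [/eqP ->|/mem [m mk [-> e]]]; first by exists k.
    by exists m => //; apply: ltnW.
  case=> m; rewrite ltnS leq_eqVlt => /orP[/eqP -> [-> _]|mk [-> e]]; first by rewrite eqxx.
  by apply/orP; right; apply/mem; exists m.
split; first by case/mem => m mk h; exists m => //; apply: ltnW.
case=> m; rewrite ltnS leq_eqVlt => /orP[/eqP -> [_ e]|mk h]; first by case: np.
by apply/mem; exists m.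
Qed.

Lemma appearP Q x y R p q :
  (forall p', x \in sv_entry Q p' -> p' = p) -> (forall q', y \in sv_entry Q q' -> q' = q) ->
  appear Q x y R = [&& x \in sv_entry Q p, y \in sv_entry Q q & R p q].
Proof.
move=> hx hy; have dom z r : z \in sv_entry Q r -> r \in domf Q.
  by rewrite /sv_entry; case: fndP => // _; rewrite inE.
apply/hasP/and3P => [[p' _ /andP[xp /hasP[q' _ /andP[yq r]]]]|[xp yq r]].
  by rewrite -(hx _ xp) -(hy _ yq).
exists p; first exact: dom xp; rewrite xp /=; apply/hasP.
by exists q; [exact: dom yq | rewrite yq].
Qed.

Theorem theorem4p4 (w : seq nat) :
  symplectic_Hecke_word w -> word_Des w = tab_Des (QSp w).
Proof.
case/symplectic_act => w1 nz.
have [dQ sz mem] := prefix_Q_letters w1 nz (leqnn _).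
have -> : QSp w = prefix_Q w (size w) by [].
apply/fsetP => i; rewrite /word_Des /tab_Des sz !inE; apply: andb_id2l => hi'.
have {hi'} hi : i \in iota 1 (size w).-1 := hi'; rewrite mem_iota in hi.
case: i hi => // m; rewrite add1n => hi; have {hi} mw : m.+1 < size w by lia.
have [p [ri _]] := prefix_P_step w1 nz (ltnW mw); have [q [ri' _]] := prefix_P_step w1 nz mw.
have [sT _ _] := prefix_P_good w1 nz (ltnW (ltnW mw)).
rewrite [m.+1.-1]/= -(consecutive_descends sT ri ri') -/(place w m) -/(place w m.+1).
have hm n b p' : n < size w -> ((n.+1, b) \in sv_entry (prefix_Q w (size w)) p') =
    (b == prim (outcome w n)) && (p' == place w n).
  move=> nw; apply/idP/andP => [/mem [k kw [[-> ->] ->]] //|[/eqP -> /eqP ->]].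
  by apply/mem; exists n.
have mw' := ltnW mw.
rewrite !(appearP _ (p := place w m) (q := place w m.+1)) ?hm ?eqxx ?andbT //;
  try by move=> p'; rewrite hm // => /andP[_ /eqP].
Qed.
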